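(* Suppose that: (i) there is $C>0$ with $|b_{k,0}(x)-b_{k,0}(y)|\le C|x-y|$ for all $x,y\in\mathbb{R}^k$; $\sup_{t\ge 0}\mathbb{E}[|f_{k,t}|^\ell]<\infty$ for all $\ell\ge 0$; and $b_{k,0}\in C^4_\uparrow(\mathbb{R}^k)$; (ii) $f_{k,t}$ is ergodic with invariant measure $\pi_{f,k}$, i.e. for every $\pi_{f,k}$-integrable $g$, $\frac1T\int_0^T g(f_{k,t})\,dt\to\int g\,d\pi_{f,k}$ in probability as $T\to\infty$; (iii) there is $C>0$ with $|B_{i,0}(x)-B_{i,0}(y)|\le C|x-y|$ for all $x,y\in\mathbb{R}$ and $i=1,\dots,p$; $\sup_{t\ge0}\mathbb{E}[|e_t|^\ell]<\infty$ for all $\ell\ge0$; and $B_{i,0}\in C^4_\uparrow(\mathbb{R})$ for $i=1,\dots,p$; (iv) $\sigma_i>0$ ($i=1,\dots,p$) for every $\theta_k\in\Theta_k$; (v) $e_t$ is ergodic with invariant measure $\pi_e$, i.e. for every $\pi_e$-integrable $g$, $\frac1T\int_0^T g(e_t)\,dt\to\int g\,d\pi_e$ in probability as $T\to\infty$; (vi) for $\theta_k\in\Theta_k$, $\Sigma_k(\theta_k)=\Sigma_k(\theta_{k,0})$ implies $\theta_k=\theta_{k,0}$; (vii) $\mathrm{rank}\,\Delta_k=q_k$. Then, as $n\to\infty$ with $h_n\to0$ and $nh_n\to\infty$, $$\hat\theta_{k,n}\to\theta_{k,0}\quad\text{in probability.}$$ If moreover $nh_n^2\to0$, then $$\sqrt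 n(\hat\theta_{k,n}-\theta_{k,0})\to N_{q_k}\big(0,(\Delta_k^\top W_k^{-1}(\theta_{k,0})\Delta_k)^{-1}\big)\quad\text{in distribution.}$$
   Context: Fix integers $1\le k<p$ and $r\ge1$. Parameter: $\theta_k=(\mathrm{vec}(A_k)^\top,\mathrm{vech}(\Sigma_{ff,k})^\top,\sigma_1^2,\dots,\sigma_p^2)^\top\in\Theta_k\subset\mathbb{R}^{q_k}$, where $A_k\in\mathbb{R}^{(p-k)\times k}$, $\Sigma_{ff,k}=S_kS_k^\top$ with $S_k\in\mathbb{R}^{k\times r}$, $q_k=(p-k)k+\frac{k(k+1)}2+p$, and $\Theta_k$ is convex and compact. $\Lambda_k\in\mathbb{R}^{p\times k}$ has top block $I_k$ and bottom block $A_k$, and $\Sigma_k(\theta_k)=\Lambda_k\Sigma_{ff,k}\Lambda_k^\top+\mathrm{diag}(\sigma_1^2,\dots,\sigma_p^2)$. The true parameter is $\theta_{k,0}\in\mathrm{Int}(\Theta_k)$, with components $A_{k,0},\Sigma_{ff,k,0}=S_{k,0}S_{k,0}^\top,\sigma_{i,0}^2$ and loading matrix $\Lambda_{k,0}$. The observed process is $X_t=\Lambda_{k,0}f_{k,t}+e_t$, $t\ge0$, with $df_{k,t}=b_{k,0}(f_{k,t})dt+S_{k,0}dW_t$, $f_{k,0}=c_1\in\mathbb{R}^k$, and $de^{(i)}_t=B_{i,0}(e^{(i)}_t)dt+\sigma_{i,0}dB^{(i)}_t$ ($i=1,\dots,p$), $e_0=c_2\in\mathbb{R}^p$; $W$ is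 an $r$-dimensional standard Wiener process, $B^{(1)},\dots,B^{(p)}$ are independent one-dimensional standard Wiener processes independent of $W$; $b_{k,0}:\mathbb{R}^k\to\mathbb{R}^k$, $B_{i,0}:\mathbb{R}\to\mathbb{R}$; initial values are deterministic. Observations are $X_{t_i^n}$, $t_i^n=ih_n$, $0\le i\le n$, $T=nh_n$, and $Q_{XX}=\frac1T\sum_{i=1}^n(X_{t_i^n}-X_{t_{i-1}^n})(X_{t_i^n}-X_{t_{i-1}^n})^\top$. $\bar p=p(p+1)/2$; vec and vech are vectorization and half-vectorization; $D_p$ is the $p^2\times\bar p$ duplication matrix ($\mathrm{vec}A=D_p\mathrm{vech}A$ for symmetric $A$), $D_p^+=(D_p^\top D_p)^{-1}D_p^\top$, $W_k(\theta_k)=2D_p^+(\Sigma_k(\theta_k)\otimes\Sigma_k(\theta_k))D_p^{+\top}$. $\Delta_k$ is the $\bar p\times q_k$ Jacobian of $\theta_k\mapsto\mathrm{vech}(\Sigma_k(\theta_k))$ at $\theta_{k,0}$. The contrast function is $F_{k,n}(Q_{XX},\Sigma_k(\theta_k))=(\mathrm{vech}(Q_{XX})-\mathrm{vech}(\Sigma_k(\theta_k)))^\top W_k^{-1}(\theta_k)(\mathrm{vech}(Q_{XX})-\mathrm{vech}(\Sigma_k(\theta_k)))$, and the estimator $\hat\theta_{k,n}$ is a minimizer of $\theta_k\mapsto F_{k,n}(Q_{XX},\Sigma_k(\theta_k))$ over $\Theta_k$. $C^4_\uparrow(\mathbb{R}^d)$ is the set of functions that are four times continuously differentiable and that, together with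 all derivatives up to order 4, have polynomial growth, i.e. are bounded in absolute value by $C(1+|x|)^C$ for some $C>0$ (componentwise for vector-valued functions). *)

(* Defs.v *)
From HB Require Import structures.
From mathcomp Require Import all_boot all_order all_algebra.
From mathcomp Require Import mxtens.
From mathcomp Require Import all_classical all_reals all_analysis.

Set Implicit Arguments.
Unset Strict Implicit.
Unset Printing Implicit Defensive.

Import Order.TTheory GRing.Theory Num.Theory.
Import numFieldNormedType.Exports.

Local Open Scope classical_set_scope.
Local Open Scope ring_scope.

Section vectorization.
Context {R : realType}.

(* [mxvec] stacks rows; [vec] stacks columns. *)
Definition vec m n (A : 'M[R]_(m, n)) : 'cV[R]_(n * m) := (mxvec A^T)^T.

Definition unvec m n (v : 'cV[R]_(n * m)) : 'M[R]_(m, n) := (vec_mx v^T)^T.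

Lemma vecK m n : cancel (@vec m n) (@unvec m n).
Proof. by move=> A; rewrite /unvec /vec trmxK mxvecK trmxK. Qed.

Lemma unvecK m n : cancel (@unvec m n) (@vec m n).
Proof. by move=> v; rewrite /unvec /vec trmxK vec_mxK trmxK. Qed.

Definition vech_dim (n : nat) : nat := (n * n.+1)./2.

(* Positions (column, row) on or below the diagonal.  The column comes first,
   so that the lexicographic enumeration of pairs is column-major. *)
Definition lower n : pred ('I_n * 'I_n) := [pred c : 'I_n * 'I_n | (c.1 <= c.2)%N].

Lemma card_lower n : vech_dim n = #|@lower n|.
Proof.
rewrite -sum1_card (eq_bigl (fun c : 'I_n * 'I_n => (c.1 <= c.2)%N)) //.
rewrite -(pair_big_dep xpredT (fun i j : 'I_n => (i <= j)%N)
  (fun _ _ => 1%N)) /= (exchange_big_dep xpredT) //=.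
have E (j : 'I_n) : (\sum_(i < n | (i <= j)%N) 1 = j.+1)%N.
  rewrite (eq_bigl (fun i : 'I_n => (i < j.+1)%N)) //.
  by rewrite (big_ord_narrow (ltn_ord j)) sum1_card card_ord.
rewrite (eq_bigr (fun j : 'I_n => j.+1)) //.
elim: n {E} => [|n IH]; first by rewrite big_ord0.
rewrite big_ord_recr -IH /vech_dim.
have -> : (n.+1 * n.+2 = n.+1.*2 + n * n.+1)%N.
  by rewrite -muln2 [(n * _)%N]mulnC -mulnDr add2n.
by rewrite halfD odd_double doubleK add0n addnC.
Qed.

Definition lower_pos n (s : 'I_(vech_dim n)) : 'I_n * 'I_n :=
  enum_val (cast_ord (card_lower n) s).

Definition vech n (A : 'M[R]_n) : 'cV[R]_(vech_dim n) :=
  \col_s A (lower_pos s).2 (lower_pos s).1.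

(* Column s of the duplication matrix is the vectorization of the symmetric
   0/1 matrix supported at the s-th lower position and its mirror image. *)
Definition dup n : 'M[R]_(n * n, vech_dim n) :=
  \matrix_(a, s)
    vec (\matrix_(i, j) (((j, i) == lower_pos s) || ((i, j) == lower_pos s))%:R
         : 'M[R]_n) a 0.

Lemma vec_dup n (A : 'M[R]_n) : A^T = A -> vec A = dup n *m vech A.
Proof.
move=> symA; apply/colP => a; rewrite !mxE.
case/mxvec_indexP: a => j i; rewrite mxvecE mxE.
pose c : 'I_n * 'I_n := if (j <= i)%N then (j, i) else (i, j).
have cl : c \in @lower n.
  rewrite /c unfold_in; case: ifP => //= /negbT.
  by rewrite -ltnNge => /ltnW.
pose s : 'I_(vech_dim n) := cast_ord (esym (card_lower n)) (enum_rank_in cl c).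
have sE : lower_pos s = c.
  by rewrite /lower_pos /s cast_ordKV enum_rankK_in.
have inj : injective (@lower_pos n).
  by move=> x y /enum_val_inj/cast_ord_inj.
rewrite (bigD1 s) //= big1 => [|t ts].
  rewrite !mxE mxvecE !mxE sE addr0 /c.
  case: ifP => _ /=; rewrite eqxx ?orbT mul1r //.
  by rewrite -{1}symA mxE.
rewrite !mxE mxvecE !mxE.
case: eqP => [e|_] /=.
  have /= := enum_valP (cast_ord (card_lower n) t).
  rewrite -/(lower_pos t) -e unfold_in /= => ji.
  by case/eqP: ts; apply: inj; rewrite -e sE /c ji.
case: eqP => [e|_] /=; last by rewrite mul0r.
have /= := enum_valP (cast_ord (card_lower n) t).
rewrite -/(lower_pos t) -e unfold_in /= => ij.
case/eqP: ts; apply: inj; rewrite -e sE /c; case: ifP => // ji.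
by have /val_inj -> : i = j :> nat by apply/eqP; rewrite eqn_leq ij ji.
Qed.

Definition unvech n (v : 'cV[R]_(vech_dim n)) : 'M[R]_n := unvec (dup n *m v).

Lemma vechK n (A : 'M[R]_n) : A^T = A -> unvech (vech A) = A.
Proof. by move=> symA; rewrite /unvech -vec_dup // vecK. Qed.

Definition dup_pinv n : 'M[R]_(vech_dim n, n * n) :=
  invmx ((dup n)^T *m dup n) *m (dup n)^T.

Definition enorm n (x : 'cV[R]_n) : R := Num.sqrt (\sum_i x i 0 ^+ 2).

End vectorization.

(* q_k, the length of (vec A, vech Sigma_ff, sigma_1^2, ..., sigma_p^2). *)
Definition param_dim (p k : nat) : nat := (k * (p - k) + vech_dim k + p)%N.

Section model.
Context {R : realType} (p k : nat).
Implicit Type theta : 'cV[R]_(param_dim p k).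

Definition par_A theta : 'M[R]_(p - k, k) := unvec (usubmx (usubmx theta)).

Definition par_Sff theta : 'M[R]_k := unvech (dsubmx (usubmx theta)).

Definition par_sigma2 theta : 'cV[R]_p := dsubmx theta.

Definition par_sigma theta (i : 'I_p) : R := Num.sqrt (par_sigma2 theta i 0).

(* [conform_mx] only transports along k + (p - k) = p, which holds as k < p. *)
Definition Lambda theta : 'M[R]_(p, k) :=
  conform_mx 0 (col_mx 1%:M (par_A theta)).

Definition Sigma theta : 'M[R]_p :=
  Lambda theta *m par_Sff theta *m (Lambda theta)^T
  + diag_mx (par_sigma2 theta)^T.

Definition Wmx theta : 'M[R]_(vech_dim p) :=
  2%:R *: (dup_pinv p *m tensmx (Sigma theta) (Sigma theta)
           *m (dup_pinv p)^T).

Definition Delta theta : 'M[R]_(vech_dim p, param_dim p k) :=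
  \matrix_(i, j)
    'D_(delta_mx j 0) (fun th : 'cV[R]_(param_dim p k) => vech (Sigma th) i 0)
      theta.

Definition contrast (Q : 'M[R]_p) theta : R :=
  let u := vech Q - vech (Sigma theta) in
  (u^T *m invmx (Wmx theta) *m u) 0 0.

End model.

Definition realized_cov {R : realType} p (h : R) (n : nat) (x : R -> 'cV[R]_p)
    : 'M[R]_p :=
  (n%:R * h)^-1 *:
    \sum_(i < n) (let dx := x (i.+1%:R * h) - x (i%:R * h) in dx *m dx^T).

Section regularity.
Context {R : realType}.

Fixpoint partials d (s : seq 'I_d) (g : 'cV[R]_d -> R) : 'cV[R]_d -> R :=
  if s is i :: s' then fun x => 'D_(delta_mx i 0) (partials s' g) x else g.

Definition C4up d (g : 'cV[R]_d -> R) : Prop :=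
  [/\ forall (s : seq 'I_d) i x, (size s < 4)%N ->
        derivable (partials s g) x (delta_mx i 0),
      forall s : seq 'I_d, (size s <= 4)%N -> continuous (partials s g) &
      forall s : seq 'I_d, (size s <= 4)%N ->
        exists2 C : R, 0 < C &
          forall x, `|partials s g x| <= C * (1 + enorm x) `^ C].

Definition C4up1 (g : R -> R) : Prop :=
  [/\ forall j x, (j < 4)%N -> derivable (derive1n j g) x 1,
      forall j, (j <= 4)%N -> continuous (derive1n j g) &
      forall j, (j <= 4)%N ->
        exists2 C : R, 0 < C & forall x, `|(derive1n j g) x| <= C * (1 + `|x|) `^ C].

End regularity.

Definition borel (R : realType) (n : nat) :=
  g_sigma_algebraType (@open 'cV[R]_n).

Section probability.
Context {R : realType} (d : measure_display) (Om : measurableType d)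
  (P : probability Om R).

Definition indep_family (I : finType) (G : I -> set (set Om)) : Prop :=
  forall (J : {set I}) (A : I -> set Om),
    (forall i, i \in J -> G i (A i)) ->
    P (\bigcap_(i in [set` J]) A i) = (\prod_(i in J) P (A i))%E.

Definition sigma_process (d' : measure_display) (E : measurableType d')
    (D : set R) (Z : R -> Om -> E) : set (set Om) :=
  <<s [set Z t @^-1` A | t in D & A in measurable] >>.

(* The second argument of [normal_prob] is the standard deviation. *)
Definition wiener (Z : R -> Om -> R) : Prop :=
  [/\ forall t, 0 <= t -> measurable_fun setT (Z t),
      {ae P, forall w, Z 0 w = 0},
      {ae P, forall w, {within `[0, +oo[, continuous (Z ^~ w)}},
      forall s t A, 0 <= s -> s < t -> measurable A ->
        P ((fun w => Z t w - Z s w) @^-1` A)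
        = normal_prob 0 (Num.sqrt (t - s)) A &
      forall s t (A : set Om) (B : set R), 0 <= s -> s < t ->
        sigma_process `[0, s] Z A -> measurable B ->
        let inc := (fun w => Z t w - Z s w) @^-1` B in
        P (A `&` inc) = (P A * P inc)%E].

Definition wiener_vec r (W : R -> Om -> 'cV[R]_r) : Prop :=
  (forall j, wiener (fun t w => W t w j 0)) /\
  indep_family (fun j => sigma_process `[0, +oo[ (fun t w => W t w j 0)).

(* dZ_t = drift_t dt + dN_t, Z_0 = z0.  All diffusion coefficients below are
   constant, so the stochastic integral is N_t itself (with N_0 = 0) and the
   equation is pathwise. *)
Definition solves_sde (z0 : R) (drift N Z : R -> Om -> R) : Prop :=
  {ae P, forall w, {within `[0, +oo[, continuous (Z ^~ w)} /\
    forall t, 0 <= t ->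
      Z t w = z0 + \int[lebesgue_measure]_(s in `[0, t]) drift s w + N t w}.

Definition bounded_moments n (Z : R -> Om -> 'cV[R]_n) : Prop :=
  forall l : R, 0 <= l ->
    (ereal_sup [set 'E_P[fun w => (enorm (Z t w) `^ l)%R] | t in `[0%R, +oo[]
     < +oo)%E.

(* The outer measure agrees with P on events, and makes sense of variables that
   are measurable only up to null sets. *)
Definition cvg_prob (I : Type) (F : set_system I) (V : normedZmodType R)
    (Y : I -> Om -> V) (c : V) : Prop :=
  forall eps : R, 0 < eps ->
    mu_ext P [set w | eps <= `|Y i w - c|] @[i --> F] --> 0%E.

(* The time average only makes sense if g is integrable along almost every
   path on compact time intervals, which does not follow from pi-integrability
   (take g singular at the deterministic starting point). *)
Definition ergodic n (Z : R -> Om -> 'cV[R]_n)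
    (pi : probability (borel R n) R) : Prop :=
  forall g : borel R n -> R,
    pi.-integrable setT (EFin \o g) ->
    (forall T : R, 0 < T -> {ae P, forall w,
       lebesgue_measure.-integrable `[0, T] (fun t => (g (Z t w))%:E)}) ->
    cvg_prob (pinfty_nbhs R)
      (fun T w => T^-1 * \int[lebesgue_measure]_(t in `[0, T]) g (Z t w))
      (\int[pi]_x g x).

End probability.

Section gaussian.
Context {R : realType}.

(* [normal_prob m 0] is not the point mass at m. *)
Definition normal1 (m v : R) (A : set R) : \bar R :=
  if v == 0 then \d_m A else normal_prob m (Num.sqrt v) A.

(* N_n(m, V), possibly degenerate: every linear form u^T x is normal with mean
   u^T m and variance u^T V u. *)
Definition is_normal n (m : 'cV[R]_n) (V : 'M[R]_n)
    (mu : probability (borel R n) R) : Prop :=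
  forall (u : 'cV[R]_n) (A : set R), measurable A ->
    mu [set x : 'cV[R]_n | A ((u^T *m x) 0 0)]
    = normal1 ((u^T *m m) 0 0) ((u^T *m V *m u) 0 0) A.

Definition cvg_to_normal (d : measure_display) (Om : measurableType d)
    (P : probability Om R) n (Z : nat -> Om -> 'cV[R]_n)
    (m : 'cV[R]_n) (V : 'M[R]_n) : Prop :=
  exists2 mu : probability (borel R n) R, is_normal m V mu &
    forall g : 'cV[R]_n -> R, continuous g ->
      (exists M : R, forall x, `|g x| <= M) ->
      'E_P[fun w => g (Z i w)]%E @[i --> \oo] --> (\int[mu]_x (g x)%:E)%E.

End gaussian.

(* Main.v *)
(* Over a step of length h the increment of X is the load matrix L applied to the
   noise increment, plus a drift of order h that is known at the beginning of the
   step up to an error of order h^(3/2).  The cross terms between noise and drift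
   are therefore martingale differences up to O(h), and
     Q_XX = Sigma_0 + (1/n) sum_i q(xi_i) + O(sqrt(h/n)) + O(h),
   where the xi_i are independent standard Gaussian vectors and q is a centred
   quadratic form determined by L.  When n h^2 -> 0 only the Gaussian average
   survives at the scale 1/sqrt n; by Isserlis' formula its covariance is W.

   Compactness, identifiability and the uniform positive definiteness of W^-1
   make the minimizer of the contrast a continuous function of Q_XX at Sigma_0.
   Comparing the contrast at the minimizer with its value at the weighted least
   squares prediction shows that, up to o(|vech Q_XX - vech Sigma_0|),
     theta_hat - theta_0 =
       (Delta^T W^-1 Delta)^-1 Delta^T W^-1 (vech Q_XX - vech Sigma_0).

   The limit law is identified by E cos(u^T Z_n + c): a Taylor expansion with a
   third moment bound gives the central limit theorem for these transforms, and
   Bernstein polynomials in (1 + sin)/2 approximate a bounded continuous function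
   on a large box by bounded trigonometric polynomials. *)

(* The processes come as measurable families obeying a pathwise equation; neither adaptedness to the
   noise nor joint measurability in time and chance is given. Adaptedness, on which the
   orthogonality of the cross terms rests, is recovered from the Lipschitz condition through Euler
   schemes, and moments of time integrals are bounded through Riemann sums and Fatou's lemma instead
   of an exchange of integrals. The limit law is realized on the same space: unit increments of one
   driving Wiener process are independent standard normal variables, and the additivity of its
   increments gives the law of their linear forms without convolving densities. [W] occurs as weight
   of the contrast and as covariance of the fluctuations; both are tied by one formula, which writes
   [u^T W v] as twice the entrywise product of two matrices [L^T M L], with [M] dual to [u] or to
   [v]. [W] is nondegenerate thanks to the idiosyncratic variances alone, so the rank of [S] is
   free. The deterministic part measures vectors by the squared Euclidean norm [sq]: its estimates
   are then polynomial, and Young's inequality does the work of Cauchy-Schwarz. *)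
Require Import Defs.
From HB Require Import structures.
From mathcomp Require Import all_boot all_order all_algebra.
From mathcomp Require Import mxtens.
From mathcomp Require Import all_classical all_reals all_analysis.
From mathcomp Require Import measurable_realfun.
From mathcomp Require Import ring lra.

Set Implicit Arguments.
Unset Strict Implicit.
Unset Printing Implicit Defensive.

Import Order.TTheory GRing.Theory Num.Theory.
Import numFieldNormedType.Exports.

Local Open Scope classical_set_scope.
Local Open Scope ring_scope.

(** * Vectorization and the covariance structure *)

Section tensor_index.

(** The product list is row-major: every entry of [s1] before [x] contributes a full block of length
    [size s2]. *)
Lemma index_allpairs (T1 T2 : eqType) (s1 : seq T1) (s2 : seq T2) x y :
  x \in s1 -> y \in s2 ->
  index (x, y) [seq (a, b) | a <- s1, b <- s2] =
  (index x s1 * size s2 + index y s2)%N.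
Proof.
move=> + ys2; elim: s1 => //= a s1 IH.
rewrite inE index_cat size_map.
have [->|xa /= xs1] := eqVneq x a => /=.
  move=> _; rewrite map_f// mul0n add0n.
  by rewrite (index_map (f := fun b => (a, b))) // => u v [].
rewrite ifF.
  by rewrite IH // mulSn addnA.
by apply/mapP => -[b _ [e _]]; rewrite e eqxx in xa.
Qed.

(** One index is a rank in the enumeration of pairs, the other is given by arithmetic. Identifying
    them is what lets Kronecker products act on [vec]. *)
Lemma mxvec_tens_index m n (i : 'I_m) (j : 'I_n) :
  mxvec_index i j = mxtens_index (i, j).
Proof.
apply: val_inj => /=.
have E : index (i, j) (enum (('I_m * 'I_n)%type : finType)) = enum_rank (i, j).
  rewrite -[X in index X _](nth_enum_rank (i, j) (i, j)) index_uniq ?enum_uniq//.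
  by rewrite -cardE.
rewrite -[LHS]E enumT unlock /= /prod_enum index_allpairs ?mem_enum//.
by rewrite size_enum_ord !index_enum_ord.
Qed.

End tensor_index.

Section vech_algebra.
Context {R : realType}.

Lemma vecE m n (A : 'M[R]_(m, n)) i j : vec A (mxvec_index j i) 0 = A i j.
Proof. by rewrite !mxE mxvecE mxE. Qed.

Lemma unvecE m n (v : 'cV[R]_(n * m)) i j :
  unvec v i j = v (mxvec_index j i) 0.
Proof. by rewrite !mxE. Qed.

Lemma lower_pos_inj n : injective (@lower_pos n).
Proof. by move=> x y /enum_val_inj/cast_ord_inj. Qed.

Lemma lower_posP n (s : 'I_(vech_dim n)) : ((lower_pos s).1 <= (lower_pos s).2)%N.
Proof. by have := enum_valP (cast_ord (card_lower n) s); rewrite unfold_in. Qed.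

Lemma dupE n (i j : 'I_n) s : dup n (mxvec_index j i) s =
  (((j, i) == lower_pos s) || ((i, j) == lower_pos s))%:R :> R.
Proof. by rewrite mxE vecE mxE. Qed.

Lemma unvec_dup_sym n (v : 'cV[R]_(vech_dim n)) :
  (unvec (dup n *m v))^T = unvec (dup n *m v).
Proof.
apply/matrixP => i j; rewrite mxE !unvecE !mxE; apply: eq_bigr => s _.
by rewrite !dupE orbC.
Qed.

Lemma vech_unvec_dup n (v : 'cV[R]_(vech_dim n)) :
  vech (unvec (dup n *m v)) = v.
Proof.
apply/colP => s; rewrite mxE unvecE mxE (bigD1 s)//= dupE -surjective_pairing.
rewrite eqxx mul1r big1 ?addr0// => t ts; rewrite dupE -surjective_pairing.
rewrite (inj_eq (@lower_pos_inj n)) [s == t]eq_sym (negbTE ts) /=.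
(* If the mirror image of position [s] is again a lower position [t], then [s] is diagonal and
   [t = s], which is excluded. *)
case: eqP => [e|]; last by rewrite mul0r.
have := lower_posP t; rewrite -e /= => le21.
have e12 : (lower_pos s).1 = (lower_pos s).2.
  by apply/val_inj/eqP; rewrite eqn_leq le21 lower_posP.
case/eqP: ts; apply: lower_pos_inj; rewrite -e.
by case: (lower_pos s) e12 => /= a b ->.
Qed.

Lemma vech_inj_sym n (A B : 'M[R]_n) : A^T = A -> B^T = B ->
  vech A = vech B -> A = B.
Proof. by move=> sA sB e; rewrite -[A]vechK// -[B]vechK// e. Qed.

Definition sq n (u : 'cV[R]_n) : R := \sum_i u i 0 ^+ 2.

Lemma sq_ge0 n (u : 'cV[R]_n) : 0 <= sq u.
Proof. by apply: sumr_ge0 => i _; exact: sqr_ge0. Qed.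

Lemma sqE n (u : 'cV[R]_n) : (u^T *m u) 0 0 = sq u.
Proof. by rewrite mxE; apply: eq_bigr => i _; rewrite mxE -expr2. Qed.

Lemma sq_eq0 n (u : 'cV[R]_n) : sq u = 0 -> u = 0.
Proof.
move=> /eqP; rewrite psumr_eq0 => [/allP u0|i _]; last exact: sqr_ge0.
apply/colP => i; rewrite mxE; apply/eqP.
by have := u0 i (mem_index_enum i); rewrite /= sqrf_eq0.
Qed.

(** If [v A A^T = 0] then [v A A^T v^T], the squared norm of [v A], vanishes. *)
Lemma gram_unit m n (A : 'M[R]_(m, n)) : row_free A -> A *m A^T \in unitmx.
Proof.
move=> rA; rewrite -row_free_unit -kermx_eq0; apply/rowV0P => v /sub_kermxP.
move=> vAA; apply: (row_free_inj rA); rewrite mul0mx.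
have : sq (v *m A)^T = 0.
  by rewrite -sqE trmxK trmx_mul mulmxA -(mulmxA v) vAA mul0mx mxE.
by move/sq_eq0/(congr1 trmx); rewrite trmxK trmx0.
Qed.

(** [vech] recovers [v] from [dup n *m v], so [dup] has independent columns and its Gram matrix is
    invertible. *)
Lemma dup_pinvK n : dup_pinv n *m dup n = 1%:M :> 'M[R]_(vech_dim n).
Proof.
rewrite /dup_pinv -mulmxA mulVmx// -{2}[dup n]trmxK; apply: gram_unit.
rewrite -kermx_eq0; apply/rowV0P => v /sub_kermxP /(congr1 trmx).
rewrite trmx_mul trmxK trmx0 => dv0; apply: trmx_inj.
rewrite -[LHS]vech_unvec_dup dv0 trmx0; apply/colP => s.
by rewrite mxE unvecE !mxE.
Qed.

Lemma vech_dup_pinv n (A : 'M[R]_n) : A^T = A -> vech A = dup_pinv n *m vec A.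
Proof. by move=> sA; rewrite vec_dup// mulmxA dup_pinvK mul1mx. Qed.

(** The transpose of [dup_pinv] factors through [dup], whose range consists of vectorized symmetric
    matrices. *)
Lemma dup_pinv_sym n (u : 'cV[R]_(vech_dim n)) :
  (unvec ((dup_pinv n)^T *m u))^T = unvec ((dup_pinv n)^T *m u).
Proof.
have -> : (dup_pinv n)^T *m u =
    dup n *m ((invmx ((dup n)^T *m dup n : 'M[R]_(vech_dim n)))^T *m u).
  by rewrite trmx_mul [_^T^T]trmxK mulmxA.
exact: unvec_dup_sym.
Qed.

(* [u^T vech A] is the trace pairing of [A] with this symmetric matrix. *)
Definition vech_dual n (u : 'cV[R]_(vech_dim n)) : 'M[R]_n :=
  unvec ((dup_pinv n)^T *m u).

Lemma vech_dualE n (u : 'cV[R]_(vech_dim n)) (A : 'M[R]_n) : A^T = A ->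
  (u^T *m vech A) 0 0 = \sum_i \sum_j vech_dual u i j * A i j.
Proof.
move=> sA; rewrite vech_dup_pinv// mulmxA mxE.
rewrite (reindex (fun c : 'I_n * 'I_n => mxvec_index c.1 c.2)) /=; last first.
  apply: onW_bij; have [g gK Kg] := curry_mxvec_bij n n.
  by exists g => [[a b]|c]; [exact: (gK (a, b))|rewrite -[RHS]Kg; case: (g c)].
rewrite exchange_big pair_bigA /=; apply: eq_bigr => -[j i] _ /=.
rewrite vecE /vech_dual unvecE; congr (_ * _).
by rewrite -[in LHS](trmxK (dup_pinv n)) -trmx_mul mxE.
Qed.

Lemma tensmxE_vec m n p q (A : 'M[R]_(m, n)) (B : 'M[R]_(p, q)) i j k l :
  tensmx A B (mxvec_index i k) (mxvec_index j l) = A i j * B k l.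
Proof. by rewrite !mxvec_tens_index tensmxE. Qed.

End vech_algebra.

(** * Kronecker squares acting on vectorized matrices *)

Section tens_form.
Context {R : realType}.

Lemma sum_mxvec m n (F : 'I_(m * n) -> R) :
  \sum_a F a = \sum_(i < m) \sum_(j < n) F (mxvec_index i j).
Proof.
rewrite pair_bigA /= (reindex (fun c : 'I_m * 'I_n => mxvec_index c.1 c.2)) //=.
apply: onW_bij; have [g gK Kg] := curry_mxvec_bij m n.
by exists g => [[a b]|c]; [exact: (gK (a, b))|rewrite -[RHS]Kg; case: (g c)].
Qed.

(** This is the transposed form of the Kronecker identity for [vec] of a product of three
    matrices. *)
Lemma tens_form m n (L : 'M[R]_(m, n)) (M : 'M[R]_m) (v : 'cV[R]_(m * m)) :
  v = vec M ->
  (v^T *m tensmx L L) = (vec (L^T *m M *m L))^T.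
Proof.
move=> ->; apply/rowP => c; case/mxvec_indexP: c => a b.
rewrite [RHS]mxE vecE mxE sum_mxvec mxE /=.
apply: eq_bigr => j _; rewrite mxE mulr_suml; apply: eq_bigr => i _.
by rewrite [X in X * _]mxE vecE tensmxE_vec mxE mulrCA mulrA mulrC mulrA mulrAC.
Qed.

(** By the mixed product rule, the Kronecker square of a right inverse is a right inverse of the
    Kronecker square. *)
Lemma row_free_tens m n (L : 'M[R]_(m, n)) (L' : 'M[R]_(n, m)) :
  L *m L' = 1%:M -> row_free (tensmx L L).
Proof.
move=> LL; apply/row_freeP; exists (tensmx L' L'); rewrite tensmx_mul LL.
apply/matrixP => x y; case/mxvec_indexP: x => i j; case/mxvec_indexP: y => k l.
rewrite tensmxE_vec !mxE -natrM mulnb; congr (_%:R).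
have [g gK _] := curry_mxvec_bij m m.
congr (nat_of_bool _); apply/andP/eqP => [[/eqP-> /eqP->]//|/(congr1 g)].
by rewrite (gK (i, j) isT) (gK (k, l) isT) => -[-> ->]; rewrite !eqxx.
Qed.

End tens_form.

(** * The diffusion load and the factorization of the weight matrix *)

Section model_algebra.
Context {R : realType} (p k r : nat).
Hypothesis hkp : (k < p)%N.
Implicit Type theta : 'cV[R]_(param_dim p k).

(* [X] has diffusion coefficient [load S theta], acting on the stacked noise
   [(W, B)]. *)
Definition load (S : 'M[R]_(k, r)) theta : 'M[R]_(p, r + p) :=
  row_mx (Lambda theta *m S) (diag_mx (\row_i par_sigma theta i)).

(** A right inverse of [load] that uses the idiosyncratic noises only: they already reach every
    direction, whatever [S] is. *)
Definition load_inv theta : 'M[R]_(r + p, p) :=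
  col_mx 0 (diag_mx (\row_i (par_sigma theta i)^-1)).

Lemma load_mul_inv S theta : (forall i, 0 < par_sigma theta i) ->
  load S theta *m load_inv theta = 1%:M.
Proof.
move=> s0; rewrite mul_row_col mulmx0 add0r mulmx_diag.
apply/matrixP => i j; rewrite !mxE; case: eqP => // _.
by rewrite mulfV// gt_eqF.
Qed.

Lemma par_sigma_sqr theta i : 0 < par_sigma theta i ->
  par_sigma theta i ^+ 2 = par_sigma2 theta i 0.
Proof. by move=> s0; rewrite sqr_sqrtr// ltW// -sqrtr_gt0. Qed.

Lemma Sigma_load S theta : par_Sff theta = S *m S^T ->
  (forall i, 0 < par_sigma theta i) ->
  Sigma theta = load S theta *m (load S theta)^T.
Proof.
move=> hS s0; rewrite /Sigma hS /load tr_row_mx mul_row_col trmx_mul !mulmxA.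
congr (_ + _); rewrite tr_diag_mx mulmx_diag; congr diag_mx.
by apply/rowP => i; rewrite [LHS]mxE -par_sigma_sqr// !mxE expr2.
Qed.

Lemma Sigma_sym theta : (Sigma theta)^T = Sigma theta.
Proof.
rewrite /Sigma linearD /= tr_diag_mx !trmx_mul trmxK mulmxA; congr (_ *m _ *m _ + _).
exact: unvec_dup_sym.
Qed.

Definition Wroot S theta := dup_pinv p *m tensmx (load S theta) (load S theta).

Lemma Wmx_root S theta : par_Sff theta = S *m S^T ->
  (forall i, 0 < par_sigma theta i) ->
  Wmx theta = 2%:R *: (Wroot S theta *m (Wroot S theta)^T).
Proof.
move=> hS s0; rewrite /Wmx /Wroot (Sigma_load hS s0) -tensmx_mul.
by rewrite [(_ *m tensmx _ _)^T]trmx_mul trmx_tens !mulmxA.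
Qed.

(** Both factors are right invertible, [dup_pinv] by [dup] and the Kronecker square because [load]
    is. *)
Lemma Wroot_free S theta : (forall i, 0 < par_sigma theta i) ->
  row_free (Wroot S theta).
Proof.
move=> s0; rewrite -kermx_eq0; apply/rowV0P => v /sub_kermxP.
rewrite mulmxA => v0.
have f := row_free_tens (load_mul_inv S s0).
have /(row_free_inj f) : v *m dup_pinv p *m tensmx (load S theta) (load S theta)
   = 0 *m tensmx (load S theta) (load S theta) by rewrite mul0mx.
by move/(congr1 (mulmx^~ (dup p))); rewrite -mulmxA dup_pinvK mulmx1 mul0mx.
Qed.

Lemma Wmx_unit (S : 'M[R]_(k, r)) theta : par_Sff theta = S *m S^T ->
  (forall i, 0 < par_sigma theta i) -> Wmx theta \in unitmx.
Proof.
move=> hS s0; rewrite (Wmx_root hS s0) unitmxZ ?unitfE ?pnatr_eq0//.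
exact/gram_unit/Wroot_free.
Qed.

Lemma Wmx_sym theta : (Wmx theta)^T = Wmx theta.
Proof.
rewrite /Wmx linearZ /=.
rewrite [(_ *m (dup_pinv p)^T)^T]trmx_mul [(_ *m tensmx _ _)^T]trmx_mul.
by rewrite [_^T^T]trmxK trmx_tens Sigma_sym mulmxA.
Qed.

(** The right-hand side has the shape of the covariance of two centred quadratic forms in
    independent standard normal variables, with coefficient matrices [L^T M L]. This is how the
    limit variance is recognized as [Wmx]; it also shows that [Wmx] is nonnegative. *)
Lemma Wmx_form S theta (u v : 'cV[R]_(vech_dim p)) : par_Sff theta = S *m S^T ->
  (forall i, 0 < par_sigma theta i) ->
  (u^T *m Wmx theta *m v) 0 0 =
  2 * \sum_c \sum_d
    ((load S theta)^T *m vech_dual u *m load S theta) c d *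
    ((load S theta)^T *m vech_dual v *m load S theta) c d.
Proof.
move=> hS s0; rewrite (Wmx_root hS s0) -scalemxAr -scalemxAl mxE; congr (_ * _).
have T w : w^T *m Wroot S theta =
    (vec ((load S theta)^T *m vech_dual w *m load S theta))^T.
  rewrite mulmxA -[dup_pinv p]trmxK -trmx_mul; apply: tens_form.
  by rewrite /vech_dual unvecK.
have -> : u^T *m (Wroot S theta *m (Wroot S theta)^T) *m v =
    (u^T *m Wroot S theta) *m (v^T *m Wroot S theta)^T.
  by rewrite [in RHS]trmx_mul trmxK !mulmxA.
rewrite !T mxE sum_mxvec.
rewrite exchange_big; apply: eq_bigr => i _; apply: eq_bigr => j _.
by rewrite [X in X * _]mxE vecE trmxK vecE.
Qed.

End model_algebra.

(** * Weighted least squares *)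

Section quadratic_forms.
Context {R : realType}.

Lemma sqN n (u : 'cV[R]_n) : sq (- u) = sq u.
Proof. by apply: eq_bigr => i _; rewrite mxE sqrrN. Qed.

Lemma sqZ n a (u : 'cV[R]_n) : sq (a *: u) = a ^+ 2 * sq u.
Proof. by rewrite /sq mulr_sumr; apply: eq_bigr => i _; rewrite mxE exprMn. Qed.

Lemma sqD_le n (u v : 'cV[R]_n) : sq (u + v) <= 2 * sq u + 2 * sq v.
Proof.
rewrite /sq !mulr_sumr -big_split; apply: ler_sum => i _ /=; rewrite mxE.
by have := sqr_ge0 (u i 0 - v i 0); nra.
Qed.

Lemma sqB_le n (u v : 'cV[R]_n) : sq (u - v) <= 2 * sq u + 2 * sq v.
Proof. by rewrite -(sqN v); exact: sqD_le. Qed.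

Lemma ge_coord_sq n (u : 'cV[R]_n) i : u i 0 ^+ 2 <= sq u.
Proof.
by rewrite /sq (bigD1 i)//= lerDl; apply: sumr_ge0 => j _; exact: sqr_ge0.
Qed.

Lemma mxnorm_sq n (u : 'cV[R]_n) : `|u| ^+ 2 <= sq u.
Proof.
have [->|u0] := eqVneq `|u| 0; first by rewrite expr0n /= sq_ge0.
have [[i j] /= e] := mx_norm_neq0 u0.
by rewrite {1}/Num.Def.normr /= e real_normK ?num_real// (ord1 j) ge_coord_sq.
Qed.

Lemma coord_mxnorm m n (A : 'M[R]_(m, n)) i j : `|A i j| <= `|A|.
Proof.
rewrite {2}/Num.Def.normr /= mx_normrE.
exact: (le_bigmax _ (fun ij : 'I_m * 'I_n => `|A ij.1 ij.2|) (i, j)).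
Qed.

Lemma sq_mxnorm n (u : 'cV[R]_n) : sq u <= n%:R * `|u| ^+ 2.
Proof.
have -> : n%:R * `|u| ^+ 2 = \sum_(i < n) `|u| ^+ 2.
  by rewrite sumr_const card_ord mulr_natl.
apply: ler_sum => i _; rewrite -[leLHS]real_normK ?num_real//.
by rewrite lerXn2r ?nnegrE// coord_mxnorm.
Qed.

Definition mxsum m n (M : 'M[R]_(m, n)) : R := \sum_i \sum_j `|M i j|.

Lemma mxsum_ge0 m n (M : 'M[R]_(m, n)) : 0 <= mxsum M.
Proof. by do 2![apply: sumr_ge0 => ? _]. Qed.

Lemma bilin_formE m n (u : 'cV[R]_m) (M : 'M[R]_(m, n)) (v : 'cV[R]_n) :
  (u^T *m M *m v) 0 0 = \sum_i \sum_j M i j * (u i 0 * v j 0).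
Proof.
rewrite mxE exchange_big; apply: eq_bigr => j _; rewrite mxE mulr_suml.
by apply: eq_bigr => i _; rewrite mxE mulrCA mulrA.
Qed.

(** Young's inequality, entry by entry. The free weight [t] lets a small vector be balanced against
    a merely bounded one. *)
Lemma form_bound m n (u : 'cV[R]_m) (M : 'M[R]_(m, n)) (v : 'cV[R]_n) t :
  0 < t ->
  `|(u^T *m M *m v) 0 0| <= mxsum M * (t * sq u + t^-1 * sq v).
Proof.
move=> t0; rewrite bilin_formE (le_trans (ler_norm_sum _ _ _))//.
rewrite /mxsum mulr_suml; apply: ler_sum => i _.
rewrite (le_trans (ler_norm_sum _ _ _))// mulr_suml; apply: ler_sum => j _.
rewrite normrM ler_wpM2l// normrM.
have ui := ge_coord_sq u i; have vj := ge_coord_sq v j.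
rewrite -[u i 0 ^+ 2]real_normK ?num_real// in ui.
rewrite -[v j 0 ^+ 2]real_normK ?num_real// in vj.
have ti : 0 < t^-1 by rewrite invr_gt0.
have tt : t * t^-1 = 1 by rewrite mulfV// gt_eqF.
move: `|u i 0| `|v j 0| (normr_ge0 (u i 0)) (normr_ge0 (v j 0)) ui vj.
move=> a b a0 b0 ui vj.
have h : 0 <= t * (a - t^-1 * b) ^+ 2 by rewrite mulr_ge0 ?sqr_ge0// ltW.
have e : t * (a - t^-1 * b) ^+ 2 = t * a ^+ 2 - 2 * (a * b) + t^-1 * b ^+ 2.
  by field; rewrite gt_eqF.
have h1 : t * a ^+ 2 <= t * sq u by rewrite ler_pM2l.
have h2 : t^-1 * b ^+ 2 <= t^-1 * sq v by rewrite ler_pM2l.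
have h3 := mulr_ge0 a0 b0.
by rewrite e in h; lra.
Qed.

Lemma form_bound1 n (u : 'cV[R]_n) (M : 'M[R]_n) :
  `|(u^T *m M *m u) 0 0| <= 2 * mxsum M * sq u.
Proof. by have := form_bound u M u ltr01; rewrite invr1; lra. Qed.

Lemma sq_mulmx m n (A : 'M[R]_(m, n)) (u : 'cV[R]_n) :
  sq (A *m u) <= 2 * mxsum (A^T *m A) * sq u.
Proof.
have -> : sq (A *m u) = (u^T *m (A^T *m A) *m u) 0 0.
  by rewrite -sqE trmx_mul !mulmxA.
exact: le_trans (ler_norm _) (form_bound1 _ _).
Qed.

(** [v] is recovered from [D v] by the bounded left inverse [(D^T D)^-1 D^T]. The [+ 1] in the
    constant keeps it positive even if that inverse is the zero matrix. *)
Lemma sq_mulmx_ge m n (D : 'M[R]_(m, n)) : row_free D^T ->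
  exists2 d : R, 0 < d & forall v, d * sq v <= sq (D *m v).
Proof.
move=> fD; have uD : D^T *m D \in unitmx by rewrite -{2}[D]trmxK gram_unit.
pose A := invmx (D^T *m D) *m D^T; pose C := 2 * mxsum (A^T *m A) + 1.
have C0 : 0 < C by have := mxsum_ge0 (A^T *m A); rewrite /C; lra.
exists C^-1 => [|v]; first by rewrite invr_gt0.
have -> : sq v = sq (A *m (D *m v)) by rewrite /A -mulmxA (mulmxA D^T) mulKmx.
rewrite ler_pdivrMl// (le_trans (sq_mulmx _ _))//.
by rewrite ler_wpM2r ?sq_ge0// /C; lra.
Qed.

Lemma bilin_formD n (u v : 'cV[R]_n) (M : 'M[R]_n) :
  ((u + v)^T *m M *m (u + v)) 0 0 =
  (u^T *m M *m u) 0 0 + (u^T *m M *m v) 0 0 + (v^T *m M *m u) 0 0 +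
  (v^T *m M *m v) 0 0.
Proof.
rewrite !bilin_formE -!big_split; apply: eq_bigr => i _ /=.
rewrite -!big_split; apply: eq_bigr => j _ /=; rewrite !mxE; ring.
Qed.

Lemma bilin_formNl m n (u : 'cV[R]_m) (M : 'M[R]_(m, n)) (v : 'cV[R]_n) :
  ((- u)^T *m M *m v) 0 0 = - (u^T *m M *m v) 0 0.
Proof.
rewrite !bilin_formE -sumrN; apply: eq_bigr => i _; rewrite -sumrN.
by apply: eq_bigr => j _; rewrite mxE mulNr mulrN.
Qed.

Lemma bilin_formNr m n (u : 'cV[R]_m) (M : 'M[R]_(m, n)) (v : 'cV[R]_n) :
  (u^T *m M *m (- v)) 0 0 = - (u^T *m M *m v) 0 0.
Proof.
rewrite !bilin_formE -sumrN; apply: eq_bigr => i _; rewrite -sumrN.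
by apply: eq_bigr => j _; rewrite mxE !mulrN.
Qed.

Lemma bilin_formZl m n a (u : 'cV[R]_m) (M : 'M[R]_(m, n)) (v : 'cV[R]_n) :
  ((a *: u)^T *m M *m v) 0 0 = a * (u^T *m M *m v) 0 0.
Proof.
rewrite !bilin_formE mulr_sumr; apply: eq_bigr => i _; rewrite mulr_sumr.
by apply: eq_bigr => j _; rewrite mxE; ring.
Qed.

Lemma bilin_formZr m n a (u : 'cV[R]_m) (M : 'M[R]_(m, n)) (v : 'cV[R]_n) :
  (u^T *m M *m (a *: v)) 0 0 = a * (u^T *m M *m v) 0 0.
Proof.
rewrite !bilin_formE mulr_sumr; apply: eq_bigr => i _; rewrite mulr_sumr.
by apply: eq_bigr => j _; rewrite mxE; ring.
Qed.

End quadratic_forms.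

(** * Minimizers of a weighted distance near the true parameter, for an abstract smooth model *)

Section weighted_least_squares.
Context {R : realType} (q m : nat) (Theta : set 'cV[R]_q) (theta0 : 'cV[R]_q).
Context (s : 'cV[R]_q -> 'cV[R]_m) (w : 'cV[R]_q -> 'M[R]_m) (D : 'M[R]_(m, q)).

Hypothesis s_diff : forall eps : R, 0 < eps -> exists2 delta : R, 0 < delta &
  forall v, sq v < delta -> sq (s (theta0 + v) - s theta0 - D *m v) <= eps * sq v.
Hypothesis w_cont : forall eps : R, 0 < eps -> exists2 delta : R, 0 < delta &
  forall theta, Theta theta -> sq (theta - theta0) < delta ->
  mxsum (w theta - w theta0) <= eps.
Hypothesis w_coercive : exists2 c : R, 0 < c & forall theta, Theta theta ->
  forall u, c * sq u <= (u^T *m w theta *m u) 0 0.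
Hypothesis s_ident : forall eps : R, 0 < eps -> exists2 delta : R, 0 < delta &
  forall theta, Theta theta -> sq (s theta - s theta0) < delta ->
  sq (theta - theta0) < eps.
Hypothesis D_free : row_free D^T.
Hypothesis theta0_int : exists2 delta : R, 0 < delta &
  forall v, sq v < delta -> Theta (theta0 + v).
Hypothesis w_sym : (w theta0)^T = w theta0.

(** The data are written [s theta0 + z], so that [z] is their deviation from the model at the true
    parameter and the whole analysis is deterministic. *)
Let F (z : 'cV[R]_m) theta := let u := s theta0 + z - s theta in (u^T *m w theta *m u) 0 0.

Let is_min (z : 'cV[R]_m) theta := Theta theta /\
  forall theta', Theta theta' -> F z theta <= F z theta'.

Let Theta0 : Theta theta0.
Proof.
have [delta d0 h] := theta0_int; rewrite -[theta0]addr0; apply: h.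
by rewrite (_ : sq 0 = 0)// /sq big1// => i _; rewrite mxE expr0n.
Qed.

Let q0 (u : 'cV[R]_m) := (u^T *m w theta0 *m u) 0 0.

Let H := D^T *m w theta0 *m D.

Let H_form y : (y^T *m H *m y) 0 0 = q0 (D *m y).
Proof. by rewrite /q0 /H trmx_mul !mulmxA. Qed.

Let H_coercive : exists2 c : R, 0 < c &
  forall y, c * sq y <= (y^T *m H *m y) 0 0.
Proof.
have [c c0 hc] := w_coercive; have [d d0 hd] := sq_mulmx_ge D_free.
exists (c * d) => [|y]; first exact: mulr_gt0.
by rewrite H_form (le_trans _ (hc _ Theta0 _))// -mulrA ler_pM2l.
Qed.

Lemma wls_hessian_unit : H \in unitmx.
Proof.
have [c c0 hc] := H_coercive.
rewrite -row_free_unit -kermx_eq0; apply/rowV0P => v /sub_kermxP vH.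
apply: trmx_inj; rewrite trmx0; apply: sq_eq0; apply/eqP.
have := hc v^T; rewrite trmxK vH mul0mx mxE pmulr_rle0// => h.
by rewrite eq_le h sq_ge0.
Qed.

(** Comparison with the candidate [theta0]: coercivity bounds the squared residual at the minimizer
    by a multiple of [F z theta0], which is the form of [z] itself. *)
Let min_s_bound : exists2 L : R, 0 < L & forall z theta, is_min z theta ->
  sq (s theta - s theta0) <= L * sq z.
Proof.
have [c c0 hc] := w_coercive; pose C0 := 2 * mxsum (w theta0).
have C00 : 0 <= C0 by rewrite mulr_ge0// mxsum_ge0.
exists (2 + 2 * (C0 / c)) => [|z theta [Tt /(_ _ Theta0)]].
  by rewrite ltr_wpDr// mulr_ge0// divr_ge0// ltW.
have -> : F z theta0 = (z^T *m w theta0 *m z) 0 0.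
  by rewrite /F addrAC subrr add0r.
rewrite /F => le0.
have := le_trans (hc _ Tt _) le0; rewrite -ler_pdivlMl// => h1.
have h2 : (z^T *m w theta0 *m z) 0 0 <= C0 * sq z.
  exact: le_trans (ler_norm _) (form_bound1 _ _).
have h3 : c^-1 * (z^T *m w theta0 *m z) 0 0 <= C0 / c * sq z.
  by rewrite -mulrA mulrCA ler_pM2l ?invr_gt0.
have -> : s theta - s theta0 = z - (s theta0 + z - s theta).
  by apply/colP => i; rewrite !mxE; ring.
have := sqB_le z (s theta0 + z - s theta).
by move: h1 h3; lra.
Qed.

Lemma wls_consistent eps : 0 < eps -> exists2 delta : R, 0 < delta &
  forall z theta, is_min z theta -> sq z < delta -> sq (theta - theta0) < eps.
Proof.
move=> e0; have [L L0 hL] := min_s_bound; have [d d0 hd] := s_ident e0.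
exists (d / L) => [|z theta mz zd]; first exact: divr_gt0.
apply: hd (mz.1) _; apply: le_lt_trans (hL _ _ mz) _.
by rewrite mulrC -ltr_pdivlMr.
Qed.

(** An a priori rate: the linear part [D] of [s] dominates its remainder near [theta0], so control
    of [s theta - s theta0] passes to [theta - theta0]. *)
Let min_rate : exists2 M : R, 0 < M & exists2 delta : R, 0 < delta &
  forall z theta, is_min z theta -> sq z < delta ->
  sq (theta - theta0) <= M * sq z.
Proof.
have [L L0 hL] := min_s_bound; have [d d0 hd] := sq_mulmx_ge D_free.
(* The inequality for [sq] of a difference doubles the remainder; with [d / 4] it consumes half of
   the lower bound [d], and the other half gives the constant [4 * L / d]. *)
have d40 : 0 < d / 4 by rewrite divr_gt0.
have [e e0 he] := s_diff d40; have [dl dl0 hdl] := wls_consistent e0.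
exists (4 * L / d); first by rewrite !mulr_gt0// invr_gt0.
exists dl => // z theta mz zd; have xe := hdl _ _ mz zd.
have := he _ xe; rewrite [theta0 + _]addrC subrK => h1.
have := sqB_le (s theta - s theta0) (s theta - s theta0 - D *m (theta - theta0)).
rewrite opprB addrC subrK => h2.
have h3 := hd (theta - theta0); have h4 := hL _ _ mz.
rewrite mulrAC ler_pdivlMr//; move: h1 h2 h3 h4 (sq_ge0 (theta - theta0)); lra.
Qed.

(** Freezing the weight at [theta0] and linearizing [s] costs only a small multiple of [sq z],
    uniformly over deviations [v] of the same order as [z]. The constant [C] is fixed before
    [eps]. *)
Let F_expansion M : 0 < M -> exists2 C : R, 0 < C &
  forall eps, 0 < eps -> eps <= 1 -> exists2 delta : R, 0 < delta &
  forall z v, sq z < delta -> sq v <= M * sq z -> Theta (theta0 + v) ->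
  `|F z (theta0 + v) - q0 (z - D *m v)| <= C * eps * sq z.
Proof.
move=> M0; pose CD := 2 * mxsum (D^T *m D); pose N := 2 + 2 * CD * M.
have CD0 : 0 <= CD by rewrite mulr_ge0// mxsum_ge0.
have CDM : 0 <= CD * M by rewrite mulr_ge0// ltW.
pose B := mxsum (w theta0); have B0 : 0 <= B by exact: mxsum_ge0.
pose C := 4 * (N + M) + 4 * B * (N + M) + 1.
have N0 : 0 < N by rewrite /N -mulrA; lra.
have NM0 : 0 <= B * (N + M) by rewrite mulr_ge0// ltW// addr_gt0.
exists C => [|eps e0 e1]; first by rewrite /C -!mulrA; move: NM0; lra.
have [d1 d10 h1] := w_cont e0.
(* The square anticipates the cross terms between the linearization remainder and the residual:
   Young's inequality with weight [eps^-1] on the remainder loses one power of [eps]. *)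
have e20 : 0 < eps ^+ 2 by rewrite exprn_gt0.
have [d2 d20 h2] := s_diff e20.
exists (Num.min d1 d2 / M); first by rewrite divr_gt0// lt_min d10.
move=> z v zd vM Tv.
have vd : sq v < Num.min d1 d2.
  by apply: le_lt_trans vM _; rewrite mulrC -ltr_pdivlMr.
rewrite lt_min in vd; have /andP[vd1 vd2] := vd.
have hw : mxsum (w (theta0 + v) - w theta0) <= eps.
  by apply: h1 => //; rewrite addrAC subrr add0r.
have hs := h2 _ vd2.
set rho := _ - D *m v in hs; set a := z - D *m v.
have -> : F z (theta0 + v) =
    ((a - rho)^T *m w (theta0 + v) *m (a - rho)) 0 0.
  rewrite /F; suff -> : s theta0 + z - s (theta0 + v) = a - rho by [].
  by rewrite /a /rho opprB addrA subrK opprB addrCA addrA.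
have aN : sq a <= N * sq z.
  have := sqB_le z (D *m v); have := sq_mulmx D v; rewrite -/CD -/a.
  have : CD * sq v <= CD * (M * sq z) by rewrite ler_wpM2l.
  by rewrite /N mulrA; lra.
have rM : sq rho <= eps ^+ 2 * (M * sq z).
  by apply: le_trans hs _; rewrite ler_pM2l.
set b := a - rho.
have bN : sq b <= 2 * (N + M) * sq z.
  have := sqB_le a rho; rewrite -/b => hb.
  have : eps ^+ 2 * (M * sq z) <= M * sq z.
    have MZ : 0 <= M * sq z by rewrite mulr_ge0 ?sq_ge0// ltW.
    by rewrite ler_piMl// exprn_ile1// ltW.
  by move: hb aN rM; lra.
have E1 : `|(b^T *m w (theta0 + v) *m b) 0 0 - q0 b| <= 4 * (N + M) * eps * sq z.
  have -> : (b^T *m w (theta0 + v) *m b) 0 0 - q0 b =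
      (b^T *m (w (theta0 + v) - w theta0) *m b) 0 0.
    rewrite /q0 !bilin_formE -sumrB; apply: eq_bigr => i _.
    by rewrite -sumrB; apply: eq_bigr => j _; rewrite !mxE; ring.
  apply: le_trans (form_bound1 _ _) _.
  have g : mxsum (w (theta0 + v) - w theta0) * sq b <= eps * (2 * (N + M) * sq z).
    by rewrite ler_pM ?mxsum_ge0 ?sq_ge0.
  by move: g; lra.
have E2 : `|q0 b - q0 a| <= 4 * B * (N + M) * eps * sq z.
  have -> : q0 b - q0 a = ((- rho)^T *m w theta0 *m a) 0 0 +
      (a^T *m w theta0 *m (- rho)) 0 0 + ((- rho)^T *m w theta0 *m (- rho)) 0 0.
    by rewrite /q0 /b bilin_formD; ring.
  have ei0 : 0 < eps^-1 by rewrite invr_gt0.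
  have B1 := form_bound (- rho) (w theta0) a ei0.
  have B2 := form_bound a (w theta0) (- rho) e0.
  have B3 := form_bound1 (- rho) (w theta0).
  rewrite !sqN -/B invrK in B1 B2 B3.
  have r1 : eps^-1 * sq rho <= eps * M * sq z.
    by rewrite ler_pdivrMl// (le_trans rM)// expr2 !mulrA.
  have r2 : sq rho <= eps * M * sq z.
    apply: le_trans rM _; rewrite -mulrA expr2 -mulrA ler_piMl//.
    by rewrite !mulr_ge0 ?sq_ge0// ltW.
  have r3 : eps * sq a <= eps * N * sq z by rewrite -mulrA ler_pM2l.
  have r4 : B * (eps^-1 * sq rho + eps * sq a) <= B * (N + M) * eps * sq z.
    by rewrite -!mulrA ler_wpM2l//; lra.
  have r5 : B * (eps * sq a + eps^-1 * sq rho) <= B * (N + M) * eps * sq z.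
    by rewrite -!mulrA ler_wpM2l//; lra.
  have r6 : B * sq rho <= B * (N + M) * eps * sq z.
    rewrite -!mulrA ler_wpM2l//; have : 0 <= N * (eps * sq z).
      by rewrite !mulr_ge0 ?sq_ge0// ltW.
    by move: r2; lra.
  apply: le_trans (ler_normD _ _) _; apply: le_trans (lerD (ler_normD _ _) (lexx _)) _.
  by move: B1 B2 B3 r4 r5 r6; lra.
have -> : (b^T *m w (theta0 + v) *m b) 0 0 - q0 a =
  ((b^T *m w (theta0 + v) *m b) 0 0 - q0 b) + (q0 b - q0 a).
  by rewrite addrA subrK.
apply: le_trans (ler_normD _ _) _.
have : 0 <= eps * sq z by rewrite mulr_ge0 ?sq_ge0// ltW.
by move: E1 E2; rewrite /C; lra.
Qed.

Definition wls_gain := invmx H *m D^T *m w theta0.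

(** Pythagoras for the inner product given by [w theta0]: by the normal equations, the residual of
    the weighted projection is orthogonal to the range of [D]. *)
Let q0_gain (z : 'cV[R]_m) (y : 'cV[R]_q) : q0 (z - D *m (wls_gain *m z + y)) =
  q0 (z - D *m (wls_gain *m z)) + (y^T *m H *m y) 0 0.
Proof.
set g := wls_gain *m z.
have Hg : H *m g = D^T *m w theta0 *m z.
  rewrite /g /wls_gain -(mulmxA (invmx H)) -(mulmxA (invmx H)).
  by rewrite mulKVmx ?wls_hessian_unit.
have -> : z - D *m (g + y) = (z - D *m g) + - (D *m y).
  by rewrite mulmxDr opprD addrA.
have o : (D *m y)^T *m w theta0 *m (z - D *m g) = 0.
  rewrite (_ : _ *m _ = y^T *m (D^T *m w theta0 *m z - H *m g)).
    by rewrite Hg subrr mulmx0.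
  by rewrite /H trmx_mul !mulmxBr !mulmxA.
have o' : (z - D *m g)^T *m w theta0 *m (D *m y) = 0.
  by apply: trmx_inj; rewrite !trmx_mul trmxK w_sym trmx0 -o trmx_mul !mulmxA.
rewrite /q0 bilin_formD !bilin_formNl !bilin_formNr o o' opprK -/(q0 (D *m y)) -H_form.
by rewrite !mxE oppr0 !addr0.
Qed.

(* [F z theta] is compared with its value at the linear prediction
   [theta0 + wls_gain *m z]; by [q0_gain] the excess is a positive definite form
   in the deviation from that prediction. *)
Lemma wls_expansion eps : 0 < eps -> exists2 delta : R, 0 < delta &
  forall z theta, is_min z theta -> sq z < delta ->
  sq (theta - theta0 - wls_gain *m z) <= eps * sq z.
Proof.
move=> e0; have [M1 M10 [d1 d10 h1]] := min_rate.
pose M := M1 + 2 * mxsum (wls_gain^T *m wls_gain).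
have K0 : 0 <= 2 * mxsum (wls_gain^T *m wls_gain) by rewrite mulr_ge0// mxsum_ge0.
have M0 : 0 < M by rewrite /M; lra.
have [C C0 hC] := F_expansion M0; have [c c0 hc] := H_coercive.
(* The minimizer and the linear prediction each incur an expansion error [C * e' * sq z]; their sum
   must stay below [c * eps * sq z], where [c] is the coercivity constant of the Hessian. *)
pose e' := Num.min 1 (eps * c / (2 * C)).
have e'0 : 0 < e' by rewrite lt_min ltr01 !mulr_gt0// invr_gt0 mulr_gt0.
have e'1 : e' <= 1 by rewrite ge_min lexx.
have e'2 : 2 * C * e' <= eps * c.
  by rewrite mulrC -ler_pdivlMr ?mulr_gt0// ge_min lexx orbT.
have [d2 d20 h2] := hC _ e'0 e'1; have [d3 d30 h3] := theta0_int.
exists (Num.min (Num.min d1 d2) (d3 / M)).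
  by rewrite !lt_min d10 d20 divr_gt0.
move=> z theta mz; rewrite !lt_min => /andP[/andP[zd1 zd2] zd3].
have z0 := sq_ge0 z.
have g1 : sq (wls_gain *m z) <= M * sq z.
  apply: le_trans (sq_mulmx _ _) _; rewrite ler_wpM2r//.
  by rewrite /M lerDr ltW.
have g2 : sq (theta - theta0) <= M * sq z.
  by apply: le_trans (h1 _ _ mz zd1) _; rewrite ler_wpM2r// /M lerDl.
have Tg : Theta (theta0 + wls_gain *m z).
  by apply: h3; apply: le_lt_trans g1 _; rewrite mulrC -ltr_pdivlMr.
have E1 := h2 _ _ zd2 g1 Tg.
have E2 : Theta (theta0 + (theta - theta0)) by rewrite addrC subrK; exact: mz.1.
have {}E2 := h2 _ _ zd2 g2 E2.
have := mz.2 _ Tg; rewrite [theta0 + (_ - _)]addrC subrK in E2.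
set y := theta - theta0 - _; move=> le.
have ey : theta - theta0 = wls_gain *m z + y by rewrite /y [RHS]addrC subrK.
rewrite ey q0_gain in E2.
have := hc y; move: E1 E2; rewrite !ler_norml => /andP[_ E1] /andP[E2 _] hy.
have h := ler_wpM2r z0 e'2; rewrite -(ler_pM2l c0).
by move: E1 E2 hy le; lra.
Qed.

End weighted_least_squares.

(** * Differentiability of determinants and inverses *)

Section differentiability.
Context {R : realType} (V : normedModType R).

Lemma differentiable_bigsum I (s : seq I) (P : pred I) (F : I -> V -> R) x :
  (forall i, differentiable (F i) x) ->
  differentiable (fun v => \sum_(i <- s | P i) F i v) x.
Proof.
move=> dF; elim: s => [|i s IH].
  by under eq_fun do rewrite big_nil; exact: differentiable_cst.
under eq_fun do rewrite big_cons; case: (P i) => //.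
exact: differentiableD.
Qed.

Lemma differentiable_bigprod I (s : seq I) (P : pred I) (F : I -> V -> R) x :
  (forall i, differentiable (F i) x) ->
  differentiable (fun v => \prod_(i <- s | P i) F i v) x.
Proof.
move=> dF; elim: s => [|i s IH].
  by under eq_fun do rewrite big_nil; exact: differentiable_cst.
under eq_fun do rewrite big_cons; case: (P i) => //.
exact: differentiableM.
Qed.

Lemma differentiable_sqr (f : V -> R) x : differentiable f x ->
  differentiable (fun v => f v ^+ 2) x.
Proof. by move=> df; under eq_fun do rewrite expr2; exact: differentiableM. Qed.

Lemma differentiable_det n (M : V -> 'M[R]_n) x :
  (forall i j, differentiable (fun v => M v i j) x) ->
  differentiable (fun v => \det (M v)) x.
Proof.
move=> dM; apply: differentiable_bigsum => s.
apply: differentiableM; first exact: differentiable_cst.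
exact: differentiable_bigprod.
Qed.

(** [invmx] is defined by cases on invertibility. This formula agrees with it on invertible matrices
    and is a rational function of the entries. *)
Definition adj_inv n (M : 'M[R]_n) : 'M[R]_n := (\det M)^-1 *: \adj M.

Lemma adj_invE n (M : 'M[R]_n) : M \in unitmx -> invmx M = adj_inv M.
Proof. by rewrite /invmx => ->. Qed.

Lemma differentiable_adj_inv n (M : V -> 'M[R]_n) x i j :
  (forall i j, differentiable (fun v => M v i j) x) -> M x \in unitmx ->
  differentiable (fun v => adj_inv (M v) i j) x.
Proof.
move=> dM; rewrite unitmxE unitfE => ux.
under eq_fun do rewrite mxE mxE.
apply: differentiableM.
  by apply: differentiableV => //; exact: differentiable_det.
apply: differentiableM; first exact: differentiable_cst.
apply: differentiable_det => a b; under eq_fun do rewrite !mxE.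
exact: dM.
Qed.

End differentiability.

Section near_sq.
Context {R : realType}.

(** The topology of matrices is that of the sup norm, whose square is at most [sq]. *)
Lemma near_sq n (x : 'cV[R]_n) (A : set 'cV[R]_n) : nbhs x A ->
  exists2 delta : R, 0 < delta & forall y, sq (y - x) < delta -> A y.
Proof.
move=> /nbhs_normP[e /= e0 h]; exists (e ^+ 2) => [|y yx]; first exact: exprn_gt0.
apply: h; rewrite /ball_ /= distrC -(@ltr_pXn2r _ 2)// ?nnegrE ?normr_ge0 ?(ltW e0)//.
exact: le_lt_trans (mxnorm_sq _) yx.
Qed.

Lemma diff_coordE n (f : 'cV[R]_n -> R) (x v : 'cV[R]_n) : differentiable f x ->
  'd f x v = \sum_j 'D_(delta_mx j 0) f x * v j 0.
Proof.
move=> df; have {1}-> : v = \sum_j v j 0 *: delta_mx j 0.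
  rewrite {1}[v]matrix_sum_delta; apply: eq_bigr => j _.
  by rewrite big_ord1.
rewrite linear_sum; apply: eq_bigr => j _.
by rewrite linearZ /= deriveE// mulrC.
Qed.

End near_sq.

(** * The minimum contrast expansion *)

Section model_analysis.
Context {R : realType} (p k r : nat).
Hypothesis hkp : (k < p)%N.
Local Notation q := (param_dim p k).
Implicit Type theta : 'cV[R]_q.

Lemma Lambda_differentiable i a theta :
  differentiable (fun th => Lambda th i a) theta.
Proof.
have e : (k + (p - k) = p)%N by rewrite subnKC// ltnW.
have E (th : 'cV[R]_q) : Lambda th i a =
    col_mx 1%:M (par_A th) (cast_ord (esym e) i) a.
  rewrite /Lambda -(conform_castmx (e, erefl k)) conform_mx_id castmxE /=.
  by rewrite cast_ord_id.
under eq_fun do rewrite E mxE.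
case: (fintype.split _) => j; first by under eq_fun do rewrite mxE; exact: differentiable_cst.
by under eq_fun do rewrite unvecE !mxE; exact: differentiable_coord.
Qed.

Lemma par_Sff_differentiable i j theta :
  differentiable (fun th => par_Sff th i j) theta.
Proof.
under eq_fun do rewrite /par_Sff /unvech unvecE mxE.
apply: differentiable_bigsum => s.
apply: differentiableM; first exact: differentiable_cst.
by under eq_fun do rewrite !mxE; exact: differentiable_coord.
Qed.

Lemma Sigma_differentiable i j theta :
  differentiable (fun th => Sigma th i j) theta.
Proof.
under eq_fun do rewrite mxE [X in X + _]mxE.
apply: differentiableD.
  apply: differentiable_bigsum => a.
  under eq_fun do rewrite mxE [X in _ * X]mxE.
  apply: differentiableM; last exact: Lambda_differentiable.
  apply: differentiable_bigsum => b; apply: differentiableM.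
    exact: Lambda_differentiable.
  exact: par_Sff_differentiable.
under eq_fun do rewrite mxE.
case: (i == j); last by under eq_fun do rewrite mulr0n; exact: differentiable_cst.
by under eq_fun do rewrite mulr1n !mxE; exact: differentiable_coord.
Qed.

Lemma Wmx_differentiable i j theta :
  differentiable (fun th => Wmx th i j) theta.
Proof.
under eq_fun do rewrite mxE mxE.
apply: differentiableM; first exact: differentiable_cst.
apply: differentiable_bigsum => a.
under eq_fun do rewrite mxE.
apply: differentiableM; last exact: differentiable_cst.
apply: differentiable_bigsum => b.
apply: differentiableM; first exact: differentiable_cst.
case/mxvec_indexP: a => a1 a2; case/mxvec_indexP: b => b1 b2.
under eq_fun do rewrite tensmxE_vec.
by apply: differentiableM; exact: Sigma_differentiable.
Qed.

Section estimator.
Context (Theta : set 'cV[R]_q) (theta0 : 'cV[R]_q).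
Hypothesis Theta_compact : compact Theta.
Hypothesis Theta_Sff : forall theta, Theta theta ->
  exists S : 'M[R]_(k, r), par_Sff theta = S *m S^T.
Hypothesis htheta0 : Theta° theta0.
Hypothesis sigma_pos : forall theta, Theta theta -> forall i, 0 < par_sigma theta i.
Hypothesis identifiable : forall theta, Theta theta ->
  Sigma theta = Sigma theta0 -> theta = theta0.
Hypothesis Delta_rank : \rank (Delta theta0) = q.

Let s theta := vech (Sigma theta).
Let w theta := invmx (Wmx theta).

Lemma Theta_center : Theta theta0.
Proof. exact: interior_subset htheta0. Qed.

Let W_unit theta : Theta theta -> Wmx theta \in unitmx.
Proof.
by move=> T; have [S hS] := Theta_Sff T; exact: Wmx_unit hS (sigma_pos T).
Qed.

Let s_diff eps : 0 < eps -> exists2 delta : R, 0 < delta &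
  forall v, sq v < delta ->
  sq (s (theta0 + v) - s theta0 - Delta theta0 *m v) <= eps * sq v.
Proof.
(* Each coordinate may err by [eps / m] in square. The successor keeps [m] nonzero and still bounds
   the number of coordinates. *)
move=> e0; pose m := (vech_dim p).+1%:R : R.
have m0 : 0 < m by rewrite ltr0n.
pose e := Num.sqrt (eps / m).
have ee : e ^+ 2 = eps / m by rewrite sqr_sqrtr// divr_ge0 ?ltW.
have e'0 : 0 < e by rewrite sqrtr_gt0 divr_gt0.
have hi (i : 'I_(vech_dim p)) : \forall v \near (0 : 'cV[R]_q),
    `|(s (theta0 + v) - s theta0 - Delta theta0 *m v) i 0| <= e * `|v|.
  pose f th := s th i 0.
  have df : differentiable f theta0.
    rewrite /f /s; under eq_fun do rewrite mxE.
    exact: Sigma_differentiable.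
  have E := diff_locallyx df.
  near=> v.
  have -> : (s (theta0 + v) - s theta0 - Delta theta0 *m v) i 0 =
      f (v + theta0) - f theta0 - 'd f theta0 v.
    rewrite /f [v + _]addrC diff_coordE// !mxE; congr (_ - _).
    by apply: eq_bigr => j _; rewrite mxE.
  have K (a b c : R) : a + b + c - a - b = c by ring.
  rewrite E K.
  by near: v; exact: littleoP.
have [d d0 h] := near_sq (filter_forall _ hi); exists d => // v vd.
have {}h := h v; rewrite subr0 in h; have {}h := h vd.
have : sq (s (theta0 + v) - s theta0 - Delta theta0 *m v) <=
    \sum_(i < vech_dim p) e ^+ 2 * `|v| ^+ 2.
  apply: ler_sum => i _; rewrite -exprMn -[leLHS]real_normK ?num_real//.
  by rewrite lerXn2r ?nnegrE// mulr_ge0// ltW.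
move=> /le_trans; apply; rewrite sumr_const card_ord ee -mulr_natl.
have vv := mxnorm_sq v.
rewrite mulrA; apply: ler_pM => //.
  by rewrite mulr_ge0// divr_ge0// ltW.
by rewrite mulrCA ler_piMr ?(ltW e0)// ler_pdivrMr// mul1r ler_nat.
Unshelve. all: by end_near. Qed.

Let w_cont eps : 0 < eps -> exists2 delta : R, 0 < delta &
  forall theta, Theta theta -> sq (theta - theta0) < delta ->
  mxsum (w theta - w theta0) <= eps.
Proof.
move=> e0; pose m := vech_dim p; pose e := eps / (m * m).+1%:R.
have e'0 : 0 < e by rewrite divr_gt0// ltr0n.
have hij (i j : 'I_m) : \forall th \near theta0,
    `|adj_inv (Wmx theta0) i j - adj_inv (Wmx th) i j| <= e.
  have /differentiable_continuous c : differentiable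
      (fun th => adj_inv (Wmx th) i j) theta0.
    apply: differentiable_adj_inv; last exact: W_unit Theta_center.
    by move=> ? ?; exact: Wmx_differentiable.
  exact: (@cvgr_dist_le _ _ _ (nbhs theta0) _
    (fun th => adj_inv (Wmx th) i j) _ c _ e'0).
have [d d0 h] := near_sq (filter_forall _ (fun i => filter_forall _ (hij i))).
exists d => // th T /h{}h.
apply: (@le_trans _ _ (\sum_(i < m) \sum_(j < m) e)).
  apply: ler_sum => i _; apply: ler_sum => j _.
  have := h i j; rewrite -!adj_invE ?W_unit//; last exact: Theta_center.
  by rewrite distrC !mxE.
rewrite !sumr_const !card_ord -mulrnA -mulr_natl /e mulrCA.
by rewrite ler_piMr ?(ltW e0)// ler_pdivrMr ?ltr0n// mul1r ler_nat.
Qed.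

(** The sum of the squared entries is continuous and thus bounded on the compact parameter set;
    [|x| <= x^2 + 1] then bounds [mxsum]. *)
Let W_bounded : exists2 C : R, 0 < C & forall theta, Theta theta ->
  forall u, (u^T *m Wmx theta *m u) 0 0 <= C * sq u.
Proof.
pose g (th : 'cV[R]_q) : R := \sum_i \sum_j Wmx th i j ^+ 2.
have gc : {within Theta, continuous g}.
  apply: continuous_subspaceT => th.
  apply: differentiable_continuous; apply: differentiable_bigsum => i.
  apply: differentiable_bigsum => j; apply: differentiable_sqr.
  exact: Wmx_differentiable.
have [c _ hc] := compact_EVT_max (ex_intro _ _ Theta_center) Theta_compact gc.
pose B := g c + (vech_dim p * vech_dim p)%:R.
have g0 th : 0 <= g th by do 2![apply: sumr_ge0 => ? _]; exact: sqr_ge0.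
have B0 : 0 <= B by rewrite addr_ge0.
exists (2 * B + 1) => [|th T u]; first by move: B0; lra.
have := form_bound1 u (Wmx th).
have : mxsum (Wmx th) <= B.
  apply: (@le_trans _ _ (\sum_i \sum_j (Wmx th i j ^+ 2 + 1))).
    apply: ler_sum => i _; apply: ler_sum => j _.
    rewrite -[X in _ <= X + _]real_normK ?num_real//.
    by have := sqr_ge0 (`|Wmx th i j| - 1); have := normr_ge0 (Wmx th i j); nra.
  under eq_bigr do rewrite big_split /= sumr_const card_ord.
  rewrite big_split /= sumr_const card_ord -mulrnA lerD2r.
  by apply: hc; rewrite inE.
move=> h1 /ler_normlP[_ h2]; apply: le_trans h2 _; rewrite ler_wpM2r ?sq_ge0//.
by move: h1; lra.
Qed.

(** An upper bound [C] on the form of [W] gives a lower bound on that of its inverse: expand the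
    nonnegative form of [W] at [y = W^-1 u - C^-1 u], whose cross terms are both [sq u]. *)
Let w_coercive : exists2 c : R, 0 < c & forall theta, Theta theta ->
  forall u, c * sq u <= (u^T *m w theta *m u) 0 0.
Proof.
have [C C0 hC] := W_bounded; exists C^-1 => [|th T u]; first by rewrite invr_gt0.
have uW := W_unit T; have [S hS] := Theta_Sff T.
pose x := w th *m u; pose y := x - C^-1 *: u.
have pos : 0 <= (y^T *m Wmx th *m y) 0 0.
  rewrite (Wmx_form _ _ hS (sigma_pos T)) mulr_ge0//.
  by apply: sumr_ge0 => i _; apply: sumr_ge0 => j _; rewrite -expr2 sqr_ge0.
have Wx : Wmx th *m x = u by rewrite /x mulKVmx.
have xW : x^T *m Wmx th = u^T by rewrite -[in RHS]Wx [RHS]trmx_mul Wmx_sym.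
have e1 : (x^T *m Wmx th *m x) 0 0 = (u^T *m w th *m u) 0 0.
  by rewrite xW /x mulmxA.
have e2 : (u^T *m Wmx th *m x) 0 0 = sq u by rewrite -mulmxA Wx sqE.
have e3 : (x^T *m Wmx th *m u) 0 0 = sq u by rewrite xW sqE.
have := hC _ T u; move: pos.
rewrite /y -scaleNr bilin_formD !bilin_formZl !bilin_formZr e1 e2 e3.
set A := (u^T *m Wmx th *m u) 0 0; set B := (u^T *m w th *m u) 0 0 => pos AC.
have cc : C^-1 * C = 1 by rewrite mulVf// gt_eqF.
have : C^-1 * C^-1 * A <= C^-1 * sq u.
  rewrite -mulrA ler_pM2l ?invr_gt0//.
  by rewrite -(ler_pM2l C0) mulrA [C * _]mulrC cc mul1r.
by move: pos; lra.
Qed.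

(** Outside a ball around [theta0] the parameter set is still compact; there
    [sq (s theta - s theta0)] attains its minimum, which identifiability makes positive. *)
Let s_ident eps : 0 < eps -> exists2 delta : R, 0 < delta &
  forall theta, Theta theta -> sq (s theta - s theta0) < delta ->
  sq (theta - theta0) < eps.
Proof.
move=> e0; pose K := Theta `&` [set th : 'cV[R]_q | eps <= sq (th - theta0)].
have c1 : continuous (fun th : 'cV[R]_q => sq (th - theta0)).
  move=> th; apply: differentiable_continuous; apply: differentiable_bigsum => i.
  apply: differentiable_sqr; under eq_fun do rewrite !mxE.
  apply: differentiableB; [exact: differentiable_coord|exact: differentiable_cst].
have cK : compact K.
  apply: compact_closedI => //.
  apply: (@preimage_closed _ _ (fun th : 'cV[R]_q => sq (th - theta0)) [set x | eps <= x]).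
    by move=> x _; exact: c1.
  exact: closed_ge.
have c2 : {within K, continuous (fun th : 'cV[R]_q => sq (s th - s theta0))}.
  apply: continuous_subspaceT => th.
  apply: differentiable_continuous; apply: differentiable_bigsum => i.
  apply: differentiable_sqr; under eq_fun do rewrite mxE mxE [X in _ + X]mxE.
  apply: differentiableB; [exact: Sigma_differentiable|exact: differentiable_cst].
have [K0|/set0P K0] := eqVneq K set0.
  exists 1 => // th T _; rewrite ltNge; apply/negP => h.
  by have : K th by []; rewrite K0.
have [c /set_mem[Tc ce] hc] := compact_EVT_min K0 cK c2.
exists (sq (s c - s theta0)).
  rewrite lt_neqAle sq_ge0 andbT eq_sym; apply/eqP => /sq_eq0/eqP.
  rewrite subr_eq0 => /eqP e.
  have cc : c = theta0.
    by apply: identifiable => //; apply: vech_inj_sym e; exact: Sigma_sym.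
  by move: ce => /=; rewrite cc subrr (_ : sq 0 = 0) ?leNgt ?e0// -sqE mulmx0 mxE.
move=> th T; rewrite ltNge => h; rewrite ltNge; apply/negP => h'.
by case/negP: h; apply: hc; rewrite inE.
Qed.

Let D_free : row_free (Delta theta0)^T.
Proof. by rewrite /row_free mxrank_tr Delta_rank. Qed.

Let theta0_int : exists2 delta : R, 0 < delta &
  forall v, sq v < delta -> Theta (theta0 + v).
Proof.
have [d d0 h] := near_sq htheta0; exists d => // v vd; apply: h.
by rewrite addrAC subrr add0r.
Qed.

Let w_sym : (w theta0)^T = w theta0.
Proof. by rewrite /w trmx_inv Wmx_sym. Qed.

Definition min_contrast (Q : 'M[R]_p) theta := Theta theta /\
  forall theta', Theta theta' -> contrast Q theta <= contrast Q theta'.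

Let contrastE Q theta : contrast Q theta =
  let u := s theta0 + (vech Q - s theta0) - s theta in
  (u^T *m w theta *m u) 0 0.
Proof. by rewrite /contrast /= [s theta0 + _]addrC subrK. Qed.

(* The linear response of the minimizer to [vech Q - vech (Sigma theta0)]. *)
Definition gain := invmx ((Delta theta0)^T *m invmx (Wmx theta0) *m Delta theta0)
  *m (Delta theta0)^T *m invmx (Wmx theta0).

Lemma min_contrast_consistent eps : 0 < eps -> exists2 delta : R, 0 < delta &
  forall Q theta, min_contrast Q theta ->
  sq (vech Q - vech (Sigma theta0)) < delta -> sq (theta - theta0) < eps.
Proof.
move=> e0.
have [d d0 h] := wls_consistent w_coercive s_ident theta0_int e0.
exists d => // Q theta [T hT] hQ; apply: h hQ; split => // th' T'.
by have := hT _ T'; rewrite !contrastE.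
Qed.

Lemma min_contrast_expansion eps : 0 < eps -> exists2 delta : R, 0 < delta &
  forall Q theta, min_contrast Q theta ->
  sq (vech Q - vech (Sigma theta0)) < delta ->
  sq (theta - theta0 - gain *m (vech Q - vech (Sigma theta0))) <=
  eps * sq (vech Q - vech (Sigma theta0)).
Proof.
move=> e0.
have [d d0 h] := wls_expansion s_diff w_cont w_coercive s_ident D_free
  theta0_int w_sym e0.
exists d => // Q theta [T hT] hQ; apply: h hQ; split => // th' T'.
by have := hT _ T'; rewrite !contrastE.
Qed.

Lemma hessian_unit :
  (Delta theta0)^T *m invmx (Wmx theta0) *m Delta theta0 \in unitmx.
Proof. exact: wls_hessian_unit w_coercive D_free theta0_int. Qed.

End estimator.
End model_analysis.

(** * Expectation and independence *)

Section borel_vectors.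
Context {R : realType}.

(** An open set is a countable union of boxes with rational centre and width, and the preimage of a
    box is a finite intersection of coordinate events. *)
Lemma measurable_cV d (T : measurableType d) n (f : T -> 'cV[R]_n) :
  (forall i, measurable_fun setT (fun w => f w i 0)) ->
  measurable_fun setT (f : T -> borel R n).
Proof.
move=> mf.
apply: (@measurability _ _ _ (borel R n) setT f (@open 'cV[R]_n)) => //.
move=> _ [U oU <-]; rewrite setTI.
pose box (c : 'cV[rat]_n * rat) : set 'cV[R]_n :=
  [set x | forall i, x i 0 \in `](ratr (c.1 i 0) - ratr c.2), (ratr (c.1 i 0) + ratr c.2)[ ].
have mbox c : measurable (f @^-1` box c).
  have -> : f @^-1` box c = \bigcap_(i : 'I_n)
     (fun w => f w i 0) @^-1` `](ratr (c.1 i 0) - ratr c.2), (ratr (c.1 i 0) + ratr c.2)[.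
    by apply/seteqP; split => [w h i _|w h i]; [exact: h|exact: (h i I)].
  apply: fin_bigcap_measurable; first exact: finite_finset.
  by move=> i _; rewrite -[X in measurable X]setTI; exact: (mf i).
have -> : f @^-1` U = \bigcup_(c : 'cV[rat]_n * rat)
    (if `[< box c `<=` U >] then f @^-1` box c else set0).
  apply/seteqP; split => [w Uw|w [c _]]; last by case: asboolP => // h; exact: h.
  have /nbhs_ballP[e /= e0 he] : nbhs (f w) U.
    by rewrite nbhsE /=; exists U => //; split.
  (* The centre is taken within [q] of [f w] and the box has half-width [q], so its points lie
     within [2 q < e] of [f w]. *)
  have [q /[!in_itv]/= /andP[q0 qe]] : exists q : rat, ratr q \in `]0, (e / 2)[.
    by apply: rat_in_itvoo; rewrite divr_gt0.
  have ex i : exists c : rat, ratr c \in `](f w i 0 - ratr q), (f w i 0)[.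
    by apply: rat_in_itvoo; rewrite ltrBlDr ltrDl.
  pose c : 'cV[rat]_n := \col_i xchoose (ex i).
  have cP i : ratr (c i 0) \in `](f w i 0 - ratr q), (f w i 0)[.
    by rewrite mxE; exact: (xchooseP (ex i)).
  exists (c, q) => //; case: asboolP => [_ i /=|[]].
    by have := cP i; rewrite !in_itv /=; lra.
  move=> y hy; apply: he; split => // i j; rewrite (ord1 j) /ball /=.
  by have := cP i; have := hy i; rewrite /= !in_itv /= ltr_norml; lra.
apply: countable_bigcupT_measurable => //.
by move=> c; case: asboolP => _.
Qed.

Lemma continuous_borel_measurable n (g : 'cV[R]_n -> R) : continuous g ->
  measurable_fun setT (g : borel R n -> R).
Proof.
move=> cg; apply: (@measurability _ _ (borel R n) R setT g (@RGenOpens.G R)).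
  exact: RGenOpens.measurableE.
move=> _ [_ [a [b ->] <-]]; rewrite setTI.
apply: sub_sigma_algebra; apply: open_comp; last exact: interval_open.
by move=> x _; exact: cg.
Qed.

Lemma measurable_coord d (T : measurableType d) n (f : T -> 'cV[R]_n) i :
  measurable_fun setT (f : T -> borel R n) ->
  measurable_fun setT (fun w => f w i 0).
Proof.
move=> mf; apply: (measurableT_comp (f := fun x : borel R n => x i 0)) => //.
by apply: continuous_borel_measurable => x; exact: coord_continuous.
Qed.

End borel_vectors.

Section real_expectation.
Context {R : realType} {d : measure_display} {Om : measurableType d}
  (P : probability Om R).
Implicit Types X Y : Om -> R.

Definition L1 X := P.-integrable setT (EFin \o X).
Definition Ex X := \int[P]_w X w.

Lemma L1_measurable X : L1 X -> measurable_fun setT X.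
Proof. by move=> /measurable_int/measurable_EFinP. Qed.

Lemma L1_cst (c : R) : L1 (fun=> c).
Proof. exact: finite_measure_integrable_cst. Qed.

Lemma L1D X Y : L1 X -> L1 Y -> L1 (fun w => X w + Y w).
Proof. by move=> lX lY; exact: (integrableD measurableT lX lY). Qed.

Lemma L1Zl c X : L1 X -> L1 (fun w => c * X w).
Proof. by move=> lX; exact: (integrableZl measurableT c lX). Qed.

Lemma L1B X Y : L1 X -> L1 Y -> L1 (fun w => X w - Y w).
Proof. by move=> lX lY; exact: (integrableB measurableT lX lY). Qed.

Lemma L1_le X Y : measurable_fun setT X -> (forall w, `|X w| <= `|Y w|) ->
  L1 Y -> L1 X.
Proof.
move=> mX XY; apply: le_integrable => //; first exact/measurable_EFinP.
by move=> w _; rewrite lee_fin.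
Qed.

Lemma L1_bounded X c : measurable_fun setT X -> (forall w, `|X w| <= c) -> L1 X.
Proof.
move=> mX Xc; apply: (L1_le mX (Y := fun=> c)); last exact: L1_cst.
by move=> w; rewrite (le_trans (Xc w))// ler_norm.
Qed.

Lemma L1_norm X : L1 X -> L1 (fun w => `|X w|).
Proof. exact: integrable_norm. Qed.

Lemma L1_sum I (s : seq I) (p : pred I) (F : I -> Om -> R) :
  (forall i, p i -> L1 (F i)) -> L1 (fun w => \sum_(i <- s | p i) F i w).
Proof.
move=> lF; elim: s => [|i s IH].
  by under eq_fun do rewrite big_nil; exact: L1_cst.
under eq_fun do rewrite big_cons; case: (boolP (p i)) => // pi; apply: L1D => //.
exact: lF.
Qed.

Lemma Ex_cst c : Ex (fun=> c) = c.
Proof. rewrite /Ex /Rintegral integral_cst//=.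
by have := probability_setT P => /= ->; rewrite mule1. Qed.

Lemma ExD X Y : L1 X -> L1 Y -> Ex (fun w => X w + Y w) = Ex X + Ex Y.
Proof. exact: RintegralD. Qed.

Lemma ExB X Y : L1 X -> L1 Y -> Ex (fun w => X w - Y w) = Ex X - Ex Y.
Proof. exact: RintegralB. Qed.

Lemma ExZl c X : L1 X -> Ex (fun w => c * X w) = c * Ex X.
Proof. exact: RintegralZl. Qed.

Lemma Ex_sum I (s : seq I) (p : pred I) (F : I -> Om -> R) :
  (forall i, p i -> L1 (F i)) ->
  Ex (fun w => \sum_(i <- s | p i) F i w) = \sum_(i <- s | p i) Ex (F i).
Proof.
move=> lF; elim: s => [|i s IH].
  by rewrite big_nil; under [X in Ex X]eq_fun do rewrite big_nil; exact: Ex_cst.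
rewrite big_cons; under [X in Ex X]eq_fun do rewrite big_cons.
case: ifP => // pi; rewrite ExD ?IH//; first exact: lF.
exact: L1_sum.
Qed.

Lemma Ex_le X Y : L1 X -> L1 Y -> (forall w, X w <= Y w) -> Ex X <= Ex Y.
Proof. by move=> lX lY XY; apply: le_Rintegral. Qed.

Lemma Ex_ge0 X : (forall w, 0 <= X w) -> 0 <= Ex X.
Proof. by move=> X0; apply: Rintegral_ge0. Qed.

Lemma Ex_norm X : L1 X -> `|Ex X| <= Ex (fun w => `|X w|).
Proof. by move=> lX; apply: le_normr_Rintegral. Qed.

Lemma integral_Ex X : L1 X -> (\int[P]_w (X w)%:E = (Ex X)%:E)%E.
Proof. by move=> lX; rewrite /Ex /Rintegral fineK//; exact: integrable_fin_num. Qed.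

Lemma ExE X : L1 X -> ('E_P[X] = (Ex X)%:E)%E.
Proof. by move=> lX; rewrite unlock integral_Ex. Qed.

(** Measurability of [Y] is asked for separately, since almost sure equality transfers it only when
    [P] is complete. *)
Lemma L1_ae X Y : measurable_fun setT Y -> {ae P, forall w, X w = Y w} ->
  L1 X -> L1 Y /\ Ex Y = Ex X.
Proof.
move=> mY XY lX; have mX := L1_measurable lX.
have aeE : ae_eq P setT (EFin \o X) (EFin \o Y).
  by apply: filterS XY => w /= -> _.
have aeN : ae_eq P setT (fun w => `|(EFin \o X) w|%E) (fun w => `|(EFin \o Y) w|%E).
  by apply: filterS XY => w /= -> _.
split; last first.
  by rewrite /Ex /Rintegral; congr fine; symmetry;
    apply: ae_eq_integral => //; exact/measurable_EFinP.
have /integrableP[_ fX] := lX; apply/integrableP; split; first exact/measurable_EFinP.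
rewrite -(ge0_ae_eq_integral _ _ _ _ _ aeN) => //.
  by apply: measurableT_comp => //; exact/measurable_EFinP.
by apply: measurableT_comp => //; exact/measurable_EFinP.
Qed.

Definition L2 X := measurable_fun setT X /\ L1 (fun w => X w ^+ 2).

Lemma sqr_measurable X : measurable_fun setT X ->
  measurable_fun setT (fun w => X w ^+ 2).
Proof. by move=> mX; exact: measurable_funX. Qed.

Lemma L2_mul X Y : L2 X -> L2 Y -> L1 (fun w => X w * Y w).
Proof.
move=> [mX lX] [mY lY].
apply: (@L1_le _ (fun w => X w ^+ 2 + Y w ^+ 2)); last exact: L1D.
  exact: measurable_funM.
move=> w; rewrite [leRHS]ger0_norm ?addr_ge0 ?sqr_ge0// normrM.
rewrite -[X w ^+ 2]real_normK ?num_real// -[Y w ^+ 2]real_normK ?num_real//.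
by have := sqr_ge0 (`|X w| - `|Y w|); have := mulr_ge0 (normr_ge0 (X w)) (normr_ge0 (Y w)); nra.
Qed.

Lemma L2_cst c : L2 (fun=> c).
Proof. by split => //; exact: L1_cst. Qed.

Lemma L2_L1 X : L2 X -> L1 X.
Proof.
by move=> lX; have := L2_mul lX (L2_cst 1); under eq_fun do rewrite mulr1.
Qed.

Lemma L2Zl c X : L2 X -> L2 (fun w => c * X w).
Proof.
move=> [mX lX]; split; first exact: measurable_funM.
by under eq_fun do rewrite exprMn; exact: L1Zl.
Qed.

Lemma L2D X Y : L2 X -> L2 Y -> L2 (fun w => X w + Y w).
Proof.
move=> lX lY; have lXY := L2_mul lX lY; have [mX lX2] := lX; have [mY lY2] := lY.
split; first exact: measurable_funD.
under eq_fun do rewrite sqrrD -mulr_natl.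
by apply: L1D => //; apply: L1D => //; exact: L1Zl.
Qed.

Lemma L2B X Y : L2 X -> L2 Y -> L2 (fun w => X w - Y w).
Proof.
move=> lX lY; have := L2D lX (L2Zl (-1) lY).
by under eq_fun do rewrite mulN1r.
Qed.

Lemma L2_sum I (s : seq I) (p : pred I) (F : I -> Om -> R) :
  (forall i, p i -> L2 (F i)) -> L2 (fun w => \sum_(i <- s | p i) F i w).
Proof.
move=> lF; elim: s => [|i s IH].
  by under eq_fun do rewrite big_nil; exact: L2_cst.
under eq_fun do rewrite big_cons; case: (boolP (p i)) => // pi; apply: L2D => //.
exact: lF.
Qed.

Lemma L2_ae X Y : measurable_fun setT Y -> {ae P, forall w, X w = Y w} ->
  L2 X -> L2 Y /\ Ex (fun w => Y w ^+ 2) = Ex (fun w => X w ^+ 2).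
Proof.
move=> mY XY [mX lX].
have XY2 : {ae P, forall w, X w ^+ 2 = Y w ^+ 2}.
  by apply: filterS XY => w /= ->.
by have [] := L1_ae (sqr_measurable mY) XY2 lX.
Qed.

Lemma markov_L1 X eps : 0 < eps -> L1 X ->
  (P [set w | (eps <= `|X w|)%R] <= (Ex (fun w => `|X w|) / eps)%:E)%E.
Proof.
move=> e0 lX; have mX := L1_measurable lX.
have mA : measurable [set w | (eps <= `|X w|)%R].
  rewrite -[X in measurable X]setTI.
  by apply: measurable_fun_le => //; exact: measurableT_comp.
rewrite -(setIT [set w | _]) -integral_indic//.
have lN := L1_norm lX.
rewrite EFinM muleC -integral_Ex// -integralZl//.
apply: ge0_le_integral => //.
- exact/measurable_EFinP/measurable_indic.
- by apply/measurable_EFinP; apply: measurable_funM => //; exact: measurableT_comp.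
- move=> w _; rewrite lee_fin indicE; case: (boolP (_ \in _)).
    by rewrite inE /= => h; rewrite mulrC ler_pdivlMr ?mul1r.
  by move=> _; rewrite mulr_ge0// invr_ge0 ltW.
Qed.

Lemma markov_L2 X eps : 0 < eps -> L2 X ->
  (P [set w | (eps <= `|X w|)%R] <= (Ex (fun w => X w ^+ 2) / eps ^+ 2)%:E)%E.
Proof.
move=> e0 [mX lX]; have e20 : 0 < eps ^+ 2 by rewrite exprn_gt0.
have := markov_L1 e20 lX.
under [X in Ex X]eq_fun do rewrite ger0_norm ?sqr_ge0//.
suff -> : [set w | eps ^+ 2 <= `|X w ^+ 2|] = [set w | eps <= `|X w|] by [].
apply/seteqP; split => w /=; rewrite normrX ler_pXn2r// ?nnegrE// ltW//.
Qed.

(** This carries second-moment bounds from Riemann sums to time integrals. *)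
Lemma fatou_L2 (F : nat -> Om -> R) X C :
  (forall n, L2 (F n)) -> (forall n, Ex (fun w => F n w ^+ 2) <= C) ->
  measurable_fun setT X -> {ae P, forall w, F n w @[n --> \oo] --> X w} ->
  L2 X /\ Ex (fun w => X w ^+ 2) <= C.
Proof.
move=> lF FC mX FX.
pose G n (w : Om) : \bar R := ((F n w) ^+ 2)%:E.
have mG n : measurable_fun setT (G n : Om -> \bar R).
  by apply/measurable_EFinP; apply: sqr_measurable; exact: (lF n).1.
have aeG : ae_eq P setT (fun w => limn_einf (G ^~ w)) (fun w => ((X w) ^+ 2)%:E).
  apply: filterS FX => w /= FX _; apply/esym/eqP.
  have c : G n w @[n --> \oo] --> ((X w) ^+ 2)%:E.
    apply: cvg_EFin; first by near=> n.
    apply: (@cvg_comp _ _ _ (fun n => F n w) (fun x => x ^+ 2)); first exact: FX.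
    exact: sqr_continuous.
  by apply/eqP; rewrite -(cvg_lim _ c)//; apply/esym/is_cvg_limn_einfE; apply/cvg_ex; eexists; exact: c.
have le : (\int[P]_w ((X w) ^+ 2)%:E <= C%:E)%E.
  rewrite -(ae_eq_integral _ _ _ _ _ aeG)//; last 2 first.
  - apply: measurableT_comp => //; apply: measurable_fun_limn_esup => n.
    exact: measurableT_comp.
  - by apply/measurable_EFinP; exact: sqr_measurable.
  apply: le_trans (fatou P measurableT mG _) _.
    by move=> n w _; rewrite lee_fin sqr_ge0.
  rewrite limn_einf_lim; apply: lime_le; first exact: is_cvg_einfs.
  near=> n; apply: le_trans (ereal_inf_lbound _) _.
    by exists n => /=; [exact: leqnn|reflexivity].
  rewrite integral_Ex ?lee_fin//; exact: (lF n).2.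
have lX : L1 (fun w => X w ^+ 2).
  apply/integrableP; split.
    by apply/measurable_EFinP; exact: sqr_measurable.
  under eq_integral do rewrite /= ger0_norm ?sqr_ge0//.
  exact: le_lt_trans le (ltry _).
by split => //; rewrite -lee_fin -integral_Ex.
Unshelve. all: by end_near. Qed.

End real_expectation.

(** * Independence and product laws *)

Section independence.
Context {R : realType} {d : measure_display} {Om : measurableType d}
  (P : probability Om R).

Definition indep_sys (F G : set (set Om)) := forall A B, F A -> G B ->
  P (A `&` B) = (P A * P B)%E.

Definition indep_rv (U V : Om -> R) := forall A B : set R,
  measurable A -> measurable B ->
  P (U @^-1` A `&` V @^-1` B) = (P (U @^-1` A) * P (V @^-1` B))%E.

Lemma measurable_preim d' (T : measurableType d') (X : Om -> T) (A : set T) :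
  measurable_fun setT X -> measurable A -> measurable (X @^-1` A).
Proof. by move=> mX mA; rewrite -[X in measurable X]setTI; exact: mX. Qed.

Section joint_law.
Context (U V : {mfun Om >-> R}).
Hypothesis UV : indep_rv U V.

Let pr (w : Om) : R * R := (U w, V w).

Let mpr : measurable_fun setT pr.
Proof. by apply/measurable_fun_pair. Qed.

Let prX : {mfun Om >-> (R * R)%type} := mfun_Sub (mem_set mpr).

Let indep_joint_law (X : set (R * R)) : measurable X ->
  (distribution P U \x distribution P V)%E X = distribution P prX X.
Proof.
move=> mX.
apply: (product_measure_unique (m' := distribution P prX)) => //.
Qed.

Lemma indep_tonelli (phi : R * R -> \bar R) : measurable_fun setT phi ->
  (forall x, 0 <= phi x)%E ->
  (\int[P]_w phi (U w, V w) =
   \int[distribution P U]_x \int[distribution P V]_y phi (x, y))%E.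
Proof.
move=> mphi phi0; rewrite [RHS](_ : _ = \int[distribution P U \x distribution P V]_z phi z)%E; last first.
  by rewrite fubini_tonelli1.
rewrite (eq_measure_integral (distribution P prX)); last first.
  by move=> A mA _; exact: indep_joint_law.
by rewrite ge0_integral_distribution.
Qed.

Lemma indep_fubini (phi : R * R -> \bar R) : measurable_fun setT phi ->
  P.-integrable setT (fun w => phi (U w, V w)) ->
  (\int[P]_w phi (U w, V w) =
   \int[distribution P U]_x \int[distribution P V]_y phi (x, y))%E.
Proof.
move=> mphi iphi.
have i1 : (distribution P prX).-integrable setT phi.
  by apply: integrable_pushforward => //; rewrite preimage_setT.
have i2 : (distribution P U \x distribution P V)%E.-integrable setT phi.
  apply/integrableP; split => //.
  have /integrableP[_ h] := i1.
  rewrite (eq_measure_integral (distribution P prX))// => A mA _.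
  exact: indep_joint_law.
transitivity (\int[distribution P U \x distribution P V]_z phi z)%E.
  rewrite (eq_measure_integral (distribution P prX)); last first.
    by move=> A mA _; exact: indep_joint_law.
  by rewrite integral_distribution.
by rewrite -(integral12_prod_meas1 i2).
Qed.

End joint_law.

(** Tonelli applied to absolute values shows that the product is integrable, after which Fubini
    gives the value. *)
Lemma indep_Ex (U V : Om -> R) : indep_rv U V -> L1 P U -> L1 P V ->
  L1 P (fun w => U w * V w) /\
  Ex P (fun w => U w * V w) = Ex P U * Ex P V.
Proof.
move=> UV lU lV; have mU := L1_measurable lU; have mV := L1_measurable lV.
pose U' : {mfun Om >-> R} := mfun_Sub (mem_set mU).
pose V' : {mfun Om >-> R} := mfun_Sub (mem_set mV).
have UV' : indep_rv U' V' by [].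
have mM : measurable_fun setT (fun z : R * R => z.1 * z.2).
  exact: measurable_funM.
have iV (g : R -> R) : measurable_fun setT g -> P.-integrable setT (EFin \o (g \o V)) ->
    (distribution P V').-integrable setT (EFin \o g).
  move=> mg ig; apply: integrable_pushforward => //.
  exact/measurable_EFinP.
have iU (g : R -> R) : measurable_fun setT g -> P.-integrable setT (EFin \o (g \o U)) ->
    (distribution P U').-integrable setT (EFin \o g).
  move=> mg ig; apply: integrable_pushforward => //.
  exact/measurable_EFinP.
have lUV : L1 P (fun w => U w * V w).
  apply/integrableP; split.
    by apply/measurable_EFinP; exact: measurable_funM.
  have := indep_tonelli UV' (phi := fun z => `|z.1 * z.2|%:E).
  rewrite /= => ->; last 2 first.
  - by apply/measurable_EFinP; exact: measurableT_comp.
  - by move=> z; rewrite lee_fin.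
  under eq_integral => x _.
    under eq_integral do rewrite normrM EFinM.
    rewrite integralZl//; last first.
      by apply: (iV (fun y => `|y|)) => //; exact: L1_norm.
    rewrite (integral_distribution (X := V') (f := fun y => `|y|%:E)) /=; last 2 first.
    - exact/measurable_EFinP.
    - exact: L1_norm.
    rewrite integral_Ex; last exact: L1_norm.
    over.
  rewrite integralZr//; last by apply: (iU (fun y => `|y|)) => //; exact: L1_norm.
  rewrite (integral_distribution (X := U') (f := fun y => `|y|%:E)) /=; last 2 first.
  - exact/measurable_EFinP.
  - exact: L1_norm.
  by rewrite integral_Ex ?ltry//; exact: L1_norm.
split => //.
apply/EFin_inj; rewrite -integral_Ex//.
have -> := indep_fubini UV' (phi := fun z => (z.1 * z.2)%:E) _ lUV; last first.
  exact/measurable_EFinP.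
under eq_integral => x _.
  under eq_integral do rewrite EFinM.
  rewrite integralZl//; last exact: (iV id).
  rewrite (integral_distribution (X := V') (f := EFin)) //=.
  rewrite integral_Ex//; over.
rewrite integralZr//; last exact: (iU id).
rewrite (integral_distribution (X := U') (f := EFin)) //=.
by rewrite integral_Ex.
Qed.

End independence.

Section joint_law_unique.
Context {R : realType} {d : measure_display} {Om : measurableType d}
  (P : probability Om R) {d' : measure_display} {Om' : measurableType d'}
  (P' : probability Om' R).

(** On either space the joint law is the product of the same two marginals, and a product measure is
    determined by its rectangles. *)
Lemma indep_sum_law (U V : Om -> R) (U' V' : Om' -> R) :
  measurable_fun setT U -> measurable_fun setT V ->
  measurable_fun setT U' -> measurable_fun setT V' ->
  indep_rv P U V -> indep_rv P' U' V' ->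
  (forall A : set R, measurable A -> P (U @^-1` A) = P' (U' @^-1` A)) ->
  (forall A : set R, measurable A -> P (V @^-1` A) = P' (V' @^-1` A)) ->
  forall A : set R, measurable A ->
  P ((fun w => U w + V w) @^-1` A) = P' ((fun w => U' w + V' w) @^-1` A).
Proof.
move=> mU mV mU' mV' UV UV' eU eV A mA.
pose X := [set z : R * R | A (z.1 + z.2)].
have mX : measurable X.
  by apply: (measurable_preim (X := fun z : R * R => z.1 + z.2)) => //;
    exact: measurable_funD.
have mp : measurable_fun setT (fun w => (U w, V w)) by exact/measurable_fun_pair.
have mp' : measurable_fun setT (fun w => (U' w, V' w)) by exact/measurable_fun_pair.
pose pX : {mfun Om >-> (R * R)%type} := mfun_Sub (mem_set mp).
pose pX' : {mfun Om' >-> (R * R)%type} := mfun_Sub (mem_set mp').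
pose u : {mfun Om >-> R} := mfun_Sub (mem_set mU).
pose v : {mfun Om >-> R} := mfun_Sub (mem_set mV).
transitivity ((distribution P u \x distribution P v)%E X).
  by apply/esym; apply: (product_measure_unique (m' := distribution P pX)).
apply: (product_measure_unique (m' := distribution P' pX')) => // B C mB mC.
rewrite [RHS](_ : _ = (P (U @^-1` B) * P (V @^-1` C))%E)//.
by rewrite eU// eV//; exact: UV'.
Qed.

End joint_law_unique.

(** * Moments of the normal law *)

Section normal_law.
Context {R : realType}.
Local Notation leb := (@lebesgue_measure R).

Import HBNNSimple.

Let measurable_mulc (c : R) : measurable_fun setT
  (( *%R c) : measurableTypeR R -> measurableTypeR R).
Proof. exact: mulrl_measurable. Qed.

Let smul (c : R) : {measure set (measurableTypeR R) -> \bar R} :=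
  measure_function_pushforward__canonical__measure_function_Measure
    leb (measurable_mulc c).

(** Lebesgue measure is unique given its values on half-open intervals. A negative [c] moves the
    closed end to the left, which does not affect the length. *)
Lemma lebesgue_measure_scale (c : R) (A : set R) : c != 0 -> measurable A ->
  leb A = (`|c|%:E * leb ((fun x => (c * x)%R) @^-1` A))%E.
Proof.
move=> c0 mA; have c'0 : 0 <= `|c| by [].
pose m := mscale (NngNum c'0) (smul c).
rewrite (lebesgue_measure_unique (mu := m))//.
move=> _ [[a b]] _ <-; rewrite [RHS](_ : _ =
  (`|c|%:E * leb ((fun x => (c * x)%R) @^-1` `]a, b]))%E)//.
have [c1|c1|/eqP] := ltgtP c 0; last by rewrite (negbTE c0).
  have -> : (fun x => c * x)%R @^-1` `]a, b] = `[b / c, a / c[%classic.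
    apply/seteqP; split=> x /=; rewrite !in_itv /= ler_ndivrMr// ltr_ndivlMr//;
      by rewrite ![x * c]mulrC andbC.
  rewrite !lebesgue_measure_itv /= !lte_fin ltr_nM2r ?invr_lt0//.
  case: ifP; rewrite ?mule0// => ab.
  by rewrite -!EFinD -EFinM ltr0_norm//; congr (_%:E); field; rewrite lt_eqF.
have -> : (fun x => c * x)%R @^-1` `]a, b] = `]a / c, b / c]%classic.
  apply/seteqP; split=> x /=; rewrite !in_itv /= ler_pdivlMr// ltr_pdivrMr//;
    by rewrite ![x * c]mulrC.
rewrite !lebesgue_measure_itv /= !lte_fin ltr_pM2r ?invr_gt0//.
case: ifP; rewrite ?mule0// => ab.
by rewrite -!EFinD -EFinM gtr0_norm//; congr (_%:E); field; rewrite gt_eqF.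
Qed.

(** [normal_prob] is given by its density on sets; simple functions and monotone convergence extend
    this to nonnegative integrands. *)
Lemma ge0_integral_normal_prob (m s : R) (f : R -> \bar R) :
  measurable_fun setT f -> (forall x, 0 <= f x)%E ->
  (\int[normal_prob m s]_x f x = \int[leb]_x (f x * (normal_pdf m s x)%:E))%E.
Proof.
move=> mf f0.
have mp : measurable_fun setT (fun x => (normal_pdf m s x)%:E).
  by apply/measurable_EFinP; exact: measurable_normal_pdf.
have p0 x : (0 <= (normal_pdf m s x)%:E)%E by rewrite lee_fin normal_pdf_ge0.
pose g := nnsfun_approx measurableT mf.
have gE n : (\int[normal_prob m s]_x (g n x)%:E =
    \int[leb]_x ((g n x)%:E * (normal_pdf m s x)%:E))%E.
  have mg r : measurable (g n @^-1` [set r] : set R).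
    by rewrite -[X in measurable X]setTI; exact: (measurable_funP (g n)).
  under [LHS]eq_integral do rewrite fimfunE -fsumEFin//.
  rewrite [LHS]ge0_integral_fsum//; last 2 first.
  - move=> r; apply/measurable_EFinP; apply: measurable_funM => //.
    exact: measurable_indic (mg r).
  - by move=> r x _; rewrite EFinM nnfun_muleindic_ge0.
  under [RHS]eq_integral => x _.
    rewrite fimfunE -fsumEFin// ge0_mule_fsuml; last first.
      by move=> r; rewrite EFinM nnfun_muleindic_ge0.
    over.
  rewrite [RHS]ge0_integral_fsum//; last 2 first.
  - move=> r; apply: emeasurable_funM => //; apply/measurable_EFinP.
    by apply: measurable_funM => //; exact: measurable_indic (mg r).
  - by move=> r x _; rewrite mule_ge0// EFinM nnfun_muleindic_ge0.
  apply: eq_fsbigr => r _.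
  have [r0|r0] := ltP r 0.
    have -> : g n @^-1` [set r] = set0 by exact: preimage_nnfun0.
    by rewrite !integral0_eq// => x _; rewrite indic0 mulr0 ?mul0e.
  under [LHS]eq_integral do rewrite EFinM.
  rewrite ge0_integralZl//; last first.
    by apply/measurable_EFinP; exact: measurable_indic (mg r).
  rewrite integral_indic//; last exact: mg.
  rewrite setIT /normal_prob.
  under [RHS]eq_integral do rewrite EFinM -muleA.
  rewrite ge0_integralZl//; last 2 first.
  - apply: emeasurable_funM => //; apply/measurable_EFinP.
    exact: measurable_indic (mg r).
  - by move=> x _; rewrite mule_ge0// lee_fin.
  congr (_ * _)%E; rewrite [LHS](_ : _ =
    \int[leb]_(x in g n @^-1` [set r]) (normal_pdf m s x)%:E)%E//.
  rewrite [LHS]integral_mkcond; apply: eq_integral => x _.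
  by rewrite patchE indicE; case: (x \in _); rewrite ?mul1e ?mul0e.
have nd x : {homo (fun n => (g n x)%:E) : a b / (a <= b)%N >-> (a <= b)%E}.
  by move=> a b ab; rewrite lee_fin; exact/lefP/nd_nnsfun_approx.
transitivity (limn (fun n => \int[normal_prob m s]_x (g n x)%:E))%E.
  rewrite -monotone_convergence//=.
  - apply: eq_integral => x _; apply/esym/cvg_lim => //.
    exact: cvg_nnsfun_approx.
  - by move=> n; apply/measurable_EFinP; exact: (measurable_funP (g n)).
  - by move=> n x _; rewrite lee_fin.
under eq_fun do rewrite gE.
rewrite -monotone_convergence//=.
- apply: eq_integral => x _; apply/cvg_lim => //.
  by apply: cvgeZr => //; exact: cvg_nnsfun_approx.
- move=> n; apply: emeasurable_funM => //; apply/measurable_EFinP.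
  exact: (measurable_funP (g n)).
- by move=> n x _; rewrite mule_ge0// lee_fin.
- by move=> x _ a b ab; rewrite lee_wpmul2r//; exact: (nd x).
Qed.

Let normal_peak_arg (a s q : R) :
  (a * s) ^+ 2 * q *+ 2 = a ^+ 2 * (s ^+ 2 * q *+ 2).
Proof. ring. Qed.

Lemma normal_prob_scale (c s : R) (A : set R) : c != 0 -> s != 0 ->
  measurable A ->
  normal_prob 0 s ((fun x => c * x) @^-1` A) = normal_prob 0 (`|c| * s) A.
Proof.
move=> c0 s0 mA; rewrite /normal_prob.
have c'0 : 0 <= `|c| by [].
pose m := mscale (NngNum c'0) (smul c).
rewrite [RHS](eq_measure_integral m); last first.
  by move=> B mB _; exact: lebesgue_measure_scale.
rewrite ge0_integral_mscale//; last 2 first.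
- by apply/measurable_funTS/measurable_EFinP; exact: measurable_normal_pdf.
- by move=> x _; rewrite lee_fin normal_pdf_ge0.
rewrite ge0_integral_pushforward//; last 2 first.
- by apply/measurable_funTS/measurable_EFinP; exact: measurable_normal_pdf.
- by move=> x _; rewrite lee_fin normal_pdf_ge0.
rewrite -ge0_integralZl//; last 3 first.
- apply: (measurable_preim (X := fun x => c * x)) => //; exact: mulrl_measurable.
- apply/measurable_funTS; apply/measurable_EFinP.
  apply: (measurableT_comp (f := normal_pdf 0 (`|c| * s))).
    exact: measurable_normal_pdf.
  exact: mulrl_measurable.
- by move=> x _; rewrite lee_fin normal_pdf_ge0.
apply: eq_integral => x _; rewrite /= -EFinM; congr (_%:E).
have cs0 : `|c| * s != 0 by rewrite mulf_neq0 ?normr_eq0.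
rewrite !normal_pdfE//= /normal_peak /normal_fun !subr0 mulrA; congr (_ * _).
  rewrite normal_peak_arg sqrtrM ?sqr_ge0// sqrtr_sqr normr_id invfM mulrA mulfV ?mul1r//.
  by rewrite normr_eq0.
congr expR; rewrite !exprMn real_normK ?num_real//.
by field; rewrite c0 s0.
Qed.

Lemma law_Ex d (Om : measurableType d) (P : probability Om R)
  (Q : probability (measurableTypeR R) R) (X : Om -> R) (g : R -> R) :
  measurable_fun setT X -> measurable_fun setT g ->
  (forall A : set R, measurable A -> P (X @^-1` A) = Q A) ->
  L1 Q g -> L1 P (g \o X) /\ Ex P (g \o X) = Ex Q g.
Proof.
move=> mX mg PQ lg.
pose X' : {mfun Om >-> measurableTypeR R} :=
  @mfun_Sub _ _ Om (measurableTypeR R) X (mem_set mX).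
have eQ A : measurable A -> distribution P X' A = Q A by move=> mA; exact: PQ.
have mgX : measurable_fun setT (g \o X) by exact: measurableT_comp.
have lgX : L1 P (g \o X).
  apply/integrableP; split; first exact/measurable_EFinP.
  have /integrableP[_] := lg; congr (_ < _)%E.
  rewrite (eq_measure_integral (distribution P X')); last first.
    by move=> A mA _; exact/esym/eQ.
  rewrite ge0_integral_distribution//.
  by apply: measurableT_comp => //; exact/measurable_EFinP.
split => //; apply/EFin_inj; rewrite -!integral_Ex//.
rewrite [RHS](eq_measure_integral (distribution P X')); last first.
  by move=> A mA _; exact/esym/eQ.
by rewrite integral_distribution//; exact/measurable_EFinP.
Qed.

Lemma normal_peak_scale (s : R) : 0 < s -> s * normal_peak s = normal_peak 1.
Proof.
move=> s0; rewrite /normal_peak.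
rewrite -{2}[s]mulr1 normal_peak_arg sqrtrM ?sqr_ge0// sqrtr_sqr gtr0_norm// invfM mulrA mulfV ?mul1r//.
by rewrite gt_eqF.
Qed.

Lemma pow_le_expR (k : nat) (y : R) : 0 <= y -> y ^+ k <= k`!%:R * expR y.
Proof.
move=> y0; case: k => [|k].
  by rewrite expr0 fact0 mul1r -[leLHS]expR0 ler_expR.
have h := expR_ge1Dxn k y0; rewrite mulrC -ler_pdivrMr ?ltr0n ?fact_gt0//.
by apply: le_trans h; rewrite lerDr.
Qed.

(** The density of variance 2 decays like [expR (- x^2 / 4)], half the exponent of the standard one.
    The spare half absorbs the power, since [y^k <= k! expR y] at [y = x^2 / 4]; hence the factors
    [4^k] and [k!]. *)
Let normal_pdf_even_bound (k : nat) : exists2 C : R, 0 <= C &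
  forall x : R, `|x ^+ k.*2 * normal_pdf 0 1 x| <= `|C * normal_pdf 0 (Num.sqrt 2) x|.
Proof.
pose r2 : R := Num.sqrt 2.
have r20 : r2 != 0 by rewrite gt_eqF// sqrtr_gt0.
have rr : r2 ^+ 2 = 2 by rewrite sqr_sqrtr.
have p20 : 0 < normal_peak r2 by exact: normal_peak_gt0.
pose C := 4 ^+ k * k`!%:R * normal_peak 1 / normal_peak r2.
have C0 : 0 <= C by rewrite !mulr_ge0 ?invr_ge0 ?normal_peak_ge0// exprn_ge0.
exists C => // x.
have x0 : 0 <= x ^+ k.*2 by rewrite -mul2n exprM exprn_ge0// sqr_ge0.
have n1 := mulr_ge0 x0 (normal_pdf_ge0 0 1 x).
have n2 := mulr_ge0 C0 (normal_pdf_ge0 0 r2 x).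
rewrite (ger0_norm n1) (ger0_norm n2).
rewrite !normal_pdfE ?oner_eq0// /normal_fun !subr0 rr expr1n.
have CE : C * normal_peak r2 = 4 ^+ k * k`!%:R * normal_peak 1.
  by rewrite /C divfK ?gt_eqF.
rewrite [leRHS]mulrA CE.
have h := @pow_le_expR k (x ^+ 2 / 4) (divr_ge0 (sqr_ge0 _) (ler0n _ _)).
have -> : x ^+ k.*2 = 4 ^+ k * (x ^+ 2 / 4) ^+ k.
  by rewrite -exprMn mulrCA mulfV ?mulr1 ?pnatr_eq0// -exprM mul2n.
have -> : - x ^+ 2 / (2 *+ 2) = x ^+ 2 / 4 + - x ^+ 2 / (1 *+ 2) :> R by field.
rewrite expRD; move: (normal_peak_ge0 (1 : R)) (expR_ge0 (- x ^+ 2 / (1 *+ 2))) h.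
move: (normal_peak 1) (expR _) => p E p0 E0.
set B := k`!%:R * expR _; set A := _ ^+ k => h.
have -> : 4 ^+ k * k`!%:R * p * (expR (x ^+ 2 / 4) * E) = 4 ^+ k * (p * (E * B)).
  by rewrite /B; ring.
have -> : 4 ^+ k * A * (p * E) = 4 ^+ k * (p * (E * A)) by ring.
by rewrite ler_wpM2l ?exprn_ge0// ler_wpM2l// ler_wpM2l.
Qed.

Let normal_pdf_even_integrable (k : nat) :
  leb.-integrable setT (EFin \o (fun x => x ^+ k.*2 * normal_pdf 0 1 x)).
Proof.
have [C C0 h] := normal_pdf_even_bound k.
have ii : leb.-integrable setT (EFin \o (fun x => C * normal_pdf 0 (Num.sqrt 2) x)).
  exact: (integrableZl (measurableT : measurable (setT : set (measurableTypeR R)))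
    C (integrable_normal_pdf 0 _)).
apply: (le_integrable (measurableT : measurable (setT : set (measurableTypeR R))) _ _ ii).
  apply/measurable_EFinP; apply: measurable_funM; last exact: measurable_normal_pdf.
  exact: measurable_funX.
by move=> x _; rewrite lee_fin; exact: h.
Qed.

Lemma L1_normal_even (k : nat) : L1 (normal_prob 0 1) (fun x : R => x ^+ k.*2).
Proof.
have x0 (x : R) : 0 <= x ^+ k.*2 by rewrite -mul2n exprM exprn_ge0// sqr_ge0.
have mx : measurable_fun setT (fun x : R => x ^+ k.*2) by exact: measurable_funX.
apply/integrableP; split; first exact/measurable_EFinP.
rewrite ge0_integral_normal_prob//; last exact/measurable_EFinP/measurableT_comp.
have /integrableP[_] := normal_pdf_even_integrable k; congr (_ < _)%E.
apply: eq_integral => x _ /=; rewrite -EFinM.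
by rewrite !ger0_norm// mulr_ge0// normal_pdf_ge0.
Qed.

Lemma normal_even_density (s : R) (k : nat) :
  L1 (normal_prob 0 s) (fun x : R => x ^+ k.*2) ->
  leb.-integrable setT (EFin \o (fun x => x ^+ k.*2 * normal_pdf 0 s x)) /\
  Ex (normal_prob 0 s) (fun x : R => x ^+ k.*2) =
  \int[leb]_x (x ^+ k.*2 * normal_pdf 0 s x).
Proof.
have x0 (x : R) : 0 <= x ^+ k.*2 by rewrite -mul2n exprM exprn_ge0// sqr_ge0.
have mx : measurable_fun setT (fun x : R => x ^+ k.*2) by exact: measurable_funX.
move=> /integrableP[_]; rewrite ge0_integral_normal_prob//; last first.
  exact/measurable_EFinP/measurableT_comp.
move=> h; split.
  apply/integrableP; split.
    by apply/measurable_EFinP; apply: measurable_funM => //;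
      exact: measurable_normal_pdf.
  move: h; congr (_ < _)%E; apply: eq_integral => x _ /=; rewrite -EFinM.
  by rewrite !ger0_norm// mulr_ge0// normal_pdf_ge0.
by rewrite /Ex /Rintegral ge0_integral_normal_prob//; exact/measurable_EFinP.
Qed.

Local Notation mom j := (Ex (normal_prob 0 1) (fun x : R => x ^+ j.*2)).

Let pow_scale (s x : R) (k : nat) : s != 0 -> x ^+ k = s ^+ k * (s^-1 * x) ^+ k.
Proof. by move=> s0; rewrite -exprMn mulrA mulfV// mul1r. Qed.

Lemma normal_even_scale (s : R) (k : nat) : 0 < s ->
  L1 (normal_prob 0 s) (fun x : R => x ^+ k.*2) /\
  Ex (normal_prob 0 s) (fun x : R => x ^+ k.*2) = s ^+ k.*2 * mom k.
Proof.
move=> s0; have s1 : s != 0 by rewrite gt_eqF.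
have mx : measurable_fun setT (fun x : R => x ^+ k.*2) by exact: measurable_funX.
have ms : measurable_fun setT (fun x : R => s^-1 * x) by exact: mulrl_measurable.
have [|l e] := law_Ex (P := normal_prob 0 s) (Q := normal_prob 0 1) ms mx _ (L1_normal_even k).
  move=> A mA; transitivity (normal_prob 0 (`|s^-1| * s) A).
    by apply: normal_prob_scale; rewrite ?invr_eq0.
  by rewrite gtr0_norm ?invr_gt0// mulVf.
have E : (fun x : R => x ^+ k.*2) = (fun x : R => s ^+ k.*2 * (s^-1 * x) ^+ k.*2).
  by apply/funext => x; exact: pow_scale.
by rewrite [X in L1 _ X]E [X in Ex _ X = _]E; split; [exact: L1Zl|rewrite ExZl ?e].
Qed.

Let normal_pdf_tangent (s x : R) : 0 < s ->
  (1 - (s ^- 2 - 1) / 2 * x ^+ 2) * normal_pdf 0 1 x <= s * normal_pdf 0 s x.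
Proof.
move=> s0; have s1 : s != 0 by rewrite gt_eqF.
rewrite !normal_pdfE ?oner_eq0//.
rewrite [leRHS]mulrA normal_peak_scale// [leLHS]mulrCA ler_wpM2l ?normal_peak_ge0//.
rewrite /normal_fun !subr0 expr1n.
have -> : - x ^+ 2 / (s ^+ 2 *+ 2) =
    - ((s ^- 2 - 1) / 2 * x ^+ 2) + - x ^+ 2 / (1 *+ 2) :> R by field.
by rewrite expRD ler_wpM2r ?expR_ge0// expR_ge1Dx.
Qed.

(* [s] times the [N(0, s^2)] density minus the tangent at [s = 1] of its
   exponential factor is nonnegative; integrating against an even monomial
   recovers the derivative in [s] of the moments without differentiating
   under the integral sign. *)
Lemma normal_moment_tangent (k : nat) (s : R) : 0 < s ->
  mom k - (s ^- 2 - 1) / 2 * mom k.+1 <= s ^+ k.*2.+1 * mom k.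
Proof.
move=> s0; have s1 : s != 0 by rewrite gt_eqF.
have mT : measurable (setT : set (measurableTypeR R)) by [].
have x0 (x : R) : 0 <= x ^+ k.*2 by rewrite -mul2n exprM exprn_ge0// sqr_ge0.
have [lk ek] := normal_even_density (L1_normal_even k).
have [lk1 ek1] := normal_even_density (L1_normal_even k.+1).
have [ls es] := normal_even_scale k s0.
have {ls}[ls es'] := normal_even_density ls.
rewrite [s ^+ k.*2.+1]exprS -[s * _ * _]mulrA -es es' ek ek1.
set c := (s ^- 2 - 1) / 2.
rewrite -(RintegralZl c mT lk1) -(RintegralZl s mT ls) -RintegralB//; last first.
  exact: (integrableZl mT c lk1).
apply: le_Rintegral => //.
- exact: (integrableB mT lk (integrableZl mT c lk1)).
- exact: (integrableZl mT s ls).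
move=> x _; rewrite [leRHS]mulrCA.
have -> : x ^+ k.+1.*2 = x ^+ k.*2 * x ^+ 2 by rewrite doubleS -addn2 exprD.
rewrite [leLHS](_ : _ = x ^+ k.*2 * ((1 - c * x ^+ 2) * normal_pdf 0 1 x)); last by ring.
by rewrite ler_wpM2l//; exact: normal_pdf_tangent.
Qed.

Lemma normal_moment0 : mom 0 = 1.
Proof. by under [X in Ex _ X]eq_fun do rewrite expr0; exact: Ex_cst. Qed.

(** Multiplied by [s^2], the tangent inequality states that a polynomial with a root at 1 is
    nonnegative for [s > 0]. Its quotient [g] by [s - 1] changes sign at 1, so [g] vanishes there,
    and [g.[1]] is the difference of the two sides of the recurrence. *)
Lemma normal_moment_rec (k : nat) : mom k.+1 = k.*2.+1%:R * mom k.
Proof.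
have T (s : R) := @normal_moment_tangent k s.
set a := mom k in T *; set b := mom k.+1 in T *.
pose g := a *: ('X^2 * \sum_(i < k.*2.+1) 'X^i) - (b / 2) *: ('X + 1%:P) : {poly R}.
have gE s : (s - 1) * g.[s] =
    s ^+ 2 * (s ^+ k.*2.+1 * a - a) - (s ^+ 2 - 1) / 2 * b.
  rewrite /g hornerD hornerN !hornerZ hornerM hornerXn hornerD hornerX hornerC.
  rewrite horner_sum; under eq_bigr do rewrite hornerXn.
  rewrite (_ : s ^+ k.*2.+1 * a - a = (s ^+ k.*2.+1 - 1) * a); last by ring.
  by rewrite subrX1; field.
have g0 s : 0 < s -> 0 <= (s - 1) * g.[s].
  move=> s0; rewrite gE; have := ler_wpM2l (sqr_ge0 s) (T _ s0).
  have -> : s ^+ 2 * (a - (s ^- 2 - 1) / 2 * b) =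
      s ^+ 2 * a - (1 - s ^+ 2) / 2 * b by field; rewrite gt_eqF.
  by set c := s ^+ k.*2.+1; lra.
have cg eps : 0 < eps -> exists2 e : R, 0 < e & forall s, `|1 - s| < e ->
    `|g.[1] - g.[s]| < eps.
  move=> e0; have /cvgrPdist_lt/(_ _ e0)/nbhs_normP[e /= e1 h] :=
    @continuous_horner _ g (1 : R).
  by exists e => // s s1; exact: h.
have h1 : 0 <= g.[1].
  rewrite leNgt; apply/negP => n; have n' : 0 < - g.[1] by rewrite oppr_gt0.
  have [e e0 h] := cg _ n'.
  have s1 : `|1 - (1 + e / 2)| < e.
    by rewrite opprD addrA subrr add0r normrN gtr0_norm; lra.
  have := h _ s1; have := g0 (1 + e / 2); rewrite addrAC subrr add0r.
  rewrite pmulr_rge0 ?divr_gt0// ltr_norml => /(_ ltac:(lra)); lra.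
have h2 : g.[1] <= 0.
  rewrite leNgt; apply/negP => n; have [e e0 h] := cg _ n.
  pose t := Num.min (e / 2) (1 / 2).
  have t0 : 0 < t by rewrite lt_min; lra.
  have t1 : t <= 1 / 2 by rewrite ge_min lexx orbT.
  have t2 : t <= e / 2 by rewrite ge_min lexx.
  have s1 : `|1 - (1 - t)| < e by rewrite opprB addrC subrK gtr0_norm; lra.
  have := h _ s1; have := g0 (1 - t); rewrite addrAC subrr add0r.
  rewrite nmulr_rge0 ?oppr_lt0// ltr_norml => /(_ ltac:(lra)); lra.
have : g.[1] = 0 by apply/le_anti; rewrite h1 h2.
rewrite /g hornerD hornerN !hornerZ hornerM hornerXn hornerD hornerX hornerC.
rewrite horner_sum; under eq_bigr do rewrite hornerXn expr1n.
rewrite sumr_const card_ord expr1n mul1r => /eqP; rewrite subr_eq0 => /eqP e.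
by rewrite mulrC e; field.
Qed.

Let odd_le_even (x : R) (k : nat) :
  `|x ^+ k.*2.+1| <= `|x ^+ k.*2 + x ^+ k.+1.*2|.
Proof.
have x0 : 0 <= x ^+ k.*2 by rewrite -mul2n exprM exprn_ge0// sqr_ge0.
have -> : x ^+ k.+1.*2 = x ^+ k.*2 * x ^+ 2 by rewrite doubleS -addn2 exprD.
rewrite -{1}[x ^+ k.*2]mulr1 -mulrDr exprS mulrC !normrM ler_wpM2l//.
rewrite [leRHS]ger0_norm ?addr_ge0 ?sqr_ge0// ler_norml.
by apply/andP; split; nra.
Qed.

(** Integrability follows from the two neighbouring even powers, and the value from the invariance
    of the law under [x -> - x]. *)
Lemma normal_odd (k : nat) : L1 (normal_prob 0 1) (fun x : R => x ^+ k.*2.+1) /\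
  Ex (normal_prob 0 1) (fun x : R => x ^+ k.*2.+1) = 0.
Proof.
have mx : measurable_fun setT (fun x : R => x ^+ k.*2.+1) by exact: measurable_funX.
have l : L1 (normal_prob 0 1) (fun x : R => x ^+ k.*2.+1).
  apply: (L1_le (P := normal_prob 0 1) mx
    (Y := fun x : R => x ^+ k.*2 + x ^+ k.+1.*2)).
    by move=> x; exact: odd_le_even.
  by apply: L1D; exact: L1_normal_even.
split=> //.
have mN : measurable_fun setT (fun x : R => -1 * x) by exact: mulrl_measurable.
have [|_] := law_Ex (P := normal_prob 0 1) (Q := normal_prob 0 1) mN mx _ l.
  move=> A mA; transitivity (normal_prob 0 (`|-1| * 1) A).
    by apply: normal_prob_scale; rewrite ?oppr_eq0 ?oner_eq0.
  by rewrite normrN1 mul1r.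
rewrite (_ : _ \o _ = (fun x : R => -1 * x ^+ k.*2.+1)); last first.
  apply/funext => x /=; rewrite exprMn -signr_odd /= odd_double /=.
  by rewrite expr1.
rewrite ExZl// => e; lra.
Qed.

End normal_law.

(** * A central limit theorem for cosine transforms *)

Section cosine_bounds.
Context {R : realType}.

(** Applied repeatedly, each inequality below being the derivative of the next, this produces the
    Taylor bounds for sine and cosine. *)
Lemma ge0_of_derive (f df : R -> R) :
  (forall x : R, is_derive x (1 : R) f (df x)) ->
  f 0 = 0 -> (forall x, 0 <= x -> 0 <= df x) -> forall x, 0 <= x -> 0 <= f x.
Proof.
move=> fd f0 df0 x; rewrite le_eqVlt => /predU1P[<-|x0]; first by rewrite f0.
have fc : {within `[0, x], continuous f}.
  apply: continuous_subspaceT => y.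
  by apply: differentiable_continuous; apply/derivable1_diffP; have [] := fd y.
have [c] := MVT x0 (fun y _ => fd y) fc.
rewrite in_itv /= f0 !subr0 => /andP[c0 _] ->.
by rewrite mulr_ge0// ?df0// ltW.
Qed.

Lemma sin_le (x : R) : 0 <= x -> sin x <= x.
Proof.
move=> x0; rewrite -subr_ge0.
apply: (ge0_of_derive (f := fun x => x - sin x) (df := fun x => 1 - cos x)) => //.
by rewrite sin0 subr0.
Qed.

Lemma cos_ge_lin (x : R) : 0 <= x -> 0 <= cos x - 1 + x.
Proof.
apply: (ge0_of_derive (f := fun x => cos x - 1 + x) (df := fun x => - sin x + 1)).
- by move=> y; apply: is_derive_eq; rewrite subr0.
- by rewrite cos0 subrr addr0.
- by move=> y _; rewrite addrC subr_ge0 sin_le1.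
Qed.

Lemma cos_ge_quad (x : R) : 0 <= x -> 0 <= cos x - 1 + x * x / 2.
Proof.
apply: (ge0_of_derive (f := fun x => cos x - 1 + x * x / 2) (df := fun x => - sin x + x)).
- move=> y; apply: is_derive_eq; rewrite subr0; congr (_ + _).
  by rewrite /GRing.scale /=; field.
- by rewrite cos0 subrr mul0r mul0r addr0.
- by move=> y y0; rewrite addrC subr_ge0 sin_le.
Qed.

Lemma sin_ge_cubic (x : R) : 0 <= x -> 0 <= sin x - x + x * x * x / 6.
Proof.
apply: (ge0_of_derive (f := fun x => sin x - x + x * x * x / 6)
  (df := fun x => cos x - 1 + x * x / 2)).
- move=> y; apply: is_derive_eq; congr (_ + _).
  by rewrite /GRing.scale /=; field.
- by rewrite sin0 subr0 !mul0r addr0.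
- exact: cos_ge_quad.
Qed.

Lemma sin_ge_quad (x : R) : 0 <= x -> 0 <= sin x - x + x * x / 2.
Proof.
apply: (ge0_of_derive (f := fun x => sin x - x + x * x / 2)
  (df := fun x => cos x - 1 + x)).
- move=> y; apply: is_derive_eq; congr (_ + _).
  by rewrite /GRing.scale /=; field.
- by rewrite sin0 subr0 !mul0r addr0.
- exact: cos_ge_lin.
Qed.

Lemma cos_le_cubic (x : R) : 0 <= x -> 0 <= 1 - x * x / 2 + x * x * x / 6 - cos x.
Proof.
apply: (ge0_of_derive (f := fun x => 1 - x * x / 2 + x * x * x / 6 - cos x)
  (df := fun x => sin x - x + x * x / 2)).
- move=> y; apply: is_derive_eq.
  by rewrite /GRing.scale /=; field.
- by rewrite cos0 !mul0r subr0 addr0 subrr.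
- exact: sin_ge_quad.
Qed.

Lemma sin_taylor (x : R) : `|sin x - x| <= `|x| ^+ 3.
Proof.
wlog x0 : x / 0 <= x.
  move=> h; have [/h//|/ltW x0] := leP 0 x.
  have := h (- x); rewrite oppr_ge0 => /(_ x0).
  by rewrite sinN -opprD !normrN.
have := sin_le x0; have := sin_ge_cubic x0.
rewrite (ger0_norm x0) ler_norml !exprS expr0 mulr1.
have : 0 <= x * (x * x) by rewrite !mulr_ge0.
by move=> *; apply/andP; split; lra.
Qed.

Lemma cos_taylor (x : R) : `|cos x - 1 + x ^+ 2 / 2| <= `|x| ^+ 3.
Proof.
wlog x0 : x / 0 <= x.
  move=> h; have [/h//|/ltW x0] := leP 0 x.
  have := h (- x); rewrite oppr_ge0 => /(_ x0).
  by rewrite cosN sqrrN normrN.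
have := cos_ge_quad x0; have := cos_le_cubic x0.
rewrite (ger0_norm x0) ler_norml !exprS expr0 mulr1.
have : 0 <= x * (x * x) by rewrite !mulr_ge0.
by move=> *; apply/andP; split; lra.
Qed.

(** Both signs are treated at once: [z + e cos (z + y)] is nondecreasing in [z] as soon as
    [|e| <= 1]. *)
Lemma cos_lip (x y : R) : `|cos x - cos y| <= `|x - y|.
Proof.
wlog xy : x y / y <= x.
  by move=> h; have [/h//|/ltW/h] := leP y x; rewrite distrC [`|y - x|]distrC.
rewrite [leRHS]ger0_norm ?subr_ge0// ler_norml opprB.
have key (e : R) : `|e| <= 1 -> 0 <= (x - y) + e * (cos x - cos y).
  move=> e1; have d0 : 0 <= x - y by rewrite subr_ge0.
  have := @ge0_of_derive (fun z => z + e * (cos (z + y) - cos y))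
    (fun z => 1 - e * sin (z + y)).
  move=> /(_ _ _ _ (x - y) d0); rewrite subrK; apply.
  - by move=> z; apply: is_derive_eq; rewrite /GRing.scale /=; ring.
  - by rewrite !add0r subrr mulr0.
  - move=> z _; rewrite subr_ge0 (le_trans (ler_norm _))// normrM.
    by rewrite mulr_ile1// ler_norml sin_geN1 sin_le1.
have := key 1; have := key (-1); rewrite normrN1 normr1 !lexx.
by move=> /(_ isT) h1 /(_ isT) h2; apply/andP; split; lra.
Qed.

Lemma expR_quad (t : R) : 0 <= t -> `|expR (- t) - 1 + t| <= t ^+ 2.
Proof.
move=> t0; have h1 := expR_ge1Dx (- t); have h2 := expR_ge1Dx t.
rewrite ger0_norm; last lra.
have e0 := expR_gt0 t; rewrite expRN.
have : (expR t)^-1 <= (1 + t)^-1 by rewrite lef_pV2// ?posrE// ltr_wpDr.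
have : (1 + t)^-1 <= 1 - t + t ^+ 2.
  rewrite -[leLHS]mul1r ler_pdivrMr ?ltr_wpDr//.
  have : 0 <= t ^+ 3 by rewrite exprn_ge0.
  have -> : (1 - t + t ^+ 2) * (1 + t) = 1 + t ^+ 3 by ring.
  by lra.
by lra.
Qed.

End cosine_bounds.

Section cosine_clt.
Context {R : realType} {d : measure_display} {Om : measurableType d}
  (P : probability Om R).

Lemma measurable_cos_comp d' (T : measurableType d') (X : T -> R) : measurable_fun setT X ->
  measurable_fun setT (fun w => cos (X w)).
Proof.
move=> mX; apply: (measurableT_comp (f := cos)) => //.
by apply: continuous_measurable_fun; exact: continuous_cos.
Qed.

Lemma measurable_sin_comp d' (T : measurableType d') (X : T -> R) : measurable_fun setT X ->
  measurable_fun setT (fun w => sin (X w)).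
Proof.
move=> mX; apply: (measurableT_comp (f := sin)) => //.
by apply: continuous_measurable_fun; exact: continuous_sin.
Qed.

Lemma L1_cos (X : Om -> R) : measurable_fun setT X -> L1 P (fun w => cos (X w)).
Proof.
move=> mX; apply: (@L1_bounded _ _ _ _ _ 1); first exact: measurable_cos_comp.
by move=> w; exact: cos_max.
Qed.

Lemma L1_sin (X : Om -> R) : measurable_fun setT X -> L1 P (fun w => sin (X w)).
Proof.
move=> mX; apply: (@L1_bounded _ _ _ _ _ 1); first exact: measurable_sin_comp.
by move=> w; exact: sin_max.
Qed.

Lemma Ex_bounded (X : Om -> R) c : L1 P X -> (forall w, `|X w| <= c) -> `|Ex P X| <= c.
Proof.
move=> lX Xc; apply: le_trans (Ex_norm lX) _; rewrite -[leRHS](Ex_cst P).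
by apply: Ex_le => //; [exact: L1_norm|exact: L1_cst].
Qed.

Lemma indep_rv_comp (U V : Om -> R) (f g : R -> R) :
  measurable_fun setT f -> measurable_fun setT g ->
  indep_rv P U V -> indep_rv P (f \o U) (g \o V).
Proof.
move=> mf mg UV A B mA mB; apply: (UV (f @^-1` A) (g @^-1` B)).
- exact: measurable_preim mf mA.
- exact: measurable_preim mg mB.
Qed.

Section sums.
Context (eta : nat -> Om -> R) (v K : R).
Let S m w := \sum_(i < m) eta i w.
Hypothesis eta_L2 : forall i, L2 P (eta i).
Hypothesis eta_indep : forall m, indep_rv P (S m) (eta m).
Hypothesis eta_mean : forall i, Ex P (eta i) = 0.
Hypothesis eta_var : forall i, Ex P (fun w => eta i w ^+ 2) = v.
Hypothesis eta_L3 : forall i, L1 P (fun w => `|eta i w| ^+ 3).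
Hypothesis eta_third : forall i, Ex P (fun w => `|eta i w| ^+ 3) <= K.

Let mS m : measurable_fun setT (S m).
Proof. by apply: measurable_sum => i; exact: (eta_L2 i).1. Qed.

Let mlin (x s : R) (X : Om -> R) : measurable_fun setT X ->
  measurable_fun setT (fun w => x + s * X w).
Proof. by move=> mX; apply: measurable_funD => //; exact: measurable_funM. Qed.

Let v0 : 0 <= v.
Proof. by rewrite -(eta_var 0); apply: Ex_ge0 => w; exact: sqr_ge0. Qed.

Let K0 : 0 <= K.
Proof.
by apply: le_trans (eta_third 0); apply: Ex_ge0 => w; exact: exprn_ge0.
Qed.

Let cos_step (s : R) i :
  `|Ex P (fun w => cos (s * eta i w)) - (1 - s ^+ 2 * v / 2)| <= `|s| ^+ 3 * K.
Proof.
have [mi li] := eta_L2 i.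
have mse : measurable_fun setT (fun w => s * eta i w) by exact: measurable_funM.
have l3 : L1 P (fun w => `|s| ^+ 3 * `|eta i w| ^+ 3) by exact: L1Zl.
have lq : L1 P (fun w => 1 - s ^+ 2 / 2 * eta i w ^+ 2).
  by apply: L1B; [exact: L1_cst|exact: L1Zl].
have <- : Ex P (fun w => 1 - s ^+ 2 / 2 * eta i w ^+ 2) = 1 - s ^+ 2 * v / 2.
  rewrite ExB; [|exact: L1_cst|exact: L1Zl].
  by rewrite Ex_cst ExZl// eta_var mulrAC.
rewrite -ExB//; last exact: L1_cos.
apply: le_trans (Ex_norm _) _; first by apply: L1B => //; exact: L1_cos.
apply: (@le_trans _ _ (Ex P (fun w => `|s| ^+ 3 * `|eta i w| ^+ 3))); last first.
  by rewrite ExZl// ler_wpM2l ?exprn_ge0.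
apply: Ex_le => //; first by apply: L1_norm; apply: L1B => //; exact: L1_cos.
move=> w; rewrite -exprMn -normrM; apply: le_trans (cos_taylor _).
rewrite le_eqVlt; apply/orP; left; apply/eqP; congr `|_|.
by rewrite exprMn; set a := cos _; set b := _ ^+ 2; set c := _ ^+ 2; field.
Qed.

Let sin_step (s : R) i : `|Ex P (fun w => sin (s * eta i w))| <= `|s| ^+ 3 * K.
Proof.
have lX := L2_L1 (eta_L2 i); have [mi li] := eta_L2 i.
have mse : measurable_fun setT (fun w => s * eta i w) by exact: measurable_funM.
have l3 : L1 P (fun w => `|s| ^+ 3 * `|eta i w| ^+ 3) by exact: L1Zl.
have ls := L1_sin mse.
have -> : Ex P (fun w => sin (s * eta i w)) =
    Ex P (fun w => sin (s * eta i w) - s * eta i w).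
  by rewrite ExB//; [rewrite ExZl// eta_mean mulr0 subr0|exact: L1Zl].
have lB : L1 P (fun w => sin (s * eta i w) - s * eta i w).
  by apply: L1B => //; exact: L1Zl.
apply: le_trans (Ex_norm lB) _.
apply: (@le_trans _ _ (Ex P (fun w => `|s| ^+ 3 * `|eta i w| ^+ 3))); last first.
  by rewrite ExZl// ler_wpM2l ?exprn_ge0.
apply: Ex_le => //; first exact: L1_norm.
by move=> w; rewrite -exprMn -normrM; exact: sin_taylor.
Qed.

(** [e s] is the cosine transform at frequency [s] of a centred normal variable of variance [v].
    [del s] is the price of using it for one summand: third-order errors of the cosine and of the
    sine, and the second-order error of the exponential. *)
Let e s := expR (- (s ^+ 2 * v / 2)).
Let del s := 2 * (`|s| ^+ 3 * K) + (s ^+ 2 * v / 2) ^+ 2.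

(** Induction on the number of summands. The addition formula and independence factor the
    expectation; the sine of the new summand is nearly centred and its cosine nearly [e s]. The
    phase [x] makes real transforms carry the information of a characteristic function. *)
Lemma cos_sum_bound (x s : R) m :
  `|Ex P (fun w => cos (x + s * S m w)) - e s ^+ m * cos x| <= m%:R * del s.
Proof.
have sv0 : 0 <= s ^+ 2 * v / 2 by rewrite divr_ge0// mulr_ge0// sqr_ge0.
have es : `|Ex P (fun w => cos (s * eta 0 w)) - e s| <= `|s| ^+ 3 * K + (s ^+ 2 * v / 2) ^+ 2.
  have := cos_step s 0; have := expR_quad sv0; rewrite -/(e s).
  by rewrite !ler_norml => /andP[? ?] /andP[? ?]; apply/andP; split; lra.
have es' i : `|Ex P (fun w => cos (s * eta i w)) - e s| <= `|s| ^+ 3 * K + (s ^+ 2 * v / 2) ^+ 2.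
  have := cos_step s i; have := expR_quad sv0; rewrite -/(e s).
  by rewrite !ler_norml => /andP[? ?] /andP[? ?]; apply/andP; split; lra.
have e0 : 0 <= e s by exact: expR_ge0.
have e1 : e s <= 1 by rewrite -[leRHS]expR0 ler_expR oppr_le0.
elim: m => [|m IH].
  rewrite expr0 !mul1r mul0r /S.
  under [X in Ex P X]eq_fun do rewrite big_ord0 mulr0 addr0.
  by rewrite Ex_cst subrr normr0.
have mSm := mlin x s (mS m).
have me : measurable_fun setT (fun w => s * eta m w).
  by apply: measurable_funM => //; exact: (eta_L2 m).1.
have mc a b : measurable_fun setT (fun y : R => cos (a + b * y)).
  apply: measurable_cos_comp; apply: measurable_funD => //; exact: measurable_funM.
have ms a b : measurable_fun setT (fun y : R => sin (a + b * y)).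
  apply: measurable_sin_comp; apply: measurable_funD => //; exact: measurable_funM.
have mc' b : measurable_fun setT (fun y : R => cos (b * y)).
  by apply: measurable_cos_comp; exact: measurable_funM.
have ms' b : measurable_fun setT (fun y : R => sin (b * y)).
  by apply: measurable_sin_comp; exact: measurable_funM.
have [lcc ecc] := indep_Ex (indep_rv_comp (mc x s) (mc' s) (eta_indep m))
  (L1_cos mSm) (L1_cos me).
have [lss ess] := indep_Ex (indep_rv_comp (ms x s) (ms' s) (eta_indep m))
  (L1_sin mSm) (L1_sin me).
have -> : Ex P (fun w => cos (x + s * S m.+1 w)) =
  Ex P (fun w => cos (x + s * S m w)) * Ex P (fun w => cos (s * eta m w)) -
  Ex P (fun w => sin (x + s * S m w)) * Ex P (fun w => sin (s * eta m w)).
  rewrite -[X in _ = X - _]ecc -[X in _ = _ - X]ess -ExB//.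
  congr (Ex P _); apply/funext => w.
  by rewrite /S big_ord_recr /= mulrDr addrA cosD.
have c1 := Ex_bounded (L1_cos mSm) (fun w => cos_max _).
have s1 := Ex_bounded (L1_sin mSm) (fun w => sin_max _).
have := sin_step s m; have := es' m; move: IH c1 s1.
set C := Ex P (fun w => cos (x + s * S m w)); set D := Ex P (fun w => sin (x + _)).
set c := Ex P _; set si := Ex P _ => IH c1 s1 h1 h2.
have -> : C * c - D * si - e s ^+ m.+1 * cos x =
  C * (c - e s) - D * si + e s * (C - e s ^+ m * cos x) by rewrite exprS; ring.
apply: le_trans (ler_normD _ _) _; apply: le_trans (lerD (ler_normB _ _) (lexx _)) _.
rewrite !normrM.
have a1 : `|C| * `|c - e s| <= `|c - e s| by rewrite ler_piMl.
have a2 : `|D| * `|si| <= `|si| by rewrite ler_piMl.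
have a3 : `|e s| * `|C - e s ^+ m * cos x| <= `|C - e s ^+ m * cos x|.
  by rewrite ler_piMl// ger0_norm.
rewrite -natr1 mulrDl mul1r /del.
move: IH; rewrite {1}/del => IH.
by move: a1 a2 a3 IH h1 h2; lra.
Qed.

Lemma cos_clt (x : R) n : (0 < n)%N ->
  `|Ex P (fun w => cos (x + (Num.sqrt n%:R)^-1 * S n w)) - expR (- (v / 2)) * cos x|
  <= (2 * K + v ^+ 2) / Num.sqrt n%:R.
Proof.
move=> n0; pose r : R := Num.sqrt n%:R.
have nn : (0 : R) < n%:R by rewrite ltr0n.
have r0 : 0 < r by rewrite sqrtr_gt0.
have rr : r ^+ 2 = n%:R by rewrite sqr_sqrtr// ltW.
have r1 : 1 <= r by rewrite -[leLHS]sqrtr1 ler_sqrt ?ler1n.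
have := cos_sum_bound x r^-1 n.
have -> : e r^-1 ^+ n = expR (- (v / 2)).
  rewrite /e -expRM_natl; congr expR.
  by rewrite exprVn rr; field; rewrite gt_eqF.
move=> /le_trans; apply; rewrite -/r /del -rr gtr0_norm ?invr_gt0//.
have -> : r ^+ 2 * (2 * (r^-1 ^+ 3 * K) + (r^-1 ^+ 2 * v / 2) ^+ 2) =
  (2 * K + v ^+ 2 / 4 / r) / r by field; rewrite gt_eqF.
rewrite ler_pM2r ?invr_gt0// lerD2l ler_pdivrMr//.
by have := sqr_ge0 v; nra.
Qed.

End sums.
End cosine_clt.

(** * Weak convergence from cosine transforms *)

Section trigonometric_polynomials.
Context {R : realType}.

(** The phase makes sines and constants available and, by the product-to-sum formula, closes the
    class under products. *)
Inductive trig (q : nat) : ('cV[R]_q -> R) -> Prop :=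
| trig_cos (u : 'cV[R]_q) (c : R) : trig (fun x : 'cV[R]_q => cos ((u^T *m x) 0 0 + c))
| trigD (F G : 'cV[R]_q -> R) :
    trig F -> trig G -> trig (fun x => F x + G x)
| trigZ (a : R) (F : 'cV[R]_q -> R) : trig F -> trig (fun x => a * F x).

Lemma trig_cst q a : trig (fun _ : 'cV[R]_q => a).
Proof.
have := trigZ a (@trig_cos q 0 0).
by under eq_fun do rewrite trmx0 mul0mx mxE addr0 cos0 mulr1.
Qed.

Lemma trig_sin q (u : 'cV[R]_q) : trig (fun x => sin ((u^T *m x) 0 0)).
Proof.
by have := trig_cos u (- (pi / 2)); under eq_fun do rewrite cosBpihalf.
Qed.

Lemma trigM q (F G : 'cV[R]_q -> R) : trig F -> trig G -> trig (fun x => F x * G x).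
Proof.
elim=> [u c|F1 F2 _ IH1 _ IH2|a F1 _ IH] tG; first last.
- by under eq_fun do rewrite -mulrA; apply: trigZ; exact: IH.
- by under eq_fun do rewrite mulrDl; apply: trigD; [exact: IH1|exact: IH2].
elim: tG => [v c'|F1 F2 _ IH1 _ IH2|a F1 _ IH]; first last.
- by under eq_fun do rewrite mulrCA; apply: trigZ; exact: IH.
- by under eq_fun do rewrite mulrDr; apply: trigD; [exact: IH1|exact: IH2].
have := trigZ 2^-1 (trigD (trig_cos (u + v) (c + c')) (trig_cos (u - v) (c - c'))).
congr trig; apply/funext => x.
have -> : ((u + v)^T *m x) 0 0 = (u^T *m x) 0 0 + (v^T *m x) 0 0.
  by rewrite linearD mulmxDl mxE.
have -> : ((u - v)^T *m x) 0 0 = (u^T *m x) 0 0 - (v^T *m x) 0 0.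
  by rewrite linearB mulmxBl !mxE.
set a := (_ *m _) 0 0; set b := (_ *m _) 0 0.
have -> : a + b + (c + c') = (a + c) + (b + c') by ring.
have -> : a - b + (c - c') = (a + c) - (b + c') by ring.
by rewrite cosD cosB; field.
Qed.

End trigonometric_polynomials.

(** * Multivariate Bernstein polynomials *)

Section coin_walk.
Context {R : realType} {q : nat}.
Implicit Types (t : 'I_q -> R) (G : 'cV[R]_q -> R) (a : 'cV[R]_q) (l : seq 'I_q).

(* The expectation of G at the end of a random walk started at a, whose step
   along each coordinate j of l has length s with probability t j and is null
   otherwise; for s = 1/N and N steps per coordinate this is the Bernstein
   polynomial of G. *)
Fixpoint walk (s : R) l t G a : R :=
  if l is j :: l' then
    t j * walk s l' t G (a + s *: delta_mx j 0) + (1 - t j) * walk s l' t G a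
  else G a.

Lemma walk_le s l t G H a : (forall j, 0 <= t j <= 1) ->
  (forall x, G x <= H x) -> walk s l t G a <= walk s l t H a.
Proof.
move=> t01 GH; elim: l a => //= j l IH a; have /andP[? ?] := t01 j.
by rewrite lerD// ler_wpM2l// subr_ge0.
Qed.

Lemma walk_cst s l t c a : walk s l t (fun=> c) a = c.
Proof. by elim: l a => //= j l IH a; rewrite !IH; ring. Qed.

Lemma walkD s l t G H a :
  walk s l t (fun x => G x + H x) a = walk s l t G a + walk s l t H a.
Proof. by elim: l a => //= j l IH a; rewrite !IH; ring. Qed.

Lemma walkZ s l t c G a : walk s l t (fun x => c * G x) a = c * walk s l t G a.
Proof. by elim: l a => //= j l IH a; rewrite !IH; ring. Qed.

Lemma walk_sum s l t (I : finType) (F : I -> 'cV[R]_q -> R) a :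
  walk s l t (fun x => \sum_i F i x) a = \sum_i walk s l t (F i) a.
Proof.
elim: l a => //= j l IH a; rewrite !IH !mulr_sumr -big_split.
by apply: eq_bigr => i _.
Qed.

(** Squared bias plus variance of a scaled binomial variable, whose number of trials is the number
    of occurrences of [i] in [l]. *)
Lemma walk_coord s l t i c a :
  walk s l t (fun x => (x i 0 - c) ^+ 2) a =
  (a i 0 + s * (count_mem i l)%:R * t i - c) ^+ 2
  + s ^+ 2 * (count_mem i l)%:R * t i * (1 - t i).
Proof.
elim: l a => [|j l IH] a /=; first by ring.
rewrite !IH !mxE natrD [(j == i)]eq_sym eqxx andbT.
case: eqVneq => [->|_] /=; last by rewrite mulr0 addr0 add0r; ring.
by rewrite mulr1 mulr1n; set m := (count_mem _ _)%:R; ring.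
Qed.

Lemma walk_trig s l (t : 'cV[R]_q -> 'I_q -> R) G a :
  (forall j, trig (fun x => t x j)) -> trig (fun x => walk s l (t x) G a).
Proof.
move=> tt; elim: l a => [|j l IH] a /=; first exact: trig_cst.
apply: trigD; apply: trigM => //.
under eq_fun do rewrite -mulN1r; apply: trigD; first exact: trig_cst.
exact: trigZ.
Qed.

Definition all_coords N : seq 'I_q := flatten [seq nseq N j | j <- enum 'I_q].

Lemma count_all_coords N i : count_mem i (all_coords N) = N.
Proof.
rewrite /all_coords count_flatten sumnE !big_map.
rewrite -enumT big_enum /= (bigD1 i)//=.
rewrite count_nseq /= eqxx mul1n big1 ?addn0// => j ji.
by rewrite count_nseq /= (negbTE ji).
Qed.

Lemma walk_sq N t : (0 < N)%N -> (forall j, 0 <= t j <= 1) ->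
  walk N%:R^-1 (all_coords N) t (fun x => sq (x - \col_j t j)) 0 <= q%:R / N%:R.
Proof.
move=> N0 t01.
have -> : (fun x : 'cV[R]_q => sq (x - \col_j t j)) =
    (fun x => \sum_i (x i 0 - t i) ^+ 2).
  by apply/funext => x; rewrite /sq; apply: eq_bigr => i _; rewrite !mxE.
rewrite walk_sum -[in leRHS](card_ord q) mulrC mulr_natr -sumr_const ler_sum// => i _.
have nN : N%:R != 0 :> R by rewrite pnatr_eq0 -lt0n.
rewrite walk_coord count_all_coords mxE add0r mulVf// mul1r subrr expr0n add0r.
have /andP[t0 t1] := t01 i.
have -> : N%:R^-1 ^+ 2 * N%:R * t i * (1 - t i) = N%:R^-1 * (t i * (1 - t i)).
  by field.
by rewrite ler_piMr ?invr_ge0//; nra.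
Qed.

End coin_walk.

Section uniform_modulus.
Context {R : realType} {q : nat}.

(** Uniform continuity near [C]: only one of the two points has to lie in the compact set, which
    suits functions given on the whole space. *)
Lemma compact_uniform (U : normedModType R) (C : set U) (G : U -> R) (e : R) :
  compact C -> continuous G -> 0 < e ->
  exists2 del : R, 0 < del & forall t s, C t -> `|s - t| < del -> `|G s - G t| < e.
Proof.
move=> cC cG e0.
pose Q (del : R) t := forall s, `|s - t| < del -> `|G s - G t| < e.
have /compact_near_coveringP/(_ _ (0^'+)%R Q) := cC.
case.
  move=> x Cx; have e20 : 0 < e / 2 by rewrite divr_gt0.
  have /cvgrPdist_lt/(_ _ e20)/nbhs_ballP[r /= r0 hr] := cG x.
  have r20 : 0 < r / 2 by rewrite divr_gt0.
  exists (ball x (r / 2), [set d | 0 < d < r / 2]) => /=.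
    split; first exact: nbhsx_ballx.
    near=> d; apply/andP; split; first by near: d; exact: nbhs_right_gt.
    by near: d; exact: nbhs_right_lt.
  move=> [t d] [/= xt /andP[d0 dr]] s st.
  have h1 : `|G x - G t| < e / 2 by apply: hr; apply: le_ball xt; lra.
  have h2 : `|G x - G s| < e / 2.
    apply: hr; rewrite [r]splitr; apply: ball_triangle xt _.
    by rewrite -ball_normE /= distrC; exact: lt_trans dr.
  rewrite (splitr e); apply: le_lt_trans (ler_distD (G x) _ _) _.
  by rewrite ltrD// distrC.
move=> d /= d0 hd; exists (d / 2); first by rewrite divr_gt0.
move=> t s Ct; apply: (hd (d / 2)) => //=.
  by rewrite /ball /= sub0r normrN gtr0_norm ?divr_gt0// ltr_pdivrMr// mulr_natr mulr2n ltrDl.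
by rewrite divr_gt0.
Unshelve. all: by end_near. Qed.

Lemma unit_cube_compact : compact [set t : 'cV[R]_q | forall j, 0 <= t j 0 <= 1].
Proof.
have cr := @rV_compact R q (fun=> `[0%R, 1%R]%classic) (fun=> @segment_compact _ _ _).
have -> : [set t : 'cV[R]_q | forall j, 0 <= t j 0 <= 1] =
    trmx @` [set v : 'rV[R]_q | forall i, `[0, 1]%classic (v 0 i)].
  apply/seteqP; split => [t h|_ [v h <-] j].
    by exists t^T => [i|]; rewrite ?trmxK//= mxE in_itv /=; exact: h.
  by have := h j; rewrite /= mxE in_itv.
apply: continuous_compact cr; apply: continuous_subspaceT => v A.
move=> /nbhs_ballP[e /= e0 he]; apply/nbhs_ballP; exists e => //= y vy.
by apply: he; split => // i j; rewrite !mxE; exact: vy.2.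
Qed.

(** Chebyshev's argument: [|G x - G t|] is at most [e / 2] within distance [del] and at most [2 M]
    beyond, hence bounded everywhere by [e / 2 + K |x - t|^2] with [K = 2 M / del^2]. The walk is a
    positive functional, and its variance is of order [1 / N]. *)
Lemma bernstein (G : 'cV[R]_q -> R) M (e : R) : continuous G ->
  (forall x, `|G x| <= M) -> 0 < e ->
  exists N, forall t, (forall j, 0 <= t j <= 1) ->
    `|walk N%:R^-1 (all_coords N) t G 0 - G (\col_j t j)| <= e.
Proof.
move=> cG GM e0; have e20 : 0 < e / 2 by rewrite divr_gt0.
have [del d0 hd] := compact_uniform unit_cube_compact cG e20.
have M0 : 0 <= M by apply: le_trans (GM 0).
pose K : R := 2 * M / del ^+ 2.
have K0 : 0 <= K by apply: divr_ge0; [exact: mulr_ge0|exact: sqr_ge0].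
pose N := (Num.truncn (K * q%:R / (e / 2))).+1; exists N => t t01.
have mod x : `|G x - G (\col_j t j)| <= e / 2 + K * sq (x - \col_j t j).
  have [xt|xt] := ltP `|x - \col_j t j| del.
    apply: (le_trans (ltW (hd _ _ _ xt))); first by move=> j /=; rewrite mxE.
    by rewrite lerDl mulr_ge0// sq_ge0.
  apply: (@le_trans _ _ (2 * M)).
    by rewrite (le_trans (ler_normB _ _))// mulr2n mulrDl mul1r lerD.
  apply: (@le_trans _ _ (K * sq (x - \col_j t j))); last by rewrite lerDr ltW.
  rewrite mulrAC ler_pdivlMr ?exprn_gt0// ler_wpM2l ?mulr_ge0//.
  by apply: le_trans (mxnorm_sq _); rewrite ler_pXn2r// ?nnegrE// ltW.
pose b := e / 2 + K * (q%:R / N%:R).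
have be : b <= e.
  rewrite /b [leRHS]splitr lerD2l mulrA ler_pdivrMr// [leRHS]mulrC -ler_pdivrMr//.
  by rewrite ltW// truncnS_gt.
have sqb : walk N%:R^-1 (all_coords N) t
    (fun x => e / 2 + K * sq (x - \col_j t j)) 0 <= b.
  by rewrite walkD walk_cst walkZ lerD2l ler_wpM2l// walk_sq.
pose c := G (\col_j t j).
rewrite (le_trans _ be)// ler_norml; apply/andP; split.
  rewrite lerBrDl -/c lerBlDr -lerBlDl.
  rewrite lerBlDl; apply: le_trans (lerD (lexx _) sqb).
  rewrite -[leLHS](walk_cst N%:R^-1 (all_coords N) t c 0).
  rewrite -walkD; apply: walk_le => // x.
  by have := mod x; rewrite ler_norml -/c => /andP[]; lra.
rewrite lerBlDr -/c; apply: (@le_trans _ _ (walk N%:R^-1 (all_coords N) t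
    (fun x => (e / 2 + K * sq (x - \col_j t j)) + c) 0)).
  apply: walk_le => // x.
  by have := mod x; rewrite ler_norml -/c => /andP[]; lra.
by rewrite walkD walk_cst lerD2r.
Qed.

End uniform_modulus.

(** * Trigonometric approximation on a box *)

Section box_approximation.
Context {R : realType} {q : nat}.

(** Truncation to the interval from -1/2 to 1/2 in closed form. It keeps the argument of [asin]
    inside the open domain where [asin] is continuous. *)
Let clip (y : R) := (`|y + 2^-1| - `|y - 2^-1|) / 2.

Let clip_bnd y : - 2^-1 <= clip y <= 2^-1.
Proof.
rewrite -ler_norml normrM [`|2^-1|]gtr0_norm ?invr_gt0// ler_piMl ?invr_ge0//.
apply: le_trans (ler_dist_dist _ _) _.
have -> : y + 2^-1 - (y - 2^-1) = 1 by field.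
by rewrite normr1.
Qed.

Let clip_id y : `|y| <= 2^-1 -> clip y = y.
Proof.
rewrite ler_norml => /andP[y1 y2]; rewrite /clip ger0_norm; last lra.
by rewrite ler0_norm; [field|lra].
Qed.

Let clip_continuous : continuous clip.
Proof.
move=> y; have c (b : R) : `|z + b| @[z --> y] --> `|y + b|.
  by apply: cvg_norm; apply: cvgD; [exact: cvg_id|exact: cvg_cst].
by apply: cvgMl; exact: cvgB.
Qed.

(** On the box, [x] is a continuous function of the numbers [(1 + sin (x_i / (2 L))) / 2], which lie
    in the unit interval; a Bernstein polynomial in them is a trigonometric polynomial in [x]. With
    the factor [2 L] the angles stay below 1/2, where the sine is injective and the clipping idle.
    Being an average of values of [g], the approximant keeps the bound [M] off the box. *)
Lemma trig_approx (g : 'cV[R]_q -> R) (M L e : R) : continuous g ->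
  (forall x, `|g x| <= M) -> 0 < L -> 0 < e ->
  exists T : 'cV[R]_q -> R, [/\ trig T, forall x, `|T x| <= M &
    forall x : 'cV[R]_q, (forall i, `|x i 0| <= L) -> `|T x - g x| <= e].
Proof.
move=> cg gM L0 e0; have L20 : 0 < 2 * L by rewrite mulr_gt0.
pose G (s : 'cV[R]_q) := g (\col_i (2 * L * asin (clip (2 * s i 0 - 1)))).
have cG : continuous G.
  move=> s; apply: continuous_comp; last exact: cg.
  move=> A /nbhs_ballP[r /= r0 hA].
  have near_i i : nbhs s [set s' : 'cV[R]_q |
    `|2 * L * asin (clip (2 * s i 0 - 1)) - 2 * L * asin (clip (2 * s' i 0 - 1))| < r].
    have h : {for s i 0, continuous (fun y : R => 2 * L * asin (clip (2 * y - 1)))}.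
      apply: cvgMr.
      apply: continuous_comp; last first.
        apply: continuous_asin; have /andP[h1 h2] := clip_bnd (2 * s i 0 - 1).
        by apply/andP; split; lra.
      apply: (continuous_comp (g := clip)); last exact: clip_continuous.
      by apply: cvgB; [apply: cvgMr; exact: cvg_id|exact: cvg_cst].
    have hc : (fun s' : 'cV[R]_q => s' i 0) @ s --> s i 0 by exact: coord_continuous.
    have /cvgrPdist_lt/(_ _ r0) := cvg_comp _ _ hc h.
    exact.
  have := filter_forall _ near_i; move=> /(_ _).
  apply: filterS => s' hs'; apply: hA; split => // i j; rewrite (ord1 j) !mxE.
  exact: hs'.
have [N hN] := bernstein cG (fun x => gM _) e0.
pose t (x : 'cV[R]_q) i := (1 + sin ((((2 * L)^-1 *: (delta_mx i 0 : 'cV[R]_q))^T *m x) 0 0)) / 2.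
have tE x i : t x i = (1 + sin ((2 * L)^-1 * x i 0)) / 2.
  rewrite /t linearZ /= -scalemxAl mxE; congr ((1 + sin (_ * _)) / 2).
  by rewrite trmx_delta -rowE mxE.
have t01 x i : 0 <= t x i <= 1.
  have := sin_geN1 ((2 * L)^-1 * x i 0); have := sin_le1 ((2 * L)^-1 * x i 0).
  by rewrite tE => *; apply/andP; split; lra.
exists (fun x => walk N%:R^-1 (all_coords N) (t x) G 0); split.
- apply: walk_trig => j; rewrite /t; under eq_fun do rewrite mulrC.
  by apply: trigZ; apply: trigD; [exact: trig_cst|exact: trig_sin].
- move=> x; rewrite ler_norml; apply/andP; split.
    rewrite -(walk_cst N%:R^-1 (all_coords N) (t x) (- M) 0).
    by apply: walk_le => // s; have := gM (\col_i (2 * L * asin (clip (2 * s i 0 - 1))));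
      rewrite ler_norml => /andP[].
  rewrite -(walk_cst N%:R^-1 (all_coords N) (t x) M 0).
  by apply: walk_le => // s; have := gM (\col_i (2 * L * asin (clip (2 * s i 0 - 1))));
    rewrite ler_norml => /andP[].
- move=> x xL; have -> : g x = G (\col_j t x j).
    congr g; apply/colP => i; rewrite !mxE tE.
    set y := (2 * L)^-1 * x i 0.
    have y2 : `|y| <= 2^-1.
      rewrite /y normrM gtr0_norm ?invr_gt0// invfM -mulrA ler_piMr ?invr_ge0//.
      by rewrite ler_pdivrMl// mulr1.
    have -> : 2 * ((1 + sin y) / 2) - 1 = sin y by field.
    have p1 := @pihalf_ge1 R.
    rewrite clip_id; last first.
      (* Between [y - pi / 2] and [- (pi / 2)] the Lipschitz bound reads [|sin y| <= |y|]. *)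
      by have := cos_lip (y - pi / 2) (- (pi / 2)); rewrite cosBpihalf cosN cos_pihalf
        subr0 opprK subrK => /le_trans; apply.
    rewrite sinK; first by rewrite /y mulrA divff ?mul1r// gt_eqF.
    by move: y2; rewrite ler_norml in_itv /= => /andP[? ?]; apply/andP; split; lra.
  exact: hN.
Qed.

End box_approximation.

(** * From cosine transforms to bounded continuous functions *)

Section weak_convergence.
Context {R : realType} {d : measure_display} {Om : measurableType d}
  (P : probability Om R) {q : nat}.

Lemma trig_measurable (T : 'cV[R]_q -> R) : trig T ->
  measurable_fun setT (T : borel R q -> R).
Proof.
elim=> [u c|F G _ IHF _ IHG|a F _ IHF].
- apply: measurable_cos_comp; apply: measurable_funD => //.
  under eq_fun do rewrite mxE; apply: measurable_sum => i.
  apply: measurable_funM => //.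
  by apply: continuous_borel_measurable => x; exact: coord_continuous.
- exact: measurable_funD.
- exact: measurable_funM.
Qed.

(* A trigonometric polynomial bounded like g approximates g on a large box, and
   the mass outside of the box is small. *)
Lemma box_close d' (Om' : measurableType d') (P' : probability Om' R)
    (Z : Om' -> 'cV[R]_q) (g T : 'cV[R]_q -> R) (M L e e' : R) :
  measurable_fun setT (Z : Om' -> borel R q) ->
  measurable_fun setT (g : borel R q -> R) ->
  measurable_fun setT (T : borel R q -> R) ->
  0 <= e -> (forall x, `|g x| <= M) -> (forall x, `|T x| <= M) ->
  (forall x : 'cV[R]_q, (forall i, `|x i 0| <= L) -> `|T x - g x| <= e) -> 0 <= L ->
  (P' [set w | (L ^+ 2 <= sq (Z w))%R] <= e'%:E)%E ->
  `|Ex P' (T \o Z) - Ex P' (g \o Z)| <= e + 2 * M * e'.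
Proof.
move=> mZ mg mT e0 gM TM Tg L0 PL.
have lg : L1 P' (g \o Z).
  by apply: (@L1_bounded _ _ _ _ _ M) => [|w]; [exact: (measurableT_comp mg mZ)|exact: gM].
have lT : L1 P' (T \o Z).
  by apply: (@L1_bounded _ _ _ _ _ M) => [|w]; [exact: (measurableT_comp mT mZ)|exact: TM].
have M0 : 0 <= M by apply: le_trans (gM 0).
set B := [set w | _] in PL.
have mB : measurable B.
  rewrite -[X in measurable X]setTI; apply: measurable_fun_le => //.
  by apply: measurable_sum => i; apply: measurable_funX; exact: measurable_coord.
have lB : L1 P' (\1_B : Om' -> R).
  by apply: (@L1_bounded _ _ _ _ _ 1) => [|w]; [exact: measurable_indic|rewrite indicE; case: (_ \in _); rewrite ?normr1 ?normr0].
have lBM : L1 P' (fun w => e + 2 * M * \1_B w) by apply: L1D; [exact: L1_cst|exact: L1Zl].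
rewrite -ExB//; apply: le_trans (Ex_norm (L1B lT lg)) _.
apply: (@le_trans _ _ (Ex P' (fun w => e + 2 * M * \1_B w))).
  apply: Ex_le => //; first exact: L1_norm (L1B lT lg).
  move=> w /=; rewrite indicE; case: (boolP (w \in B)) => [_|].
    rewrite mulr1 (le_trans (ler_normB _ _))// ler_wpDl// mulr2n mulrDl mul1r.
    exact: lerD.
  rewrite notin_setE /B /= => /negP; rewrite -ltNge => zL.
  rewrite mulr0 addr0; apply: Tg => i.
  rewrite -(@ler_pXn2r _ 2)// ?nnegrE// real_normK ?num_real//.
  exact: le_trans (ge_coord_sq _ _) (ltW zL).
rewrite ExD; [|exact: L1_cst|exact: L1Zl].
rewrite Ex_cst ExZl// lerD2l ler_wpM2l ?mulr_ge0//.
by rewrite -lee_fin -integral_Ex// integral_indic// setIT.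
Qed.

Lemma weak_convergence (Z : nat -> Om -> 'cV[R]_q) (mu : probability (borel R q) R) :
  (forall n, measurable_fun setT (Z n : Om -> borel R q)) ->
  (forall e : R, 0 < e -> exists2 L : R, 0 < L & \forall n \near \oo,
     (P [set w | (L ^+ 2 <= sq (Z n w))%R] <= e%:E)%E) ->
  (forall e : R, 0 < e -> exists2 L : R, 0 < L &
     (mu [set x | (L ^+ 2 <= sq x)%R] <= e%:E)%E) ->
  (forall (u : 'cV[R]_q) (c : R), Ex P (fun w => cos ((u^T *m Z n w) 0 0 + c)) @[n --> \oo]
     --> Ex mu (fun x => cos ((u^T *m x) 0 0 + c))) ->
  forall g : 'cV[R]_q -> R, continuous g -> (exists M : R, forall x, `|g x| <= M) ->
  'E_P[fun w => g (Z n w)]%E @[n --> \oo] --> (\int[mu]_x (g x)%:E)%E.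
Proof.
move=> mZ tightZ tightm cosZ g cg [M gM].
have M0 : 0 <= M by apply: le_trans (gM 0).
have mg : measurable_fun setT (g : borel R q -> R) by exact: continuous_borel_measurable.
have lg n : L1 P (fun w => g (Z n w)).
  by apply: (@L1_bounded _ _ _ _ _ M) => [|w]; [exact: (measurableT_comp mg (mZ n))|exact: gM].
have lm : L1 mu g by exact: (@L1_bounded _ _ _ _ _ M).
rewrite (integral_Ex lm); under eq_fun do rewrite ExE//.
apply: cvg_EFin; first by near=> n.
have trigZ T : trig T -> [/\ forall n, L1 P (fun w => T (Z n w)), L1 mu T &
    Ex P (fun w => T (Z n w)) @[n --> \oo] --> Ex mu T].
  elim=> [u c|F G _ [lF lFm cF] _ [lG lGm cG]|a F _ [lF lFm cF]].
  - have mT := trig_measurable (trig_cos u c); split; last exact: cosZ.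
      move=> n; apply: (@L1_bounded _ _ _ _ _ 1) => [|w]; last exact: cos_max.
      exact: (measurableT_comp mT (mZ n)).
    by apply: (@L1_bounded _ _ _ _ _ 1) => // w; exact: cos_max.
  - split; [by move=> n; exact: L1D|exact: L1D|].
    by rewrite ExD//; under eq_fun do rewrite ExD//; exact: cvgD.
  - split; [by move=> n; exact: L1Zl|exact: L1Zl|].
    by rewrite ExZl//; under eq_fun do rewrite ExZl//; exact: cvgMr.
apply/cvgrPdist_le => e e0.
(* Each of the two laws costs [e / 8] on the box and at most [e / 4] off it, and the transforms
   another [e / 4]: in all [e]. The [+ 1] covers [M = 0]. *)
pose e' := e / 8 / (M + 1).
have M1 : 0 < M + 1 by rewrite ltr_wpDl.
have e'0 : 0 < e' by rewrite !divr_gt0.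
have Me' : 2 * M * e' <= e / 4.
  have -> : 2 * M * e' = 2 * (M / (M + 1)) * (e / 8) by rewrite /e'; field; rewrite gt_eqF.
  have : M / (M + 1) <= 1 by rewrite ler_pdivrMr// mul1r lerDl.
  set z := M / (M + 1) => z1.
  by have := ltW e0; nra.
have [L L0 hL] := tightZ _ e'0; have [L' L'0 hL'] := tightm _ e'0.
pose K := Num.max L L'.
have K0 : 0 < K by rewrite lt_max L0.
have e80 : 0 < e / 8 by rewrite divr_gt0.
have [T [tT TM Tg]] := trig_approx cg gM K0 e80.
have [lTZ lTm cT] := trigZ T tT.
have mT := trig_measurable tT.
have Tg' (K' : R) (x : 'cV[R]_q) : K' <= K -> (forall i, `|x i 0| <= K') -> `|T x - g x| <= e / 8.
  by move=> KK h; apply: Tg => i; exact: le_trans (h i) KK.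
have mu_close : `|Ex mu T - Ex mu g| <= e / 8 + 2 * M * e'.
  have mid : measurable_fun setT (id : borel R q -> borel R q) by [].
  apply: (box_close (P' := mu) (L := L') mid) => //; [exact: ltW| |exact: ltW].
  by move=> x; apply: Tg' => //; rewrite le_max lexx orbT.
have e40 : 0 < e / 4 by rewrite divr_gt0.
have /cvgrPdist_le/(_ _ e40) cT' := cT.
near=> n.
have Z_close : `|Ex P (T \o Z n) - Ex P (g \o Z n)| <= e / 8 + 2 * M * e'.
  apply: (box_close (L := L)) => //; [exact: ltW| |exact: ltW|by near: n].
  by move=> x; apply: Tg' => //; rewrite le_max lexx.
have T_close : `|Ex mu T - Ex P (T \o Z n)| <= e / 4 by near: n.
move: mu_close Z_close T_close; rewrite !ler_norml.
set a := Ex mu T; set b := Ex mu g; set c := Ex P _; set f := Ex P _.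
rewrite (_ : (fine \o _) n = f)//; move: Me'; clearbody a b c f; set m := 2 * M * e' => Me'.
by move=> /andP[? ?] /andP[? ?] /andP[? ?]; apply/andP; split; lra.
Unshelve. all: by end_near. Qed.

End weak_convergence.

(** * Independent Wiener processes *)

Section pi_lambda.
Context {R : realType} {d : measure_display} {Om : measurableType d}
  (P : probability Om R).
Implicit Types (F G : set (set Om)) (A B : set Om).

(** Dynkin's argument: the events satisfying the product formula with [B] form a lambda-system
    containing the pi-system [F]. *)
Lemma indep_gen_l F B : setI_closed F -> F `<=` measurable -> measurable B ->
  (forall A, F A -> P (A `&` B) = (P A * P B)%E) ->
  forall A, <<s F >> A -> P (A `&` B) = (P A * P B)%E.
Proof.
move=> FI Fm mB FB A sA.
suff : (measurable `&` [set A | P (A `&` B) = (P A * P B)%E]) A by case.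
move: A sA; rewrite -setI_closed_g_dynkin_g_sigma_algebra//; apply: smallest_sub; last first.
  by move=> A FA; split; [exact: Fm|exact: FB].
split.
- by split => //=; rewrite setTI probability_setT mul1e.
- move=> A [mA /= AB]; split; first exact: measurableC.
  have PBA : P (B `\` A) = (P B - P (A `&` B))%E.
    by rewrite setIC measureD// ltey_eq fin_num_measure.
  rewrite /= setIC -setDE PBA AB probability_setC//.
  rewrite -(fineK (fin_num_measure P _ mA)) -(fineK (fin_num_measure P _ mB)).
  by rewrite muleBl// mul1e.
- move=> /= C tC mC; split; first by apply: bigcupT_measurable => i; case: (mC i).
  rewrite /= setI_bigcupl measure_bigcup//; last 2 first.
  - by move=> i _; apply: measurableI => //; case: (mC i).
  - exact: trivIset_setIr.
  rewrite measure_bigcup//; last by move=> i _; case: (mC i).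
  rewrite [RHS]muleC -[P B]fineK ?fin_num_measure// -nneseriesZl//.
  by apply: eq_eseriesr => i _; case: (mC i) => _ /= ->; rewrite [RHS]muleC fineK// fin_num_measure.
Qed.

Lemma indep_sys_gen F G : setI_closed F -> setI_closed G ->
  F `<=` measurable -> G `<=` measurable ->
  indep_sys P F G -> indep_sys P <<s F >> <<s G >>.
Proof.
move=> FI GI Fm Gm FG A B sA sB.
have mB : measurable B by move: sB; apply: smallest_sub => //; exact: sigma_algebra_measurable.
apply: indep_gen_l sA => // A' FA'.
rewrite setIC muleC; apply: indep_gen_l sB => //; first exact: Fm.
by move=> B' GB'; rewrite setIC muleC; exact: FG.
Qed.

Lemma indep_rv_gen F G (U V : Om -> R) : indep_sys P <<s F >> <<s G >> ->
  measurable_fun setT (U : g_sigma_algebraType F -> R) ->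
  measurable_fun setT (V : g_sigma_algebraType G -> R) -> indep_rv P U V.
Proof.
move=> FG mU mV A B mA mB; apply: FG.
- exact: (measurable_preim mU mA).
- exact: (measurable_preim mV mB).
Qed.

Lemma sub_gen_measurable F G (U : Om -> R) : <<s F >> `<=` <<s G >> ->
  measurable_fun setT (U : g_sigma_algebraType F -> R) ->
  measurable_fun setT (U : g_sigma_algebraType G -> R).
Proof.
move=> FG mU _ A mA; rewrite setTI; apply: FG.
exact: (measurable_preim mU mA).
Qed.

Lemma gen_measurable F (U : Om -> R) : F `<=` measurable ->
  measurable_fun setT (U : g_sigma_algebraType F -> R) -> measurable_fun setT U.
Proof.
move=> Fm mU _ A mA; rewrite setTI.
have := measurable_preim mU mA; apply: smallest_sub => //.
exact: sigma_algebra_measurable.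
Qed.

Section grouping.
Context (J : finType) (G : J -> set (set Om)).
Hypothesis G_indep : indep_family P G.
Hypothesis G_setI : forall j, setI_closed (G j).
Hypothesis G_setT : forall j, G j setT.
Hypothesis G_measurable : forall j, G j `<=` measurable.

Definition group (K : {set J}) : set (set Om) := \bigcup_(j in [set` K]) G j.

(** The members of a group are not closed under intersection; these finite intersections are, they
    generate the same sigma-algebra, and their probabilities factor. *)
Let rect (K : {set J}) : set (set Om) :=
  [set A | exists2 B : J -> set Om, forall j, j \in K -> G j (B j) &
    A = \bigcap_(j in [set` K]) B j].

Let rect_setI K : setI_closed (rect K).
Proof.
move=> _ _ [B hB ->] [C hC ->]; exists (fun j => B j `&` C j).
  by move=> j jK; apply: G_setI; [exact: hB|exact: hC].
by rewrite bigcapI.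
Qed.

Let rect_measurable K : rect K `<=` measurable.
Proof.
move=> _ [B hB ->]; apply: fin_bigcap_measurable => //.
by move=> j jK; apply: (@G_measurable j); exact: hB.
Qed.

Let group_rect K : <<s group K >> `<=` <<s rect K >>.
Proof.
apply: smallest_sub; first exact: smallest_sigma_algebra.
move=> A [j /= jK GA]; apply: sub_sigma_algebra.
exists (fun i => if i == j then A else setT).
  by move=> i _; case: eqP => [->//|_]; exact: G_setT.
apply/seteqP; split => [w Aw i _|w /(_ j jK)]; last by rewrite eqxx.
by case: eqP.
Qed.

Lemma indep_groups (K L : {set J}) : [disjoint K & L]%B ->
  indep_sys P <<s group K >> <<s group L >>.
Proof.
move=> KL A B /group_rect sA /group_rect sB.
apply: indep_sys_gen sA sB; [exact: rect_setI|exact: rect_setI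
  |exact: rect_measurable|exact: rect_measurable|].
move=> _ _ [B1 h1 ->] [B2 h2 ->].
pose C j := if j \in K then B1 j else B2 j.
have CL j : j \in L -> C j = B2 j.
  by move=> jL; rewrite /C (disjointFl KL jL).
have -> : \bigcap_(j in [set` K]) B1 j `&` \bigcap_(j in [set` L]) B2 j =
    \bigcap_(j in [set` (K :|: L)]) C j.
  apply/seteqP; split => [w [w1 w2] j /=|w wC].
    by rewrite inE => /orP[jK|jL]; [rewrite /C jK; exact: w1|rewrite CL//; exact: w2].
  split => j /= jj; first by have := wC j; rewrite /= inE jj /C jj; exact.
  by rewrite -CL//; apply: wC; rewrite /= inE jj orbT.
rewrite (G_indep (J := K) h1) (G_indep (J := L) h2) (G_indep (J := K :|: L)); last first.
  by move=> j; rewrite inE => /orP[jK|jL]; [rewrite /C jK; exact: h1|rewrite CL//; exact: h2].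
rewrite (big_setID K)/= finset.setUK finset.setDUl finset.setDv finset.set0U.
have -> : L :\: K = L by apply/finset.setDidPl; rewrite disjoint_sym.
congr (_ * _)%E; apply: eq_bigr => j jj; first by rewrite /C jj.
by rewrite CL.
Qed.

End grouping.
End pi_lambda.

(** * Past and increments of a family of Wiener processes *)

Section wiener_family.
Context {R : realType} {d : measure_display} {Om : measurableType d}
  (P : probability Om R) (I : finType) (V : I -> R -> Om -> R).
Hypothesis V_wiener : forall i, wiener P (V i).
Hypothesis V_indep : indep_family P (fun i => sigma_process `[0, +oo[ (V i)).

Let sp (s : R) i : set (set Om) := sigma_process `[0, s] (V i).

Definition increment i (s t : R) w := V i t w - V i s w.

Definition past (s : R) : set (set Om) := \bigcup_i sp s i.

Let inc s t i : set (set Om) := [set increment i s t @^-1` B | B in measurable].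

(** Each process is split at time [s] into its past ([false]) and its increment up to [t] ([true]).
    Every independence used later is one between disjoint groups of these pieces. *)
Let fam (s t : R) (x : I * bool) : set (set Om) :=
  if x.2 then inc s t x.1 else sp s x.1.

Let V_measurable i t : 0 <= t -> measurable_fun setT (V i t).
Proof. by case: (V_wiener i) => h _ _ _ _; exact: h. Qed.

Lemma increment_measurable i s t : 0 <= s -> s <= t ->
  measurable_fun setT (increment i s t).
Proof.
by move=> s0 st; apply: measurable_funB; apply: V_measurable => //; exact: le_trans st.
Qed.

Lemma sigma_process_coord (D : set R) (Z : R -> Om -> R) u : D u ->
  measurable_fun setT (Z u : g_sigma_algebraType
    [set Z t @^-1` A | t in D & A in (measurable : set (set R))] -> R).
Proof.
move=> Du _ A mA; rewrite setTI; apply: sub_sigma_algebra; exists u => //.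
by exists A.
Qed.

Let sp_measurable s i : sp s i `<=` measurable.
Proof.
apply: smallest_sub; first exact: sigma_algebra_measurable.
move=> _ [u /= + [A mA <-]]; rewrite in_itv /= => /andP[u0 _].
by apply: measurable_preim => //; exact: V_measurable.
Qed.

Let sp_sub s i : sp s i `<=` sigma_process `[0, +oo[ (V i).
Proof.
apply: sub_smallest2r; first exact: smallest_sigma_algebra.
move=> _ [u /= + [A mA <-]]; rewrite in_itv /= => /andP[u0 _].
by exists u; rewrite /= ?in_itv /= ?u0//; exists A.
Qed.

Let inc_sub s t i : 0 <= s -> s <= t -> inc s t i `<=` sigma_process `[0, +oo[ (V i).
Proof.
move=> s0 st _ [B mB <-].
set S := [set V i t @^-1` A | t in `[0, +oo[%classic & A in (measurable : set (set R))].
have mi : measurable_fun setT (increment i s t : g_sigma_algebraType S -> R).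
  by apply: measurable_funB; apply: sigma_process_coord; rewrite /= in_itv /= ?s0//
    (le_trans s0).
exact: (measurable_preim mi mB).
Qed.

Lemma past_measurable s : past s `<=` measurable.
Proof. by move=> A [i _ Ai]; exact: sp_measurable Ai. Qed.

Lemma past_mono s t : s <= t -> <<s past s >> `<=` <<s past t >>.
Proof.
move=> st; apply: sub_smallest2r; first exact: smallest_sigma_algebra.
move=> A [i _ Ai]; exists i => //; move: A Ai.
apply: sub_smallest2r; first exact: smallest_sigma_algebra.
move=> _ [u /= + [A mA <-]]; rewrite in_itv /= => /andP[u0 us].
by exists u; rewrite /= ?in_itv /= ?u0 ?(le_trans us)//; exists A.
Qed.

Lemma past_value i u s : 0 <= u -> u <= s ->
  measurable_fun setT (V i u : g_sigma_algebraType (past s) -> R).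
Proof.
move=> u0 us _ A mA; rewrite setTI; apply: sub_sigma_algebra; exists i => //.
apply: sub_sigma_algebra; exists u; first by rewrite /= in_itv /= u0.
by exists A.
Qed.

Lemma past_increment i s t : 0 <= s -> s <= t ->
  measurable_fun setT (increment i s t : g_sigma_algebraType (past t) -> R).
Proof.
move=> s0 st; apply: measurable_funB; apply: past_value => //.
exact: le_trans st.
Qed.

Section step.
Context (s t : R).
Hypotheses (s0 : 0 <= s) (st : s < t).

Let st' : s <= t. Proof. exact: ltW. Qed.

(** Different processes are independent by assumption, and within one process the increment is
    independent of the past; the product over pairs is therefore taken process by process. *)
Let fam_indep : indep_family P (fam s t).
Proof.
move=> J A hA.
(* Filling up with the whole space lets the product run over all pairs instead of an arbitrary
   subset. *)
pose A' x := if x \in J then A x else setT.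
have A'fam x : fam s t x (A' x).
  rewrite /A'; case: ifPn => [/hA//|_]; rewrite /fam; case: ifP => _.
    by exists setT => //; rewrite preimage_setT.
  have [h1 h2 _] : sigma_algebra setT (sp s x.1) by exact: smallest_sigma_algebra.
  by rewrite -[setT]setD0; exact: h2.
have A'm x : measurable (A' x).
  have := A'fam x; rewrite /fam; case: ifP => _; last exact: sp_measurable.
  by move=> [B mB <-]; apply: measurable_preim => //; exact: increment_measurable.
pose C i := A' (i, false) `&` A' (i, true).
have -> : \bigcap_(x in [set` J]) A x = \bigcap_(i in [set` [set: I]%SET]) C i.
  apply/seteqP; split => [w h i _|w h [i b] /= xJ].
    by split; rewrite /A'; case: ifPn => // xJ; exact: h.
  have [] := h i; rewrite /= ?inE// /A'.
  by case: b xJ => ->.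
rewrite V_indep; last first.
  move=> i _; have := A'fam (i, false); have := A'fam (i, true).
  move=> /(inc_sub s0 st') h1 /sp_sub h2.
  by apply: (@measurableI _ (g_sigma_algebraType _)); [exact: h2|exact: h1].
have PC i : P (C i) = (P (A' (i, false)) * P (A' (i, true)))%E.
  have [_ _ _ _ h] := V_wiener i.
  have [B mB eB] := A'fam (i, true); rewrite /C -eB.
  by apply: (h s t (A' (i, false)) B s0 st) => //; exact: (A'fam (i, false)).
transitivity (\prod_x P (A' x))%E; last first.
  rewrite [RHS]big_mkcond /=; apply: eq_bigr => x _; rewrite /A'.
  by case: ifP => // _; rewrite probability_setT.
rewrite (eq_bigr (fun x => P (A' (x.1, x.2)))); last by case.
rewrite -(pair_bigA _ (fun i b => P (A' (i, b)))) /=.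
rewrite (eq_bigl xpredT); last by move=> i; rewrite inE.
by apply: eq_bigr => i _; rewrite big_bool PC muleC.
Qed.

Let fam_setI x : setI_closed (fam s t x).
Proof.
rewrite /fam; case: ifP => _ A B.
  by move=> [A' mA <-] [B' mB <-]; exists (A' `&` B') => //; exact: measurableI.
by move=> hA hB; exact: (@measurableI _ (g_sigma_algebraType _) _ _ hA hB).
Qed.

Let fam_setT x : fam s t x setT.
Proof.
rewrite /fam; case: ifP => _; first by exists setT => //; rewrite preimage_setT.
exact: (@measurableT _ (g_sigma_algebraType _)).
Qed.

Let fam_measurable x : fam s t x `<=` measurable.
Proof.
rewrite /fam; case: ifP => _; last exact: sp_measurable.
by move=> _ [B mB <-]; apply: measurable_preim => //; exact: increment_measurable.
Qed.

Definition steps (K : {set I}) : set (set Om) :=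
  \bigcup_(i in [set` K]) [set increment i s t @^-1` B | B in (measurable : set (set R))].

Lemma steps_increment (K : {set I}) i : i \in K ->
  measurable_fun setT (increment i s t : g_sigma_algebraType (steps K) -> R).
Proof.
move=> iK _ A mA; rewrite setTI; apply: sub_sigma_algebra; exists i => //.
by exists A.
Qed.

Let sub_group (F : set (set Om)) K : F `<=` group (fam s t) K ->
  <<s F >> `<=` <<s group (fam s t) K >>.
Proof. by apply: sub_smallest2r; exact: smallest_sigma_algebra. Qed.

Lemma indep_past_steps K : indep_sys P <<s past s >> <<s steps K >>.
Proof.
move=> A B sA sB.
apply: (indep_groups fam_indep fam_setI fam_setT fam_measurable
  (K := [set x | ~~ x.2]%SET) (L := [set x | x.2]%SET)).
- by rewrite finset.disjoints_subset; apply/fintype.subsetP => x; rewrite !inE.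
- move: A sA; apply: sub_group => A [i _ Ai]; exists (i, false) => //=.
  by rewrite inE.
- move: B sB; apply: sub_group => B [i _ Bi]; exists (i, true) => //=.
  by rewrite inE.
Qed.

Lemma indep_steps (K L : {set I}) : [disjoint K & L]%B ->
  indep_sys P <<s steps K >> <<s steps L >>.
Proof.
move=> KL A B sA sB.
apply: (indep_groups fam_indep fam_setI fam_setT fam_measurable
  (K := [set x | x.2 & x.1 \in K]%SET) (L := [set x | x.2 & x.1 \in L]%SET)).
- rewrite finset.disjoints_subset; apply/fintype.subsetP => x; rewrite !inE => /andP[-> xK] /=.
  by rewrite (disjointFr KL xK).
- move: A sA; apply: sub_group => A [i iK Ai]; exists (i, true) => //=.
  by rewrite inE.
- move: B sB; apply: sub_group => B [i iL Bi]; exists (i, true) => //=.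
  by rewrite inE.
Qed.

End step.
End wiener_family.

(** * Moments of quadratic forms in standardized increments *)

Section gaussian_steps.
Context {R : realType} {d : measure_display} {Om : measurableType d}
  (P : probability Om R) (I : finType) (V : I -> R -> Om -> R).
Hypothesis V_wiener : forall i, wiener P (V i).
Hypothesis V_indep : indep_family P (fun i => sigma_process `[0, +oo[ (V i)).

Definition xi (s t : R) i w := (Num.sqrt (t - s))^-1 * increment V i s t w.

Section step.
Context (s t : R).
Hypotheses (s0 : 0 <= s) (st : s < t).

Let ts : 0 < Num.sqrt (t - s). Proof. by rewrite sqrtr_gt0 subr_gt0. Qed.

Let N01 : probability (measurableTypeR R) R := normal_prob 0 1.

Lemma xi_steps (K : {set I}) i : i \in K ->
  measurable_fun setT (xi s t i : g_sigma_algebraType (steps V s t K) -> R).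
Proof.
by move=> iK; apply: measurable_funM => //; exact: steps_increment.
Qed.

Lemma xi_measurable i : measurable_fun setT (xi s t i).
Proof.
apply: measurable_funM => //.
exact: (increment_measurable V_wiener i s0 (ltW st)).
Qed.

Lemma xi_law i (A : set R) : measurable A -> P (xi s t i @^-1` A) = N01 A.
Proof.
move=> mA; have [_ _ _ h _] := V_wiener i.
pose c := (Num.sqrt (t - s))^-1.
have c0 : c != 0 by rewrite invr_eq0 gt_eqF.
pose B : set R := (fun x => c * x) @^-1` A.
have mB : measurable B by apply: measurable_preim => //; exact: measurable_funM.
have c1 : `|c| * Num.sqrt (t - s) = 1.
  by rewrite gtr0_norm ?invr_gt0// mulVf// gt_eqF.
have hB := normal_prob_scale c0 (lt0r_neq0 ts) mA; rewrite c1 in hB.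
exact: etrans (h s t B s0 st mB) hB.
Qed.

Lemma xi_even i k : L1 P (fun w => xi s t i w ^+ k.*2) /\
  Ex P (fun w => xi s t i w ^+ k.*2) = Ex N01 (fun x : R => x ^+ k.*2).
Proof.
apply: (law_Ex (g := fun x => x ^+ k.*2) (xi_measurable i) _ (@xi_law i)).
  exact: measurable_funX.
exact: L1_normal_even.
Qed.

Lemma xi_odd i k : L1 P (fun w => xi s t i w ^+ k.*2.+1) /\
  Ex P (fun w => xi s t i w ^+ k.*2.+1) = 0.
Proof.
have [l e] := @normal_odd R k.
have [l' e'] := law_Ex (g := fun x => x ^+ k.*2.+1) (xi_measurable i)
  (measurable_funX _ (@measurable_id _ _ _)) (@xi_law i) l.
by split => //; rewrite -e.
Qed.

Lemma xi_L2 i : L2 P (xi s t i).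
Proof. by split; [exact: xi_measurable|have [] := xi_even i 1]. Qed.

Lemma xi_Ex i : Ex P (xi s t i) = 0.
Proof. by have [] := xi_odd i 0. Qed.

Lemma xi_Ex2 i : Ex P (fun w => xi s t i w ^+ 2) = 1.
Proof.
by have [_ ->] := xi_even i 1; rewrite (normal_moment_rec 0) normal_moment0 mulr1.
Qed.

Lemma xi_Ex4 i : Ex P (fun w => xi s t i w ^+ 4) = 3.
Proof.
have [_ ->] := xi_even i 2.
by rewrite (normal_moment_rec 1) (normal_moment_rec 0) normal_moment0 !mulr1.
Qed.

Lemma xi_Ex6 i : Ex P (fun w => xi s t i w ^+ 6) = 15.
Proof.
have [_ ->] := xi_even i 3; rewrite (normal_moment_rec 2).
by rewrite (normal_moment_rec 1) (normal_moment_rec 0) normal_moment0 !mulr1 -natrM.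
Qed.

Lemma xi_mul_L2 a b : L2 P (fun w => xi s t a w * xi s t b w).
Proof.
have m : measurable_fun setT (fun w => xi s t a w * xi s t b w).
  by apply: measurable_funM; exact: xi_measurable.
split => //.
apply: (@L1_le _ _ _ _ _ (fun w => xi s t a w ^+ 4 + xi s t b w ^+ 4)).
- exact: sqr_measurable.
- move=> w; set x := xi s t a w; set y := xi s t b w.
  have x4 : 0 <= x ^+ 4 by rewrite (exprM x 2 2) sqr_ge0.
  have y4 : 0 <= y ^+ 4 by rewrite (exprM y 2 2) sqr_ge0.
  rewrite !ger0_norm ?addr_ge0 ?sqr_ge0//.
  have := sqr_ge0 (x ^+ 2 - y ^+ 2).
  have -> : (x ^+ 2 - y ^+ 2) ^+ 2 = x ^+ 4 + y ^+ 4 - (x * y) ^+ 2 *+ 2 by ring.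
  by rewrite mulr2n; have := sqr_ge0 (x * y); lra.
- by apply: L1D; [have [] := xi_even a 2|have [] := xi_even b 2].
Qed.

Lemma xi_mul3_L1 a b c : L1 P (fun w => xi s t a w * xi s t b w * xi s t c w).
Proof. exact: (L2_mul (xi_mul_L2 a b) (xi_L2 c)). Qed.

Lemma xi_mul4_L1 a b c e :
  L1 P (fun w => xi s t a w * xi s t b w * (xi s t c w * xi s t e w)).
Proof. exact: (L2_mul (xi_mul_L2 a b) (xi_mul_L2 c e)). Qed.

(** A centred factor that is independent of the remaining ones annihilates the expectation. *)
Lemma xi_isolated a (Y : Om -> R) : L1 P Y ->
  measurable_fun setT (Y : g_sigma_algebraType (steps V s t (~: [set a])%SET) -> R) ->
  Ex P (fun w => xi s t a w * Y w) = 0.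
Proof.
move=> lY mY.
have i : indep_rv P (xi s t a) Y.
  apply: (indep_rv_gen (F := steps V s t [set a]%SET) (G := steps V s t (~: [set a])%SET)) => //.
    apply: (indep_steps V_wiener V_indep s0 st).
    by rewrite finset.disjoints_subset finset.setCK.
  by apply: xi_steps; rewrite inE.
by have [_ ->] := indep_Ex i (L2_L1 (xi_L2 a)) lY; rewrite xi_Ex mul0r.
Qed.

Lemma xi_isolated3 a b c e : b != a -> c != a -> e != a ->
  Ex P (fun w => xi s t a w * (xi s t b w * xi s t c w * xi s t e w)) = 0.
Proof.
move=> ba ca ea; apply: xi_isolated; first exact: xi_mul3_L1.
have m x : x != a ->
    measurable_fun setT (xi s t x : g_sigma_algebraType (steps V s t (~: [set a])%SET) -> R).
  by move=> xa; apply: xi_steps; rewrite !inE.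
by apply: measurable_funM; [apply: measurable_funM|]; exact: m.
Qed.

Lemma xi_sqr2 a b : a != b ->
  Ex P (fun w => xi s t a w ^+ 2 * xi s t b w ^+ 2) = 1.
Proof.
move=> ab.
have i : indep_rv P (xi s t a) (xi s t b).
  apply: (indep_rv_gen (F := steps V s t [set a]%SET) (G := steps V s t [set b]%SET)).
  - apply: (indep_steps V_wiener V_indep s0 st).
    by rewrite finset.disjoints_subset finset.sub1set !inE.
  - by apply: xi_steps; rewrite inE.
  - by apply: xi_steps; rewrite inE.
have m2 : measurable_fun setT (fun x : R => x ^+ 2) by exact: measurable_funX.
have [_ ->] := indep_Ex (indep_rv_comp m2 m2 i) (xi_L2 a).2 (xi_L2 b).2.
by rewrite (xi_Ex2 a) (xi_Ex2 b) mulr1.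
Qed.

Lemma xi_Ex_mul a b : Ex P (fun w => xi s t a w * xi s t b w) = (a == b)%:R.
Proof.
have [->|ab] := eqVneq a b.
  by under [X in Ex P X]eq_fun do rewrite -expr2; rewrite xi_Ex2.
apply: xi_isolated; first exact: L2_L1 (xi_L2 b).
by apply: xi_steps; rewrite !inE eq_sym.
Qed.

(** Isserlis' formula by cases on coincidences: an index differing from the other three isolates its
    factor, two distinct pairs give 1, and four equal indices give the fourth moment 3, which is the
    number of pairings. *)
Lemma xi_Ex_mul4 a b c e :
  Ex P (fun w => xi s t a w * xi s t b w * (xi s t c w * xi s t e w)) =
  ((a == b) && (c == e))%:R + ((a == c) && (b == e))%:R + ((a == e) && (b == c))%:R.
Proof.
have perm4 (f g : Om -> R) : (forall w, f w = g w) -> Ex P f = Ex P g.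
  by move=> fg; congr (Ex P _); exact/funext.
have [eab|ab] := eqVneq a b; have [ece|ce] := eqVneq c e.
- subst b e; have [eac|ac] /= := eqVneq a c.
    subst c; rewrite (perm4 _ (fun w => xi s t a w ^+ 4)) ?xi_Ex4; last by move=> w; ring.
    by rewrite -!natrD.
  rewrite !addr0 (perm4 _ (fun w => xi s t a w ^+ 2 * xi s t c w ^+ 2)) ?xi_sqr2//.
- subst b; rewrite add0r.
  have [eac|ac] /= := eqVneq a c; last first.
    rewrite (perm4 _ (fun w => xi s t c w * (xi s t a w * xi s t a w * xi s t e w))).
      by rewrite xi_isolated3 ?andbF ?addr0// eq_sym.
    by move=> w; ring.
  subst c; rewrite (negbTE ce) /= addr0.
  rewrite (perm4 _ (fun w => xi s t e w * (xi s t a w * xi s t a w * xi s t a w))).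
    by rewrite xi_isolated3.
  by move=> w; ring.
- subst e; rewrite add0r.
  have [eac|ac] /= := eqVneq a c; last first.
    rewrite (perm4 _ (fun w => xi s t a w * (xi s t b w * xi s t c w * xi s t c w))).
      by rewrite xi_isolated3 ?addr0// eq_sym.
    by move=> w; ring.
  subst c; rewrite [b == a]eq_sym (negbTE ab) /= addr0.
  rewrite (perm4 _ (fun w => xi s t b w * (xi s t a w * xi s t a w * xi s t a w))).
    by rewrite xi_isolated3.
  by move=> w; ring.
- rewrite add0r.
  have [eac|ac] /= := eqVneq a c.
    subst c; rewrite (negbTE ce) /= addr0.
    have [ebe|be] /= := eqVneq b e.
      subst e; rewrite (perm4 _ (fun w => xi s t a w ^+ 2 * xi s t b w ^+ 2)) ?xi_sqr2//.
      by move=> w; ring.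
    rewrite (perm4 _ (fun w => xi s t b w * (xi s t a w * xi s t a w * xi s t e w))).
      by rewrite xi_isolated3// eq_sym.
    by move=> w; ring.
  rewrite add0r; have [eae|ae] /= := eqVneq a e; last first.
    rewrite (perm4 _ (fun w => xi s t a w * (xi s t b w * xi s t c w * xi s t e w))).
      by rewrite xi_isolated3// eq_sym.
    by move=> w; ring.
  subst e; have [ebc|bc] /= := eqVneq b c.
    subst c; rewrite (perm4 _ (fun w => xi s t a w ^+ 2 * xi s t b w ^+ 2)) ?xi_sqr2//.
    by move=> w; ring.
  rewrite (perm4 _ (fun w => xi s t b w * (xi s t a w * xi s t c w * xi s t a w))).
    by rewrite xi_isolated3// eq_sym.
  by move=> w; ring.
Qed.

Definition quad (q : I -> I -> R) w : R :=
  \sum_a \sum_b q a b * (xi s t a w * xi s t b w - (a == b)%:R).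

Lemma quad_steps q :
  measurable_fun setT (quad q : g_sigma_algebraType (steps V s t [set: I]%SET) -> R).
Proof.
apply: measurable_sum => a; apply: measurable_sum => b.
apply: measurable_funM => //; apply: measurable_funB => //.
by apply: measurable_funM; apply: xi_steps; rewrite inE.
Qed.

Let term_L2 a b : L2 P (fun w => xi s t a w * xi s t b w - (a == b)%:R).
Proof. by apply: L2B; [exact: xi_mul_L2|exact: L2_cst]. Qed.

Lemma quad_L2 q : L2 P (quad q).
Proof. by apply: L2_sum => a _; apply: L2_sum => b _; exact: L2Zl. Qed.

Let term_mean a b : Ex P (fun w => xi s t a w * xi s t b w - (a == b)%:R) = 0.
Proof.
rewrite ExB; [|exact: L2_L1 (xi_mul_L2 a b)|exact: L1_cst].
by rewrite xi_Ex_mul Ex_cst subrr.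
Qed.

Lemma quad_mean q : Ex P (quad q) = 0.
Proof.
rewrite Ex_sum => [|a _]; last first.
  by apply: L1_sum => b _; apply: L1Zl; exact: L2_L1.
rewrite big1// => a _; rewrite Ex_sum => [|b _]; last by apply: L1Zl; exact: L2_L1.
by rewrite big1// => b _; rewrite ExZl ?term_mean ?mulr0//; exact: L2_L1.
Qed.

Let term_cov a b c e :
  Ex P (fun w => (xi s t a w * xi s t b w - (a == b)%:R) *
                 (xi s t c w * xi s t e w - (c == e)%:R)) =
  ((a == c) && (b == e))%:R + ((a == e) && (b == c))%:R.
Proof.
have l1 := xi_mul4_L1 a b c e.
have l2 : L1 P (fun w => (c == e)%:R * (xi s t a w * xi s t b w)).
  by apply: L1Zl; exact: L2_L1 (xi_mul_L2 a b).
have l3 : L1 P (fun w => (a == b)%:R * (xi s t c w * xi s t e w)).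
  by apply: L1Zl; exact: L2_L1 (xi_mul_L2 c e).
have l4 : L1 P (fun w => (a == b)%:R * (xi s t c w * xi s t e w) - (a == b)%:R * (c == e)%:R).
  by apply: L1B => //; exact: L1_cst.
have -> : (fun w => (xi s t a w * xi s t b w - (a == b)%:R) *
                    (xi s t c w * xi s t e w - (c == e)%:R)) =
    (fun w => xi s t a w * xi s t b w * (xi s t c w * xi s t e w)
       - (c == e)%:R * (xi s t a w * xi s t b w)
       - ((a == b)%:R * (xi s t c w * xi s t e w) - (a == b)%:R * (c == e)%:R)).
  by apply/funext => w; ring.
rewrite ExB//; last exact: L1B.
rewrite ExB// ExB//; last exact: L1_cst.
rewrite xi_Ex_mul4 !ExZl ?xi_Ex_mul ?Ex_cst; last 3 first.
- exact: L1_cst.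
- exact: L2_L1 (xi_mul_L2 c e).
- exact: L2_L1 (xi_mul_L2 a b).
by rewrite -mulnb natrM; ring.
Qed.

Let sum_delta2 (F : I -> I -> R) a b :
  \sum_c \sum_e F c e * ((a == c) && (b == e))%:R = F a b.
Proof.
rewrite (bigD1 a)//= [X in _ + X]big1 => [|c ca]; last first.
  by apply: big1 => e _; rewrite eq_sym (negbTE ca) mulr0.
rewrite (bigD1 b)//= big1 => [|e eb]; last by rewrite [b == e]eq_sym (negbTE eb) andbF mulr0.
by rewrite !eqxx !addr0 mulr1.
Qed.

(** Centring removes the pairing of [a] with [b]; the two pairings that remain contribute equally
    because [q] is symmetric, hence the factor 2. *)
Lemma quad_var q : (forall a b, q a b = q b a) ->
  Ex P (fun w => quad q w ^+ 2) = 2 * \sum_a \sum_b q a b ^+ 2.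
Proof.
move=> qs.
pose T a b w := xi s t a w * xi s t b w - (a == b)%:R.
have lT a b c e : L1 P (fun w => q a b * q c e * (T a b w * T c e w)).
  by apply: L1Zl; exact: (L2_mul (term_L2 a b) (term_L2 c e)).
have -> : (fun w => quad q w ^+ 2) = (fun w => \sum_a \sum_b \sum_c \sum_e
    q a b * q c e * (T a b w * T c e w)).
  apply/funext => w; rewrite expr2 mulr_suml; apply: eq_bigr => a _.
  rewrite mulr_suml; apply: eq_bigr => b _.
  rewrite mulr_sumr; apply: eq_bigr => c _.
  by rewrite mulr_sumr; apply: eq_bigr => e _; rewrite /T; ring.
rewrite Ex_sum => [|a _]; last by do 3![apply: L1_sum => ? _]; exact: lT.
rewrite mulr_sumr; apply: eq_bigr => a _.
rewrite Ex_sum => [|b _]; last by do 2![apply: L1_sum => ? _]; exact: lT.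
rewrite mulr_sumr; apply: eq_bigr => b _.
rewrite Ex_sum => [|c _]; last by apply: L1_sum => ? _; exact: lT.
under eq_bigr => c _.
  rewrite Ex_sum => [|e _]; last exact: lT.
  under eq_bigr => e _.
    rewrite ExZl; last exact: (L2_mul (term_L2 a b) (term_L2 c e)).
    rewrite term_cov mulrDr.
    over.
  rewrite big_split /=.
  over.
rewrite big_split /=.
rewrite sum_delta2 (eq_bigr (fun c => \sum_e q a b * q c e * ((b == c) && (a == e))%:R)).
  by rewrite sum_delta2 (qs b a); ring.
by move=> c _; apply: eq_bigr => e _; rewrite andbC.
Qed.

End step.

Let cubeD_le (x y : R) : 0 <= x -> 0 <= y -> (x + y) ^+ 3 <= 4 * (x ^+ 3 + y ^+ 3).
Proof.
move=> x0 y0.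
have -> : 4 * (x ^+ 3 + y ^+ 3) = (x + y) ^+ 3 + 3 * ((x + y) * (x - y) ^+ 2) by ring.
by rewrite lerDl mulr_ge0// mulr_ge0 ?addr_ge0 ?sqr_ge0.
Qed.

Let sum_cube_le J (r : seq J) (F : J -> R) : (forall j, 0 <= F j) ->
  (\sum_(j <- r) F j) ^+ 3 <= 4 ^+ size r * \sum_(j <- r) F j ^+ 3.
Proof.
move=> F0; elim: r => [|j r IH]; first by rewrite !big_nil expr0n mulr0.
rewrite !big_cons; set x := F j; set y := \sum_(i <- r) F i in IH *.
have x0 : 0 <= x by exact: F0.
have y0 : 0 <= y by apply: sumr_ge0.
have h := cubeD_le x0 y0.
apply: le_trans h _; rewrite /= [4 ^+ _.+1]exprS -mulrA ler_pM2l// mulrDr lerD//.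
by rewrite ler_peMl ?exprn_ge0// exprn_ege1// ler1n.
Qed.

(** The bound does not depend on [s] and [t] because the increments are standardized.
    [(x + y)^3 <= 4 (x^3 + y^3)] is iterated over the terms, and a product is bounded through
    [|x y|^3 <= x^6 + y^6], with 15 as sixth moment. *)
Lemma quad_third (q : I -> I -> R) : exists K, forall s t, 0 <= s -> s < t ->
  L1 P (fun w => `|quad s t q w| ^+ 3) /\ Ex P (fun w => `|quad s t q w| ^+ 3) <= K.
Proof.
pose N := size (index_enum (I * I)%type).
exists (4 ^+ N * \sum_(x : I * I) `|q x.1 x.2| ^+ 3 * (4 * (15 + 15 + 1))) => s t s0 st.
pose B w := 4 ^+ N * \sum_(x : I * I) `|q x.1 x.2| ^+ 3 *
  (4 * (xi s t x.1 w ^+ 6 + xi s t x.2 w ^+ 6 + 1)).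
have l6 i := (xi_even s0 st i 3).1.
have lt (x : I * I) : L1 P (fun w => 4 * (xi s t x.1 w ^+ 6 + xi s t x.2 w ^+ 6 + 1)).
  by apply: L1Zl; apply: L1D; [apply: L1D; exact: l6|exact: L1_cst].
have lB : L1 P B.
  by apply: L1Zl; apply: L1_sum => x _; apply: L1Zl; exact: lt.
have EB : Ex P B = 4 ^+ N * \sum_(x : I * I) `|q x.1 x.2| ^+ 3 * (4 * (15 + 15 + 1)).
  rewrite ExZl; last by apply: L1_sum => x _; apply: L1Zl; exact: lt.
  congr (_ * _); rewrite Ex_sum => [|x _]; last by apply: L1Zl; exact: lt.
  apply: eq_bigr => x _; rewrite ExZl; last exact: lt.
  rewrite ExZl; last by apply: L1D; [apply: L1D; exact: l6|exact: L1_cst].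
  rewrite ExD; [|by apply: L1D; exact: l6|exact: L1_cst].
  by rewrite ExD; [|exact: l6|exact: l6]; rewrite !xi_Ex6// Ex_cst.
have le w : `|quad s t q w| ^+ 3 <= B w.
  rewrite /quad pair_bigA /=.
  apply: (@le_trans _ _ ((\sum_(x : I * I)
    `|q x.1 x.2 * (xi s t x.1 w * xi s t x.2 w - (x.1 == x.2)%:R)|) ^+ 3)).
    by rewrite ler_pXn2r// ?nnegrE// ?ler_norm_sum// sumr_ge0.
  apply: le_trans (sum_cube_le _ _) _ => //.
  rewrite ler_pM2l ?exprn_gt0//; apply: ler_sum => -[a b] _ /=.
  rewrite normrM exprMn ler_wpM2l ?exprn_ge0//.
  set x := xi s t a w; set y := xi s t b w.
  have h : `|x * y - (a == b)%:R| <= `|x * y| + 1.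
    apply: le_trans (ler_normB _ _) _; rewrite lerD2l.
    by case: (a == b); rewrite ?normr1 ?normr0.
  have h3 : `|x * y - (a == b)%:R| ^+ 3 <= (`|x * y| + 1) ^+ 3.
    by rewrite ler_pXn2r// ?nnegrE// addr_ge0.
  apply: le_trans h3 _.
  have hz := cubeD_le (normr_ge0 (x * y)) (@ler01 R); rewrite expr1n in hz.
  apply: le_trans hz _; rewrite ler_pM2l// lerD2r normrM exprMn.
  have e6 (r : R) : r ^+ 6 = (`|r| ^+ 3) ^+ 2.
    by rewrite -exprM -[RHS]normrX ger0_norm// (exprM r 3 2) sqr_ge0.
  rewrite !e6; set u := `|x| ^+ 3; set v := `|y| ^+ 3.
  have u0 : 0 <= u by exact: exprn_ge0.
  have v0 : 0 <= v by exact: exprn_ge0.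
  by have := sqr_ge0 (u - v); have := mulr_ge0 u0 v0; nra.
have mq : measurable_fun setT (quad s t q).
  exact: (quad_L2 s0 st q).1.
have l3 : L1 P (fun w => `|quad s t q w| ^+ 3).
  apply: (@L1_le _ _ _ _ _ B) => //.
    by apply: measurable_funX; exact: measurableT_comp.
  move=> w; rewrite ger0_norm ?exprn_ge0//.
  exact: le_trans (le w) (ler_norm _).
by split => //; rewrite -EB; exact: Ex_le.
Qed.

End gaussian_steps.

(** * Sums over a regular time grid *)

Section grid_sums.
Context {R : realType} {d : measure_display} {Om : measurableType d}
  (P : probability Om R) (I : finType) (V : I -> R -> Om -> R).
Hypothesis V_wiener : forall i, wiener P (V i).
Hypothesis V_indep : indep_family P (fun i => sigma_process `[0, +oo[ (V i)).

Definition adapted t (F : Om -> R) :=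
  measurable_fun setT (F : g_sigma_algebraType (past V t) -> R).

(** Only the total increments over the step enter, not the path inside it. *)
Definition step_fun s t (Y : Om -> R) :=
  measurable_fun setT (Y : g_sigma_algebraType (steps V s t [set: I]%SET) -> R).

Lemma adapted_mono s t F : s <= t -> adapted s F -> adapted t F.
Proof. by move=> st; apply: sub_gen_measurable; exact: past_mono. Qed.

Lemma adapted_measurable t F : adapted t F -> measurable_fun setT F.
Proof. by apply: gen_measurable; exact: past_measurable. Qed.

Lemma adapted_step s t Y : 0 <= s -> s <= t -> step_fun s t Y -> adapted t Y.
Proof.
move=> s0 st; apply: sub_gen_measurable; apply: smallest_sub.
  exact: smallest_sigma_algebra.
move=> _ [i _ [B mB <-]].
have mi := past_increment (V := V) i s0 st; exact: (measurable_preim mi mB).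
Qed.

Lemma adapted_step_indep s t F Y : 0 <= s -> s < t -> adapted s F -> step_fun s t Y ->
  indep_rv P F Y.
Proof.
move=> s0 st mF mY; apply: (indep_rv_gen (F := past V s) (G := steps V s t [set: I]%SET)) => //.
exact: indep_past_steps.
Qed.

Lemma adapted_step_mul s t F Y : 0 <= s -> s < t -> adapted s F -> step_fun s t Y ->
  L2 P F -> L2 P Y -> L2 P (fun w => F w * Y w) /\
  Ex P (fun w => (F w * Y w) ^+ 2) = Ex P (fun w => F w ^+ 2) * Ex P (fun w => Y w ^+ 2).
Proof.
move=> s0 st aF sY lF lY; have FY := adapted_step_indep s0 st aF sY.
have m2 : measurable_fun setT (fun x : R => x ^+ 2) by exact: measurable_funX.
have [l e] := indep_Ex (indep_rv_comp m2 m2 FY) lF.2 lY.2.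
have E : (fun w => (F w * Y w) ^+ 2) =
    (fun w => ((fun x => x ^+ 2) \o F) w * ((fun x => x ^+ 2) \o Y) w).
  by apply/funext => w; rewrite exprMn.
split; last by rewrite E e.
by split; [apply: measurable_funM; [exact: lF.1|exact: lY.1]|rewrite E].
Qed.

Section grid.
Context (h : R).
Hypothesis h0 : 0 < h.

Let g0 (i : nat) : 0 <= i%:R * h. Proof. by rewrite mulr_ge0// ltW. Qed.

Let gS (i : nat) : i%:R * h < i.+1%:R * h.
Proof. by rewrite ltr_pM2r// ltr_nat. Qed.

Let gle (i j : nat) : (i <= j)%N -> i%:R * h <= j%:R * h.
Proof. by move=> ij; rewrite ler_pM2r// ler_nat. Qed.

Lemma adapted_sum (F Y : nat -> Om -> R) n :
  (forall i, adapted (i%:R * h) (F i)) ->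
  (forall i, step_fun (i%:R * h) (i.+1%:R * h) (Y i)) ->
  adapted (n%:R * h) (fun w => \sum_(i < n) F i w * Y i w).
Proof.
move=> aF sY; apply: measurable_sum => i; apply: measurable_funM.
  by apply: (adapted_mono _ (aF i)); apply: gle; exact: ltnW.
apply: (adapted_mono (gle (ltn_ord i))).
exact: (adapted_step (g0 i) (ltW (gS i)) (sY i)).
Qed.

(** Orthogonality of martingale differences: in the cross term, the partial sum and the coefficient
    are known at the start of the step, whereas the new factor is independent of that past and
    centred. *)
Lemma martingale_sum (F Y : nat -> Om -> R) v n :
  (forall i, adapted (i%:R * h) (F i)) ->
  (forall i, step_fun (i%:R * h) (i.+1%:R * h) (Y i)) ->
  (forall i, L2 P (F i)) -> (forall i, L2 P (Y i)) ->
  (forall i, Ex P (Y i) = 0) -> (forall i, Ex P (fun w => Y i w ^+ 2) = v) ->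
  L2 P (fun w => \sum_(i < n) F i w * Y i w) /\
  Ex P (fun w => (\sum_(i < n) F i w * Y i w) ^+ 2) =
    v * \sum_(i < n) Ex P (fun w => F i w ^+ 2).
Proof.
move=> aF sY lF lY Y0 Yv.
have lFY i := adapted_step_mul (g0 i) (gS i) (aF i) (sY i) (lF i) (lY i).
have lS m : L2 P (fun w => \sum_(i < m) F i w * Y i w).
  by apply: L2_sum => i _; exact: (lFY i).1.
split => //; elim: n => [|n IH].
  under [X in Ex P X]eq_fun do rewrite big_ord0 expr0n.
  by rewrite Ex_cst big_ord0 mulr0.
pose S w := \sum_(i < n) F i w * Y i w.
have lSF : L1 P (fun w => S w * F n w) by apply: L2_mul; [exact: lS|exact: lF].
have aSF : adapted (n%:R * h) (fun w => S w * F n w).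
  by apply: measurable_funM; [exact: adapted_sum|exact: aF].
have [lSFY eSFY] := indep_Ex (adapted_step_indep (g0 n) (gS n) aSF (sY n)) lSF (L2_L1 (lY n)).
have -> : (fun w => (\sum_(i < n.+1) F i w * Y i w) ^+ 2) =
  (fun w => S w ^+ 2 + 2 * (S w * F n w * Y n w) + (F n w * Y n w) ^+ 2).
  by apply/funext => w; rewrite big_ord_recr /= -/(S w); ring.
have l2 : L1 P (fun w => 2 * (S w * F n w * Y n w)) by exact: L1Zl.
rewrite ExD; [|by apply: L1D => //; exact: (lS n).2|exact: (lFY n).1.2].
rewrite ExD//; last exact: (lS n).2.
rewrite ExZl// eSFY Y0 mulr0 mulr0 addr0 IH (lFY n).2 Yv big_ord_recr /=.
by rewrite mulrDr [X in _ + X]mulrC.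
Qed.

Let quad_at q (i : nat) := quad V (i%:R * h) (i.+1%:R * h) q.

Let qL2 q i : L2 P (quad_at q i). Proof. exact: quad_L2. Qed.

Let qs q i : step_fun (i%:R * h) (i.+1%:R * h) (quad_at q i).
Proof. exact: quad_steps. Qed.

Lemma quad_sum_var q n : (forall a b, q a b = q b a) ->
  L2 P (fun w => \sum_(i < n) quad_at q i w) /\
  Ex P (fun w => (\sum_(i < n) quad_at q i w) ^+ 2) =
    n%:R * (2 * \sum_a \sum_b q a b ^+ 2).
Proof.
move=> qsym.
have := @martingale_sum (fun _ _ => 1) (quad_at q) (2 * \sum_a \sum_b q a b ^+ 2) n.
have E w : \sum_(i < n) quad_at q i w = \sum_(i < n) 1 * quad_at q i w.
  by apply: eq_bigr => i _; rewrite mul1r.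
rewrite (_ : (fun w => \sum_(i < n) quad_at q i w) =
  (fun w => \sum_(i < n) 1 * quad_at q i w)); last exact/funext.
rewrite (_ : (fun w => (\sum_(i < n) quad_at q i w) ^+ 2) =
  (fun w => (\sum_(i < n) 1 * quad_at q i w) ^+ 2)); last by apply/funext => w; rewrite E.
case => //.
- by move=> i; exact: measurable_cst.
- by move=> i; exact: L2_cst.
- by move=> i; exact: quad_mean.
- by move=> i; exact: quad_var.
move=> l ->; split => //; rewrite mulrC; congr (_ * _).
under eq_bigr do rewrite expr1n Ex_cst.
by rewrite sumr_const card_ord.
Qed.

End grid.

(** The constant is the same for all steps [h], as it must be when [h] varies with [n]. A summand
    has variance [v], twice the sum of squares, so the exponent [v / 2] is that sum. *)
Lemma quad_clt q : (forall a b, q a b = q b a) ->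
  exists C, forall h x n, 0 < h -> (0 < n)%N ->
  `|Ex P (fun w => cos (x + (Num.sqrt n%:R)^-1 *
        \sum_(i < n) quad V (i%:R * h) (i.+1%:R * h) q w))
    - expR (- (\sum_a \sum_b q a b ^+ 2)) * cos x| <= C / Num.sqrt n%:R.
Proof.
move=> qsym; have [K hK] := quad_third V_wiener q.
pose v := 2 * \sum_a \sum_b q a b ^+ 2.
exists (2 * K + v ^+ 2) => h x n h0 n0.
have g0 (i : nat) : 0 <= i%:R * h by rewrite mulr_ge0// ltW.
have gS (i : nat) : i%:R * h < i.+1%:R * h by rewrite ltr_pM2r// ltr_nat.
have -> : \sum_a \sum_b q a b ^+ 2 = v / 2 by rewrite /v mulrAC divff ?mul1r// pnatr_eq0.
apply: (cos_clt (eta := fun i => quad V (i%:R * h) (i.+1%:R * h) q)) => //.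
- by move=> i; exact: quad_L2.
- move=> m; apply: (adapted_step_indep (g0 m) (gS m)); last exact: quad_steps.
  have := @adapted_sum h h0 (fun _ _ => 1) (fun i => quad V (i%:R * h) (i.+1%:R * h) q) m.
  have -> : (fun w => \sum_(i < m) quad V (i%:R * h) (i.+1%:R * h) q w) =
      (fun w => \sum_(i < m) 1 * quad V (i%:R * h) (i.+1%:R * h) q w).
    by apply/funext => w; apply: eq_bigr => i _; rewrite mul1r.
  by apply => // i; [exact: measurable_cst|exact: quad_steps].
- by move=> i; exact: quad_mean.
- by move=> i; exact: quad_var.
- by move=> i; exact: (hK _ _ (g0 i) (gS i)).1.
- by move=> i; exact: (hK _ _ (g0 i) (gS i)).2.
Qed.

End grid_sums.

(** * Gaussian vectors *)

Section gaussian_vector.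
Context {R : realType} {d : measure_display} {Om : measurableType d}
  (P : probability Om R) (B : R -> Om -> R).
Hypothesis B_wiener : wiener P B.

(** A single process seen as a family, so that the preceding results apply. *)
Let V (_ : unit) := B.

Let V_wiener i : wiener P (V i). Proof. exact: B_wiener. Qed.

Let V_indep : indep_family P (fun i => sigma_process `[0, +oo[ (V i)).
Proof.
move=> J A hA; have [J0|[i iJ]] := set_0Vmem J.
  rewrite J0 big_set0 (_ : \bigcap_(_ in _) _ = setT) ?probability_setT//.
  by apply/seteqP; split => // w _ i /=; rewrite inE.
have -> : J = [set tt]%SET.
  by apply/setP => -[]; rewrite inE; case: i iJ => ->.
rewrite finset.big_set1 (_ : \bigcap_(_ in _) _ = A tt)//.
apply/seteqP; split => [w /(_ tt)|w Aw [] _//]; apply; by rewrite /= inE.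
Qed.

(** Increments over consecutive unit intervals: a sequence of independent standard normal variables
    already present on [Om]. *)
Definition gauss (i : nat) := xi V i%:R i.+1%:R tt.

Let i0 (i : nat) : (0 : R) <= i%:R. Proof. by []. Qed.
Let iS (i : nat) : (i%:R : R) < i.+1%:R. Proof. by rewrite ltr_nat. Qed.

Lemma gauss_L2 i : L2 P (gauss i). Proof. exact: xi_L2. Qed.

Let gauss_step i : step_fun V i%:R i.+1%:R (gauss i).
Proof. by apply: xi_steps; rewrite inE. Qed.

Let gauss_sum_adapted (c : nat -> R) n :
  adapted V n%:R (fun w => \sum_(i < n) c i * gauss i w).
Proof.
have := @adapted_sum _ _ _ _ V 1 ltr01 (fun i _ => c i) gauss n.
rewrite mulr1; apply; first by move=> i; exact: measurable_cst.
by move=> i; rewrite !mulr1; exact: gauss_step.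
Qed.

Let gauss_sum_indep (c : nat -> R) n a :
  indep_rv P (fun w => \sum_(i < n) c i * gauss i w) (fun w => a * gauss n w).
Proof.
apply: (adapted_step_indep V_wiener V_indep (i0 n) (iS n)).
  exact: gauss_sum_adapted.
by apply: measurable_funM => //; exact: gauss_step.
Qed.

Let gaussZ_law i c (A : set R) : c != 0 -> measurable A ->
  P ((fun w => c * gauss i w) @^-1` A) = normal_prob 0 `|c| A.
Proof.
move=> c0 mA.
have mB : measurable ((fun x => c * x) @^-1` A : set R).
  by apply: measurable_preim => //; exact: measurable_funM.
rewrite -[`|c|]mulr1; apply: etrans (normal_prob_scale c0 (oner_neq0 R) mA).
exact: (xi_law V_wiener (i0 i) (iS i) tt mB).
Qed.

Let cst0_law (A : set R) : P ((fun=> 0) @^-1` A) = \d_(0 : R) A.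
Proof.
rewrite diracE; case: (boolP (0 \in A)) => [|/negP]; rewrite inE => h.
  by rewrite (_ : _ @^-1` _ = setT) ?probability_setT//; apply/seteqP; split.
by rewrite (_ : _ @^-1` _ = set0) ?measure0//; apply/seteqP; split.
Qed.

(** By induction the sum has the law of the increment of [B] over a time interval of length [v]. The
    new term has the law of the increment over the adjacent interval of length [c n ^+ 2], and the
    two increments are independent and add up. *)
Lemma gauss_sum_law (c : nat -> R) n (A : set R) : measurable A ->
  P ((fun w => \sum_(i < n) c i * gauss i w) @^-1` A) = normal1 0 (\sum_(i < n) c i ^+ 2) A.
Proof.
move=> mA; elim: n A mA => [|n IH] A mA.
  rewrite big_ord0 /normal1 eqxx -cst0_law.
  rewrite (_ : (fun w => _) = fun=> 0)//.
  by apply/funext => w; rewrite big_ord0.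
rewrite big_ord_recr /=; set v := \sum_(i < n) _.
have v0 : 0 <= v by apply: sumr_ge0 => i _; exact: sqr_ge0.
(* Zero variances are split off: there [normal1] is a point mass, and the laws of increments are
   only given over nonempty time intervals. *)
have [c0|c0] := eqVneq (c n) 0.
  rewrite c0 expr0n addr0 -IH// (_ : (fun w => _) =
    (fun w => \sum_(i < n) c i * gauss i w))//; apply/funext => w.
  by rewrite big_ord_recr /= c0 mul0r addr0.
have c20 : 0 < c n ^+ 2 by rewrite lt_neqAle sqr_ge0 eq_sym sqrf_eq0 c0.
have [vE|vN] := eqVneq v 0.
  rewrite vE add0r /normal1 gt_eqF// sqrtr_sqr -(gaussZ_law n)// (_ : (fun w => _) = (fun w => c n * gauss n w))//.
  apply/funext => w.
  rewrite big_ord_recr /= big1 ?add0r// => i _.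
  have /eqP := vE; rewrite psumr_eq0 => [/allP/(_ i)|j _]; last exact: sqr_ge0.
  by rewrite mem_index_enum sqrf_eq0 => /(_ isT)/eqP ->; rewrite mul0r.
have vp : 0 < v by rewrite lt_neqAle eq_sym vN.
have vc : v < v + c n ^+ 2 by rewrite ltrDl.
rewrite /normal1 gt_eqF ?addr_gt0//.
have [mB _ _ hB _] := B_wiener.
have mBt t : 0 <= t -> measurable_fun setT (B t) := mB t.
have mI s t : 0 <= s -> 0 <= t -> measurable_fun setT (fun w => B t w - B s w).
  by move=> s0' t0; apply: measurable_funB; exact: mBt.
have ind : indep_rv P (fun w => B v w - B 0 w) (fun w => B (v + c n ^+ 2) w - B v w).
  apply: (adapted_step_indep V_wiener V_indep v0 vc).
    exact: (past_increment (V := V) tt (lexx 0) v0).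
  by apply: (@steps_increment _ _ _ _ V v (v + c n ^+ 2) [set: unit]%SET tt); rewrite inE.
have mg m : measurable_fun setT (gauss m) := (gauss_L2 m).1.
have := @indep_sum_law R d Om P d Om P (fun w => \sum_(i < n) c i * gauss i w)
  (fun w => c n * gauss n w) (fun w => B v w - B 0 w) (fun w => B (v + c n ^+ 2) w - B v w).
rewrite (_ : (fun w => \sum_(i < n.+1) c i * gauss i w) =
  (fun w => \sum_(i < n) c i * gauss i w + c n * gauss n w)); last first.
  by apply/funext => w; rewrite big_ord_recr.
move=> ->//.
- rewrite -{2}[v + _]subr0; rewrite -hB ?ltr_wpDl//.
  rewrite (_ : (fun w => B v w - B 0 w + _) =
    (fun w => B (v + c n ^+ 2) w - B 0 w))//.
  by apply/funext => w; ring.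
- by apply: measurable_sum => i; apply: measurable_funM.
- by apply: measurable_funM.
- exact: mI.
- by apply: mI => //; rewrite addr_ge0// ltW.
- move=> C mC; have := hB 0 v C (lexx 0) vp mC; rewrite subr0 => hC.
  by apply: etrans (IH C mC) _; rewrite hC /normal1 (negbTE vN).
- move=> C mC; have := hB v _ C v0 vc mC; rewrite [v + _]addrC addrK sqrtr_sqr => hC.
  by apply: etrans (gaussZ_law n c0 mC) _; rewrite -hC addrC.
Qed.

Lemma same_law_Ex (X Y : Om -> R) (g : R -> R) M :
  measurable_fun setT X -> measurable_fun setT Y -> measurable_fun setT g ->
  (forall x, `|g x| <= M) ->
  (forall A : set R, measurable A -> P (X @^-1` A) = P (Y @^-1` A)) ->
  Ex P (fun w => g (X w)) = Ex P (fun w => g (Y w)).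
Proof.
move=> mX mY mg gM XY.
pose X' : {mfun Om >-> R} := mfun_Sub (mem_set mX).
pose Y' : {mfun Om >-> R} := mfun_Sub (mem_set mY).
have i (Z : Om -> R) : measurable_fun setT Z -> P.-integrable setT (EFin \o g \o Z).
  move=> mZ; apply: (@L1_bounded _ _ _ P (g \o Z) M); first exact: measurableT_comp.
  by move=> w; exact: gM.
have mEg : measurable_fun setT (EFin \o g) by exact/measurable_EFinP.
rewrite /Ex /Rintegral.
have eX := integral_distribution (X := X') mEg (i _ mX).
have eY := integral_distribution (X := Y') mEg (i _ mY).
congr fine; apply: etrans (etrans (esym eX) _) eY.
apply: eq_measure_integral => A mA _; exact: XY A mA.
Qed.

(* The law of a linear form in Gaussian increments depends on its variance only,
   so it is that of a normalized sum of m increments for every m, and the error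
   bound of the central limit theorem vanishes as m grows. *)
Lemma gauss_sum_cos (c : nat -> R) n x :
  Ex P (fun w => cos (x + \sum_(i < n) c i * gauss i w)) =
  expR (- ((\sum_(i < n) c i ^+ 2) / 2)) * cos x.
Proof.
set v := \sum_(i < n) c i ^+ 2.
have v0 : 0 <= v by apply: sumr_ge0 => i _; exact: sqr_ge0.
have mg m : measurable_fun setT (gauss m) := (gauss_L2 m).1.
have mS (b : nat -> R) m : measurable_fun setT (fun w => \sum_(i < m) b i * gauss i w).
  by apply: measurable_sum => i; exact: measurable_funM.
have mcos : measurable_fun setT (fun y : R => cos (x + y)).
  by apply: measurable_cos_comp; exact: measurable_funD.
pose s := Num.sqrt v.
have ss : s ^+ 2 = v by rewrite sqr_sqrtr.
have [K hK] : exists K, forall i, L1 P (fun w => `|s * gauss i w| ^+ 3) /\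
    Ex P (fun w => `|s * gauss i w| ^+ 3) <= K.
  exists (`|s| ^+ 3 * (1 + 3)) => i.
  have l4 := (xi_even V_wiener (i0 i) (iS i) tt 2).1; rewrite -/(gauss i) in l4.
  have l2 := (gauss_L2 i).2.
  have lD : L1 P (fun w => gauss i w ^+ 2 + gauss i w ^+ 4) by exact: L1D.
  have lB : L1 P (fun w => `|s| ^+ 3 * (gauss i w ^+ 2 + gauss i w ^+ 4)) by exact: L1Zl.
  have le w : `|s * gauss i w| ^+ 3 <= `|s| ^+ 3 * (gauss i w ^+ 2 + gauss i w ^+ 4).
    rewrite normrM exprMn ler_wpM2l ?exprn_ge0//; set y := gauss i w.
    rewrite -[y ^+ 2]real_normK ?num_real// (exprM y 2 2) -[y ^+ 2]real_normK ?num_real//.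
    have y0 : 0 <= `|y| ^+ 2 by exact: sqr_ge0.
    have := mulr_ge0 y0 (sqr_ge0 (`|y| - 1)).
    have -> : `|y| ^+ 2 * (`|y| - 1) ^+ 2 =
      (`|y| ^+ 2) ^+ 2 - 2 * `|y| ^+ 3 + `|y| ^+ 2 by ring.
    have : 0 <= `|y| ^+ 3 by exact: exprn_ge0.
    have : 0 <= (`|y| ^+ 2) ^+ 2 by exact: sqr_ge0.
    by lra.
  have l3 : L1 P (fun w => `|s * gauss i w| ^+ 3).
    apply: (L1_le _ _ lB).
      by apply: measurable_funX; apply: measurableT_comp => //; exact: measurable_funM.
    by move=> w; rewrite ger0_norm ?exprn_ge0//; exact: le_trans (le w) (ler_norm _).
  split => //; apply: le_trans (Ex_le l3 lB le) _.
  rewrite ExZl// ExD// (xi_Ex2 V_wiener (i0 i) (iS i)).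
  by rewrite (xi_Ex4 V_wiener (i0 i) (iS i)).
pose C := 2 * K + v ^+ 2.
have bound m : (0 < m)%N ->
    `|Ex P (fun w => cos (x + \sum_(i < n) c i * gauss i w)) -
      expR (- (v / 2)) * cos x| <= C / Num.sqrt m%:R.
  move=> m0; pose b (_ : nat) := (Num.sqrt m%:R)^-1 * s.
  have -> : Ex P (fun w => cos (x + \sum_(i < n) c i * gauss i w)) =
      Ex P (fun w => cos (x + \sum_(i < m) b i * gauss i w)).
    apply: (same_law_Ex (g := fun y => cos (x + y)) (M := 1)) => //.
      by move=> y; exact: cos_max.
    move=> A mA; rewrite (gauss_sum_law c n mA) (gauss_sum_law b m mA).
    suff -> : \sum_(i < m) b i ^+ 2 = v by [].
    rewrite (eq_bigr (fun=> m%:R^-1 * v)) => [|i _]; last first.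
      by rewrite /b exprMn ss exprVn sqr_sqrtr.
    rewrite sumr_const card_ord -[LHS]mulr_natl mulrA divff ?mul1r//.
    by rewrite pnatr_eq0 -lt0n.
  have := @cos_clt _ _ _ P (fun i w => s * gauss i w) v K; rewrite -/C.
  move=> /(_ _ _ _ _ _ _ x m m0).
  under [X in Ex P X]eq_fun do rewrite mulr_sumr.
  under [X in Ex P X]eq_fun do under eq_bigr do rewrite mulrA.
  apply.
  - by move=> i; apply: L2Zl; exact: gauss_L2.
  - by move=> i; exact: (gauss_sum_indep (fun=> s) i s).
  - move=> i; rewrite ExZl ?(xi_Ex V_wiener (i0 i) (iS i)) ?mulr0//.
    exact: L2_L1 (gauss_L2 i).
  - move=> i; under [X in Ex P X]eq_fun do rewrite exprMn.
    by rewrite ExZl ?(xi_Ex2 V_wiener (i0 i) (iS i)) ?mulr1//; exact: (gauss_L2 i).2.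
  - by move=> i; exact: (hK i).1.
  - by move=> i; exact: (hK i).2.
apply/eqP; rewrite -subr_eq0 -normr_eq0; apply/negPn/negP => ne.
set D := `|_| in bound ne.
have D0 : 0 < D by rewrite lt_neqAle eq_sym ne normr_ge0.
(* [m] exceeds [(C / D)^2], so the bound [C / sqrt m] falls below the gap [D] that was assumed
   positive. *)
pose m := (Num.truncn ((C / D) ^+ 2)).+1.
have := bound m isT; apply/negP; rewrite -ltNge.
have m0 : 0 < Num.sqrt m%:R :> R by rewrite sqrtr_gt0 ltr0n.
rewrite ltr_pdivrMr// mulrC -ltr_pdivrMr//.
apply: le_lt_trans (ler_norm _) _; rewrite -sqrtr_sqr ltr_sqrt ?ltr0n//.
exact: truncnS_gt.
Qed.

Section vector.
Context (q m : nat) (A : 'M[R]_(q, m)).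

Definition gauss_vec w : 'cV[R]_q := A *m \col_j gauss j w.

Lemma gauss_vec_measurable : measurable_fun setT (gauss_vec : Om -> borel R q).
Proof.
apply: measurable_cV => i; under eq_fun do rewrite mxE.
apply: measurable_sum => j; apply: measurable_funM => //.
by under eq_fun do rewrite mxE; exact: (gauss_L2 j).1.
Qed.

Let Z : {mfun Om >-> borel R q} := mfun_Sub (mem_set gauss_vec_measurable).

Definition gauss_law : probability (borel R q) R := distribution P Z.

(** Extended by 0 beyond [m], since the laws of Gaussian sums are stated for sequences of
    coefficients. *)
Let coef (u : 'cV[R]_q) (j : nat) := if insub j is Some i then (A^T *m u) i 0 else 0.

Let gauss_vec_form (u : 'cV[R]_q) w :
  (u^T *m gauss_vec w) 0 0 = \sum_(j < m) coef u j * gauss j w.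
Proof.
rewrite /gauss_vec mulmxA mxE; apply: eq_bigr => j _; rewrite [X in _ * X]mxE.
by rewrite /coef valK -[A in LHS]trmxK -trmx_mul mxE.
Qed.

Let coef_sq u : \sum_(j < m) coef u j ^+ 2 = (u^T *m (A *m A^T) *m u) 0 0.
Proof.
rewrite mulmxA -mulmxA -[A in RHS]trmxK -trmx_mul trmxK sqE /sq.
by apply: eq_bigr => j _; rewrite /coef valK.
Qed.

Lemma gauss_law_normal : is_normal 0 (A *m A^T) gauss_law.
Proof.
move=> u C mC; rewrite mulmx0 mxE -coef_sq -(gauss_sum_law (coef u) m mC).
by congr (P _); apply/seteqP; split => w /=; rewrite gauss_vec_form.
Qed.

Lemma gauss_law_cos (u : 'cV[R]_q) c :
  Ex gauss_law (fun x => cos ((u^T *m x) 0 0 + c)) =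
  expR (- ((u^T *m (A *m A^T) *m u) 0 0 / 2)) * cos c.
Proof.
rewrite -coef_sq -gauss_sum_cos.
have mc := trig_measurable (trig_cos u c).
rewrite /Ex /Rintegral; congr fine.
rewrite (integral_distribution (X := Z) (f := fun x => (cos ((u^T *m x) 0 0 + c))%:E)) /=.
- by apply: eq_integral => w _; rewrite gauss_vec_form addrC.
- exact/measurable_EFinP.
- apply: (@L1_bounded _ _ _ P _ 1); first exact: (measurableT_comp mc gauss_vec_measurable).
  by move=> w; exact: cos_max.
Qed.

Lemma gauss_law_tight (e : R) : 0 < e -> exists2 L : R, 0 < L &
  (gauss_law [set x | (L ^+ 2 <= sq x)%R] <= e%:E)%E.
Proof.
move=> e0; have l : L1 P (fun w => sq (gauss_vec w)).
  apply: L1_sum => i _.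
  have : L2 P (fun w => gauss_vec w i 0).
    under eq_fun do rewrite mxE; apply: L2_sum => j _; apply: L2Zl.
    by under eq_fun do rewrite mxE; exact: gauss_L2.
  by case.
pose M := Ex P (fun w => `|sq (gauss_vec w)|).
have M0 : 0 <= M by apply: Ex_ge0.
have M1 : 0 < (M + 1) / e by rewrite divr_gt0// ltr_wpDl.
exists (Num.sqrt ((M + 1) / e)); first by rewrite sqrtr_gt0.
rewrite sqr_sqrtr; last exact: ltW.
have := markov_L1 M1 l; rewrite -/M.
have -> : [set w | (M + 1) / e <= `|sq (gauss_vec w)|] =
    gauss_vec @^-1` [set x | (M + 1) / e <= sq x].
  by apply/seteqP; split => w /=; rewrite ger0_norm// sq_ge0.
move=> /le_trans; apply; rewrite lee_fin.
rewrite ler_pdivrMr// mulrC mulfVK ?gt_eqF//.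
by rewrite lerDl.
Qed.

End vector.
End gaussian_vector.

(** * Stochastic differential equations with additive noise *)

Section paths.
Context {R : realType}.

Lemma le_mxnorm n (u : 'cV[R]_n) c : 0 <= c -> (forall i, `|u i 0| <= c) -> `|u| <= c.
Proof.
move=> c0 uc; have [->//|u0] := eqVneq `|u| 0.
have [[i j] /= e] := mx_norm_neq0 u0.
by rewrite {1}/Num.Def.normr /= e (ord1 j).
Qed.

Definition path_continuous (phi : R -> R) := {within `[0, +oo[, continuous phi}.

(** The path is extended evenly to the whole line, where uniform continuity near the compact
    interval is available. *)
Lemma path_modulus (phi : R -> R) (T e : R) : path_continuous phi -> 0 < e ->
  \forall N \near \oo, forall s t, 0 <= s <= T -> 0 <= t <= T ->
    `|s - t| <= T / N%:R -> `|phi s - phi t| <= e.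
Proof.
move=> cphi e0; pose psi (x : R^o) : R := phi `|x|.
have cpsi : continuous psi.
  move=> x; have /subspace_continuousP/(_ `|x|) := cphi.
  rewrite /= in_itv /= normr_ge0 => /(_ isT) c A /c wA.
  have nx : `|y : R^o| @[y --> x] --> `|x| by exact: norm_continuous.
  move: (nx _ wA); rewrite !nbhs_simpl /=; apply: filterS => y /=; apply.
  by rewrite in_itv /= normr_ge0.
have [del d0 hd] := compact_uniform (@segment_compact R 0 T) cpsi e0.
have psiE s : 0 <= s -> psi s = phi s by move=> s0; rewrite /psi ger0_norm.
near=> N => s t /andP[s0 sT] /andP[t0 tT] st.
rewrite -!psiE//; apply/ltW/hd; first by rewrite /= in_itv /= t0.
apply: le_lt_trans st _.
have N0 : 0 < N%:R :> R by rewrite ltr0n; near: N; exact: nbhs_infty_gt.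
rewrite ltr_pdivrMr// mulrC -ltr_pdivrMr//.
by near: N; exact: nbhs_infty_gtr.
Unshelve. all: by end_near. Qed.

Let mu := @lebesgue_measure R.

Let I (phi : R -> R) t := \int[mu]_(s in `[0, t]) phi s.

Lemma path_integrable phi t : path_continuous phi ->
  mu.-integrable `[0, t] (EFin \o phi).
Proof.
move=> cphi; apply: continuous_compact_integrable; first exact: segment_compact.
apply: continuous_subspaceW cphi => x /=.
by rewrite !in_itv /= andbT => /andP[].
Qed.

Lemma integral_increment phi (a b c e : R) : path_continuous phi -> 0 <= a -> a <= b ->
  (forall s, a <= s <= b -> `|phi s - c| <= e) ->
  `|I phi b - I phi a - (b - a) * c| <= (b - a) * e.
Proof.
move=> cphi a0 ab hs; rewrite /I Rintegral_itvB; first last.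
- by rewrite bnd_simp.
- by rewrite bnd_simp.
- exact: path_integrable.
have ma : (mu `]a, b] = (b - a)%:E)%E.
  by rewrite /mu lebesgue_measure_itv /= lte_fin; case: ltP => // ba;
    rewrite (@le_anti _ _ a b) ?ab// subrr.
have icst (k : R) : mu.-integrable `]a, b] (EFin \o (fun=> k)).
  have ck : path_continuous (fun=> k).
    by apply: continuous_subspaceT => x; exact: cvg_cst.
  apply: integrableS (path_integrable b ck) => //.
  by move=> x /=; rewrite !in_itv /= => /andP[ax ->]; rewrite (le_trans a0 (ltW ax)).
have iphi : mu.-integrable `]a, b] (EFin \o phi).
  apply: integrableS (path_integrable b cphi) => //.
  by move=> x /=; rewrite !in_itv /= => /andP[ax ->]; rewrite (le_trans a0 (ltW ax)).
have Icst (k : R) : \int[mu]_(s in `]a, b]) k = (b - a) * k.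
  rewrite Rintegral_cst// mulrC; congr (_ * _).
  by have := congr1 fine ma.
have mab : measurable (`]a, b] : set (measurableTypeR R)) by [].
have iB : mu.-integrable `]a, b] (EFin \o (fun s => phi s - c)).
  exact: (integrableB mab iphi (icst c)).
rewrite -Icst -RintegralB//.
apply: le_trans (le_normr_Rintegral _ _) _ => //.
rewrite -Icst; apply: le_Rintegral => //.
  exact: integrable_norm.
move=> s /=; rewrite in_itv /= => /andP[as' sb]; apply: hs.
by rewrite (ltW as').
Qed.

Lemma riemann_sum_cvg phi (a l : R) : path_continuous phi -> 0 <= a -> 0 <= l ->
  (l / N%:R) * (\sum_(j < N) phi (a + j%:R * (l / N%:R))) @[N --> \oo]
    --> I phi (a + l) - I phi a.
Proof.
move=> cphi a0 l0; apply/cvgrPdist_le => e e0.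
have e'0 : 0 < e / (l + 1) by rewrite divr_gt0// ltr_wpDl.
have hN := path_modulus (a + l) cphi e'0.
near=> N.
have N0 : 0 < N%:R :> R by rewrite ltr0n; near: N; exact: nbhs_infty_gt.
have mod : forall s t, 0 <= s <= a + l -> 0 <= t <= a + l ->
    `|s - t| <= (a + l) / N%:R -> `|phi s - phi t| <= e / (l + 1) by near: N.
pose del := l / N%:R; pose s (j : nat) := a + j%:R * del.
have del0 : 0 <= del by rewrite divr_ge0// ltW.
have sle (j : nat) : (j <= N)%N -> 0 <= s j <= a + l.
  move=> jN; rewrite addr_ge0 ?mulr_ge0//= lerD2l /del mulrCA ler_piMr//.
  by rewrite ler_pdivrMr// mul1r ler_nat.
have -> : I phi (a + l) - I phi a = \sum_(j < N) (I phi (s j.+1) - I phi (s j)).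
  rewrite -(big_mkord xpredT (fun j => I phi (s j.+1) - I phi (s j))) telescope_sumr//.
  by rewrite /s mul0r addr0 /del mulrCA divff ?mulr1// gt_eqF.
rewrite mulr_sumr -sumrB; apply: le_trans (ler_norm_sum _ _ _) _.
apply: (@le_trans _ _ (\sum_(j < N) del * (e / (l + 1)))).
  apply: ler_sum => j _.
  have ds : s j.+1 - s j = del by rewrite /s -natr1 mulrDl mul1r; ring.
  have ss : s j <= s j.+1 by rewrite -subr_ge0 ds.
  have /andP[sj0 _] := sle j (ltnW (ltn_ord j)).
  have /andP[_ sj1] := sle j.+1 (ltn_ord j).
  have := @integral_increment phi (s j) (s j.+1) (phi (s j)) (e / (l + 1)) cphi sj0 ss.
  rewrite ds; apply => r /andP[r0 r1].
  apply: mod.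
  - by rewrite (le_trans sj0 r0) (le_trans r1 sj1).
  - exact: sle (ltnW (ltn_ord j)).
  - rewrite ger0_norm ?subr_ge0//; apply: (@le_trans _ _ del).
      by rewrite -ds lerD2r.
    by rewrite ler_pM2r ?invr_gt0// lerDr.
rewrite sumr_const card_ord -mulr_natl /del mulrA [N%:R * _]mulrC divfK ?gt_eqF//.
by rewrite mulrA ler_pdivrMr ?ltr_wpDl// mulrC ler_pM2l// lerDl.
Unshelve. all: by end_near. Qed.

End paths.

(** * Pathwise convergence of Euler schemes *)

Section euler.
Context {R : realType} {n : nat} (beta : 'cV[R]_n -> 'cV[R]_n) (C : R).
Hypothesis C0 : 0 <= C.
Hypothesis beta_lip : forall x y, `|beta x - beta y| <= C * `|x - y|.

Lemma lip_coord_continuous i : continuous (fun x => beta x i 0).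
Proof.
have C1 : 0 < C + 1 by rewrite ltr_wpDl.
move=> x A /nbhs_ballP[e /= e0 hA]; apply/nbhs_ballP; exists (e / (C + 1)) => /=.
  by rewrite divr_gt0.
move=> y; rewrite -ball_normE /= => xy; apply: hA; rewrite /ball /=.
have := coord_mxnorm (beta x - beta y) i 0; rewrite !mxE => /le_lt_trans; apply.
apply: le_lt_trans (beta_lip x y) _.
apply: (@le_lt_trans _ _ ((C + 1) * `|x - y|)); first by rewrite ler_wpM2r// lerDl.
by rewrite mulrC -ltr_pdivlMr.
Qed.

Lemma drift_path_continuous (z : R -> 'cV[R]_n) i :
  (forall i, path_continuous (fun t => z t i 0)) ->
  path_continuous (fun t => beta (z t) i 0).
Proof.
move=> cz; apply/subspace_continuousP => x x0.
apply: (cvg_comp z (fun y => beta y i 0)); last exact: lip_coord_continuous.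
move=> A /nbhs_ballP[e /= e0 hA].
have near_i j : within `[0, +oo[ (nbhs x) [set s | `|z x j 0 - z s j 0| < e].
  have /subspace_continuousP/(_ x x0) := cz j.
  by move=> /cvgrPdist_lt/(_ _ e0).
have := filter_forall _ near_i; move=> /(_ _).
apply: filterS => s hs; apply: hA; split => // j j'; rewrite (ord1 j').
exact: hs.
Qed.

(** The start includes [nu 0] because a Wiener process vanishes at time 0 only almost surely; the
    integral equation at time 0 contains the same term. *)
Fixpoint euler (z0 : 'cV[R]_n) (nu : R -> 'cV[R]_n) (del : R) (j : nat) : 'cV[R]_n :=
  if j is j'.+1 then
    let y := euler z0 nu del j' in
    y + del *: beta y + (nu (j'.+1%:R * del) - nu (j'%:R * del))
  else z0 + nu 0.

(** For additive noise the noise cancels exactly in each step, so only the drift is discretized. The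
    error obeys a linear recursion with factor [1 + del * C], closed by a discrete Gronwall
    argument. *)
Lemma euler_cvg (z0 : 'cV[R]_n) (nu z : R -> 'cV[R]_n) t i :
  (forall i, path_continuous (fun t => z t i 0)) ->
  (forall t i, 0 <= t -> z t i 0 =
     z0 i 0 + \int[lebesgue_measure]_(s in `[0, t]) beta (z s) i 0 + nu t i 0) ->
  0 <= t ->
  euler z0 nu (t / N%:R) N i 0 @[N --> \oo] --> z t i 0.
Proof.
move=> cz ez t0; apply/cvgrPdist_le => e e0.
(* This is the Gronwall amplification of the local error over [[0, t]]; the [+ 1] keeps it positive
   at [t = 0]. *)
pose K := t * expR (t * C) + 1.
have K0 : 0 < K by rewrite ltr_wpDl// mulr_ge0 ?expR_ge0.
have eK : 0 < e / K by rewrite divr_gt0.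
have cphi j := @drift_path_continuous z j cz.
have modj j := path_modulus t (cphi j) eK.
have modN := filter_forall _ modj; 
have ft : Filter (\oo : set_system nat) by exact: _.
have {modj}modN := modN ft.
near=> N.
have N0 : 0 < N%:R :> R by rewrite ltr0n; near: N; exact: nbhs_infty_gt.
have mod : forall j s s', 0 <= s <= t -> 0 <= s' <= t ->
    `|s - s'| <= t / N%:R -> `|beta (z s) j 0 - beta (z s') j 0| <= e / K by near: N.
set del := t / N%:R; have del0 : 0 <= del by rewrite divr_ge0// ltW.
pose y j := euler z0 nu del j.
have yS j : y j.+1 = y j + del *: beta (y j) + (nu (j.+1%:R * del) - nu (j%:R * del)) by [].
pose J s l := \int[lebesgue_measure]_(r in `[0, s]) beta (z r) l 0.
have zJ s l : 0 <= s -> z s l 0 = z0 l 0 + J s l + nu s l 0 by exact: ez.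
have step j : (j < N)%N -> `|z (j.+1%:R * del) - y j.+1| <=
    (1 + del * C) * `|z (j%:R * del) - y j| + del * (e / K).
  move=> jN; have sj0 : 0 <= j%:R * del by rewrite mulr_ge0.
  have sj1 : j.+1%:R * del <= t.
    by rewrite /del mulrCA ler_piMr// ler_pdivrMr// mul1r ler_nat.
  have ds : j.+1%:R * del - j%:R * del = del by rewrite -natr1 mulrDl mul1r; ring.
  have ss : j%:R * del <= j.+1%:R * del by rewrite -subr_ge0 ds.
  apply: le_mxnorm => [|l].
    apply: addr_ge0; apply: mulr_ge0 => //; last exact: ltW.
    by rewrite addr_ge0// mulr_ge0.
  have inc := @integral_increment _ _ (j%:R * del) (j.+1%:R * del)
    (beta (z (j%:R * del)) l 0) (e / K) (cphi l) sj0 ss.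
  rewrite ds -/(J _ l) -/(J _ l) in inc.
  rewrite yS !mxE (zJ (j.+1%:R * del) l)//; last exact: le_trans ss.
  have ezj := zJ (j%:R * del) l sj0.
  move: inc ezj; set J1 := J (j.+1%:R * del) l; set J0 := J (j%:R * del) l => inc ezj.
  have lip : `|beta (z (j%:R * del)) l 0 - beta (y j) l 0| <= C * `|z (j%:R * del) - y j|.
    have := coord_mxnorm (beta (z (j%:R * del)) - beta (y j)) l 0; rewrite !mxE => /le_trans.
    by apply.
  have co : `|z (j%:R * del) l 0 - y j l 0| <= `|z (j%:R * del) - y j|.
    by have := coord_mxnorm (z (j%:R * del) - y j) l 0; rewrite !mxE.
  have {}inc : `|J1 - J0 - del * beta (z (j%:R * del)) l 0| <= del * (e / K).
    apply: inc => s /andP[s0 s1]; apply: mod.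
    - by rewrite (le_trans sj0 s0) (le_trans s1 sj1).
    - by rewrite sj0 (le_trans ss sj1).
    - rewrite ger0_norm ?subr_ge0//.
      by apply: le_trans (lerB s1 (lexx _)) _; rewrite ds.
  have -> : z0 l 0 + J1 + nu (j.+1%:R * del) l 0 -
     (y j l 0 + del * beta (y j) l 0 + (nu (j.+1%:R * del) l 0 - nu (j%:R * del) l 0)) =
     (z (j%:R * del) l 0 - y j l 0)
     + del * (beta (z (j%:R * del)) l 0 - beta (y j) l 0)
     + (J1 - J0 - del * beta (z (j%:R * del)) l 0) by rewrite ezj; ring.
  apply: le_trans (ler_normD _ _) _; apply: lerD inc.
  apply: le_trans (ler_normD _ _) _; rewrite mulrDl mul1r lerD//.
  by rewrite normrM (ger0_norm del0) -mulrA ler_wpM2l.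
have y0 : z (0%:R * del) = y 0.
  apply/colP => l; rewrite mul0r /y /= mxE ez//.
  by rewrite set_itv1 Rintegral_set1 addr0.
have bound j : (j <= N)%N -> `|z (j%:R * del) - y j| <=
    j%:R * del * (e / K) * (1 + del * C) ^+ j.
  elim: j => [_|j IH jN]; first by rewrite y0 subrr normr0 !mul0r.
  apply: le_trans (step j jN) _.
  have c1 : 1 <= 1 + del * C by rewrite lerDl mulr_ge0.
  have c0 : 0 <= 1 + del * C by exact: le_trans c1.
  have dK : 0 <= del * (e / K) by rewrite mulr_ge0// ltW.
  have h1 : del * (e / K) <= del * (e / K) * (1 + del * C) ^+ j.+1.
    by rewrite ler_peMr// exprn_ege1.
  have h2 := ler_wpM2l c0 (IH (ltnW jN)).
  apply: le_trans (lerD h2 h1) _.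
  by rewrite -natr1 exprS; set u := _ ^+ j; rewrite le_eqVlt; apply/orP; left; apply/eqP; ring.
have tE : N%:R * del = t by rewrite /del mulrC divfK// gt_eqF.
have := bound N (leqnn _); rewrite tE => bN.
have := coord_mxnorm (z t - y N) i 0; rewrite !mxE => /le_trans; apply.
apply: le_trans bN _.
have : (1 + del * C) ^+ N <= expR (t * C).
  rewrite -tE -mulrA expRM_natl; apply: lerXn2r; rewrite ?nnegrE ?expR_ge0//.
    by rewrite addr_ge0 ?mulr_ge0.
  exact: expR_ge1Dx.
move=> hexp; apply: (@le_trans _ _ (t * (e / K) * expR (t * C))).
  by rewrite ler_wpM2l// mulr_ge0// ltW.
have -> : t * (e / K) * expR (t * C) = t * expR (t * C) / K * e by ring.
by rewrite ler_piMl ?(ltW e0)// ler_pdivrMr// mul1r /K lerDl.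
Unshelve. all: by end_near. Qed.

End euler.

Section noise_forms.
Context {R : realType} {d : measure_display} {Om : measurableType d}
  (P : probability Om R) (I : finType) (V : I -> R -> Om -> R).
Hypothesis V_wiener : forall i, wiener P (V i).
Hypothesis V_indep : indep_family P (fun i => sigma_process `[0, +oo[ (V i)).

Definition noise (l : I -> R) s t w := \sum_a l a * increment V a s t w.

Lemma noise_step l s t : step_fun V s t (noise l s t).
Proof.
apply: measurable_sum => a; apply: measurable_funM => //.
by apply: steps_increment; rewrite inE.
Qed.

Lemma noise_xi l s t w : s < t ->
  noise l s t w = Num.sqrt (t - s) * \sum_a l a * xi V s t a w.
Proof.
move=> st; rewrite /noise mulr_sumr; apply: eq_bigr => a _.
rewrite /xi mulrCA [X in _ = _ * X]mulrA mulfV ?mul1r//.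
by rewrite gt_eqF// sqrtr_gt0 subr_gt0.
Qed.

Lemma noise_moments l s t : 0 <= s -> s <= t -> [/\ L2 P (noise l s t),
  Ex P (noise l s t) = 0 &
  Ex P (fun w => noise l s t w ^+ 2) = (t - s) * \sum_a l a ^+ 2].
Proof.
move=> s0; rewrite le_eqVlt => /predU1P[<-|st].
  have -> : noise l s s = fun=> 0.
    by apply/funext => w; rewrite /noise big1// => a _; rewrite /increment subrr mulr0.
  by rewrite subrr mul0r; split; [exact: L2_cst|exact: Ex_cst|rewrite expr0n Ex_cst].
have lx a := xi_L2 V_wiener s0 st a.
have lax a : L2 P (fun w => l a * xi V s t a w) by exact: L2Zl.
have ls : L2 P (fun w => \sum_a l a * xi V s t a w) by exact: L2_sum.
rewrite (_ : noise l s t = (fun w => Num.sqrt (t - s) * \sum_a l a * xi V s t a w)); last first.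
  by apply/funext => w; rewrite noise_xi.
split; first exact: L2Zl.
  rewrite ExZl; last exact: L2_L1.
  rewrite Ex_sum => [|a _]; last exact: L2_L1.
  rewrite big1 ?mulr0// => a _; rewrite ExZl ?(xi_Ex V_wiener s0 st) ?mulr0//.
  exact: L2_L1.
under [X in Ex P X]eq_fun do rewrite exprMn.
rewrite ExZl; last exact: ls.2.
rewrite sqr_sqrtr ?subr_ge0 ?(ltW st)//; congr (_ * _).
have -> : (fun w => (\sum_a l a * xi V s t a w) ^+ 2) =
    (fun w => \sum_a \sum_b l a * l b * (xi V s t a w * xi V s t b w)).
  apply/funext => w; rewrite expr2 mulr_suml; apply: eq_bigr => a _.
  by rewrite mulr_sumr; apply: eq_bigr => b _; ring.
have lab a b : L1 P (fun w => l a * l b * (xi V s t a w * xi V s t b w)).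
  by apply: L1Zl; exact: L2_mul.
rewrite Ex_sum => [|a _]; last exact: L1_sum.
apply: eq_bigr => a _; rewrite Ex_sum//.
rewrite (bigD1 a)//= big1 ?addr0 => [|b ba].
  by rewrite ExZl ?(xi_Ex_mul V_wiener V_indep s0 st) ?eqxx ?mulr1//; exact: L2_mul.
rewrite ExZl ?(xi_Ex_mul V_wiener V_indep s0 st); last exact: L2_mul.
by rewrite eq_sym (negbTE ba) mulr0.
Qed.

Lemma sqr_sum_le (m : nat) (x : nat -> R) :
  (\sum_(j < m) x j) ^+ 2 <= m%:R * \sum_(j < m) x j ^+ 2.
Proof.
elim: m => [|m IH]; first by rewrite !big_ord0 expr0n mul0r.
rewrite !big_ord_recr /=; set S := \sum_(j < m) x j; set T := \sum_(j < m) x j ^+ 2.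
have h : 2 * (S * x m) <= T + m%:R * x m ^+ 2.
  have -> : m%:R * x m ^+ 2 = \sum_(j < m) x m ^+ 2 by rewrite sumr_const card_ord mulr_natl.
  rewrite -big_split mulr_suml mulr_sumr; apply: ler_sum => j _ /=.
  by have := sqr_ge0 (x j - x m); nra.
rewrite -/S -/T in IH; rewrite sqrrD -natr1 mulr2n mulrDl mul1r.
by move: IH h; lra.
Qed.

(** Meant for Riemann sums over an interval of length [a]: a uniform bound on second moments of the
    integrand yields one that does not depend on the mesh. *)
Lemma Ex_sqr_sum_le (m : nat) (a c : R) (X : nat -> Om -> R) : 0 <= c ->
  (forall j, (j < m)%N -> L2 P (X j) /\ Ex P (fun w => X j w ^+ 2) <= c) ->
  L2 P (fun w => a / m%:R * \sum_(j < m) X j w) /\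
  Ex P (fun w => (a / m%:R * \sum_(j < m) X j w) ^+ 2) <= a ^+ 2 * c.
Proof.
move=> c0 hX; have lS : L2 P (fun w => \sum_(j < m) X j w).
  by apply: L2_sum => j _; exact: (hX j (ltn_ord j)).1.
have lS2 : L1 P (fun w => \sum_(j < m) X j w ^+ 2).
  by apply: L1_sum => j _; exact: (hX j (ltn_ord j)).1.2.
have laS := L2Zl (a / m%:R) lS; split => //.
case: m hX lS lS2 laS => [|m] hX lS lS2 laS.
  under [X in Ex P X]eq_fun do rewrite big_ord0 mulr0 expr0n.
  by rewrite Ex_cst mulr_ge0// sqr_ge0.
have m0 : (0 : R) < m.+1%:R by rewrite ltr0n.
have am : 0 <= a ^+ 2 / m.+1%:R by rewrite divr_ge0 ?sqr_ge0.
apply: (@le_trans _ _ (Ex P (fun w => a ^+ 2 / m.+1%:R * \sum_(j < m.+1) X j w ^+ 2))).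
  apply: Ex_le => [| |w]; [exact: laS.2|exact: L1Zl|].
  have := sqr_sum_le m.+1 (X ^~ w); set S := \sum_(j < _) _; set T := \sum_(j < _) _ => h.
  rewrite exprMn expr_div_n -[leLHS]mulrA -[leRHS]mulrA ler_wpM2l ?sqr_ge0//.
  have := ler_wpM2l (_ : 0 <= (m.+1%:R ^- 2)) h; rewrite invr_ge0 exprn_ge0// => /(_ isT).
  move=> /le_trans; apply; rewrite expr2 invfM -mulrA [X in _ * X]mulrA mulVf ?mul1r//.
rewrite ExZl// Ex_sum => [|j _]; last exact: (hX j (ltn_ord j)).1.2.
apply: (@le_trans _ _ (a ^+ 2 / m.+1%:R * (\sum_(j < m.+1) c))).
  by rewrite ler_wpM2l//; apply: ler_sum => j _; exact: (hX j (ltn_ord j)).2.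
by rewrite sumr_const card_ord -[X in _ * X]mulr_natl mulrA divfK// gt_eqF.
Qed.

(* On [s, t] the drift [D] is [(t - s) u] with [u] known at time [s], up to an
   error of order [(t - s)^(3/2)] in L2. *)
Definition drift_bound s t c (D u : Om -> R) :=
  [/\ L2 P D /\ Ex P (fun w => D w ^+ 2) <= c * (t - s) ^+ 2,
      L2 P u /\ Ex P (fun w => u w ^+ 2) <= c, adapted V s u &
      L2 P (fun w => D w - (t - s) * u w) /\
      Ex P (fun w => (D w - (t - s) * u w) ^+ 2) <= c * (t - s) ^+ 3].

(** Steps of length at most 1 allow powers of the step to be compared. The class is stable under
    linear combinations, which is how the observed process inherits the property from factors and
    errors. *)
Definition drifts (D : R -> R -> Om -> R) := exists2 c, 0 <= c &
  forall s t, 0 <= s -> s <= t -> t <= s + 1 -> exists u, drift_bound s t c (D s t) u.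

Lemma L2_sqrD_le (X Y : Om -> R) a b : L2 P X -> L2 P Y ->
  Ex P (fun w => X w ^+ 2) <= a -> Ex P (fun w => Y w ^+ 2) <= b ->
  L2 P (fun w => X w + Y w) /\ Ex P (fun w => (X w + Y w) ^+ 2) <= 2 * a + 2 * b.
Proof.
move=> lX lY Xa Yb; have lXY := L2D lX lY; split => //.
apply: (@le_trans _ _ (Ex P (fun w => 2 * X w ^+ 2 + 2 * Y w ^+ 2))).
  apply: Ex_le => [| |w]; first exact: lXY.2.
  - by apply: L1D; apply: L1Zl; [exact: lX.2|exact: lY.2].
  - by have := sqr_ge0 (X w - Y w); nra.
rewrite ExD; [|by apply: L1Zl; exact: lX.2|by apply: L1Zl; exact: lY.2].
rewrite !ExZl; [|exact: lY.2|exact: lX.2].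
by rewrite lerD// ler_pM2l.
Qed.

Lemma L2_sqrZ_le (X : Om -> R) k a : L2 P X -> Ex P (fun w => X w ^+ 2) <= a ->
  L2 P (fun w => k * X w) /\ Ex P (fun w => (k * X w) ^+ 2) <= k ^+ 2 * a.
Proof.
move=> lX Xa; split; first exact: L2Zl.
under [X in Ex P X]eq_fun do rewrite exprMn.
by rewrite ExZl ?ler_wpM2l ?sqr_ge0//; exact: lX.2.
Qed.

Lemma driftsD D1 D2 : drifts D1 -> drifts D2 ->
  drifts (fun s t w => D1 s t w + D2 s t w).
Proof.
move=> [c1 c10 h1] [c2 c20 h2]; exists (2 * c1 + 2 * c2).
  by rewrite addr_ge0 ?mulr_ge0.
move=> s t s0 st ts.
have [u1 [[lD1 eD1] [lu1 eu1] a1 [lr1 er1]]] := h1 s t s0 st ts.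
have [u2 [[lD2 eD2] [lu2 eu2] a2 [lr2 er2]]] := h2 s t s0 st ts.
exists (fun w => u1 w + u2 w); split.
- by have [? h] := L2_sqrD_le lD1 lD2 eD1 eD2; split => //; rewrite mulrDl -!mulrA.
- exact: L2_sqrD_le.
- exact: measurable_funD.
- have [l h] := L2_sqrD_le lr1 lr2 er1 er2.
  have E : (fun w => D1 s t w + D2 s t w - (t - s) * (u1 w + u2 w)) =
    (fun w => D1 s t w - (t - s) * u1 w + (D2 s t w - (t - s) * u2 w)).
    by apply/funext => w; ring.
  rewrite E; split => //.
  rewrite (_ : (fun w => _ ^+ 2) = (fun w => (D1 s t w - (t - s) * u1 w
    + (D2 s t w - (t - s) * u2 w)) ^+ 2)); first by rewrite mulrDl -!mulrA.
  by apply/funext => w; congr (_ ^+ 2); ring.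
Qed.

Lemma driftsZ k D : drifts D -> drifts (fun s t w => k * D s t w).
Proof.
move=> [c c0 h]; exists (k ^+ 2 * c); first by rewrite mulr_ge0// sqr_ge0.
move=> s t s0 st ts; have [u [[lD eD] [lu eu] a [lr er]]] := h s t s0 st ts.
exists (fun w => k * u w); split.
- by rewrite -mulrA; exact: L2_sqrZ_le.
- exact: L2_sqrZ_le.
- exact: measurable_funM.
- rewrite (_ : (fun w => k * D s t w - (t - s) * (k * u w)) =
    (fun w => k * (D s t w - (t - s) * u w))); last by apply/funext => w; ring.
  rewrite (_ : (fun w => _ ^+ 2) = (fun w => (k * (D s t w - (t - s) * u w)) ^+ 2)).
    by rewrite -mulrA; exact: L2_sqrZ_le.
  by apply/funext => w; congr (_ ^+ 2); ring.
Qed.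

Lemma drifts0 : drifts (fun _ _ _ => 0).
Proof.
exists 0 => // s t s0 st ts; exists (fun=> 0); split.
- by split; [exact: L2_cst|rewrite expr0n Ex_cst mul0r].
- by split; [exact: L2_cst|rewrite expr0n Ex_cst].
- exact: measurable_cst.
- under eq_fun do rewrite mulr0 subr0.
  under [X in _ /\ Ex P X <= _]eq_fun do rewrite mulr0 subr0 expr0n.
  by split; [exact: L2_cst|rewrite Ex_cst mul0r].
Qed.

Lemma drifts_sum J (r : seq J) (D : J -> R -> R -> Om -> R) :
  (forall j, drifts (D j)) -> drifts (fun s t w => \sum_(j <- r) D j s t w).
Proof.
move=> hD; elim: r => [|j r IH].
  rewrite (_ : (fun s t w => _) = (fun _ _ _ => 0)); first exact: drifts0.
  by apply/funext => s; apply/funext => t; apply/funext => w; rewrite big_nil.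
rewrite (_ : (fun s t w => _) =
  (fun s t w => D j s t w + \sum_(j <- r) D j s t w)); first exact: driftsD.
by apply/funext => s; apply/funext => t; apply/funext => w; rewrite big_cons.
Qed.

End noise_forms.

(** * Drift estimates for an equation with Lipschitz drift *)

Section lipschitz_sde.
Context {R : realType} {d : measure_display} {Om : measurableType d}
  (P : probability Om R) (I : finType) (V : I -> R -> Om -> R).
Hypothesis V_wiener : forall i, wiener P (V i).
Hypothesis V_indep : indep_family P (fun i => sigma_process `[0, +oo[ (V i)).
Context {n : nat} (beta : 'cV[R]_n -> 'cV[R]_n) (C : R).
Hypothesis C0 : 0 <= C.
Hypothesis beta_lip : forall x y, `|beta x - beta y| <= C * `|x - y|.
Context (l : 'I_n -> I -> R) (N Z : R -> Om -> 'cV[R]_n) (z0 : 'cV[R]_n) (M : R).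
Hypothesis NE : forall t w i, N t w i 0 = \sum_a l i a * V a t w.
Hypothesis Z_sde : forall i, solves_sde P (z0 i 0) (fun t w => beta (Z t w) i 0)
  (fun t w => N t w i 0) (fun t w => Z t w i 0).
Hypothesis Z_L2 : forall t i, 0 <= t ->
  L2 P (fun w => Z t w i 0) /\ Ex P (fun w => Z t w i 0 ^+ 2) <= M.

Let good : {ae P, forall w, (forall i, path_continuous (fun t => Z t w i 0)) /\
  forall t i, 0 <= t -> Z t w i 0 =
    z0 i 0 + \int[lebesgue_measure]_(s in `[0, t]) beta (Z s w) i 0 + N t w i 0}.
Proof.
have F := ae_filter_ringOfSetsType P.
have := @filter_forall _ _ _ (almost_everywhere P) F Z_sde.
apply: filterS => w h; split => [i|t i t0]; first exact: (h i).1.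
exact: (h i).2.
Qed.

Let N_adapted t s i : 0 <= s -> s <= t -> adapted V t (fun w => N s w i 0).
Proof.
move=> s0 st; under eq_fun do rewrite NE.
by apply: measurable_sum => a; apply: measurable_funM => //; exact: past_value.
Qed.

Let beta_meas d' (T : measurableType d') (f : T -> 'cV[R]_n) i :
  (forall i, measurable_fun setT (fun w => f w i 0)) ->
  measurable_fun setT (fun w => beta (f w) i 0).
Proof.
move=> mf; have mb := continuous_borel_measurable (lip_coord_continuous (i := i) C0 beta_lip).
exact: (measurableT_comp mb (measurable_cV mf)).
Qed.

Let euler_adapted t del m i : 0 <= del -> m%:R * del <= t ->
  adapted V t (fun w => euler beta z0 (N ^~ w) del m i 0).
Proof.
move=> del0; elim: m i => [|m IH] i mt.
  under eq_fun do rewrite /= mxE.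
  by apply: measurable_funD => //; apply: N_adapted => //; move: mt; rewrite mul0r.
have mS : m%:R * del <= m.+1%:R * del by rewrite ler_wpM2r// ler_nat.
have mt' : m%:R * del <= t by exact: le_trans mt.
have ay j : adapted V t (fun w => euler beta z0 (N ^~ w) del m j 0) by exact: IH.
under eq_fun do rewrite /= !mxE.
apply: measurable_funD; last first.
  by apply: measurable_funB; apply: N_adapted => //; rewrite mulr_ge0.
apply: measurable_funD; first exact: ay.
by apply: measurable_funM => //; exact: beta_meas.
Qed.

(* The strong solution is a pathwise limit of Euler schemes, which only use the
   noise up to time [t]. *)
Lemma adapted_version t i : 0 <= t ->
  exists2 Y, adapted V t Y & {ae P, forall w, Y w = Z t w i 0}.
Proof.
move=> t0.
pose E m w := euler beta z0 (N ^~ w) (t / m%:R) m i 0.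
exists (fun w => fine (limn_esup (fun m => (E m w)%:E))).
  apply: measurableT_comp; first exact: fine_measurable.
  apply: measurable_fun_limn_esup => m; apply/measurable_EFinP.
  apply: euler_adapted; first by rewrite divr_ge0.
  have [->|m0] := posnP m; first by rewrite mul0r.
  by rewrite mulrC divfK// pnatr_eq0 -lt0n.
apply: filterS good => w [cz ez].
have c : (E m w)%:E @[m --> \oo] --> (Z t w i 0)%:E.
  apply: cvg_EFin; first by near=> m.
  exact: (euler_cvg (i := i) C0 beta_lip cz ez t0).
have -> : limn_esup (fun m => (E m w)%:E) = (Z t w i 0)%:E => //.
rewrite is_cvg_limn_esupE; last by apply/cvg_ex; eexists; exact: c.
exact: cvg_lim c.
Unshelve. all: by end_near. Qed.

Let U t i w := beta (Z t w) i 0.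

Let mZ t i : 0 <= t -> measurable_fun setT (fun w => Z t w i 0).
Proof. by move=> t0; exact: (Z_L2 i t0).1.1. Qed.

Let mU t i : 0 <= t -> measurable_fun setT (U t i).
Proof. by move=> t0; apply: beta_meas => j; exact: mZ. Qed.

(** Almost surely this is the time integral of [beta] along the path. Defined through [Z] and the
    noise, it is visibly measurable. *)
Definition drift s t i w := Z t w i 0 - Z s w i 0 - noise V (l i) s t w.

Let M0 : (0 < n)%N -> 0 <= M.
Proof.
move=> n0; apply: le_trans (Z_L2 (Ordinal n0) (lexx 0)).2.
by apply: Ex_ge0 => w; exact: sqr_ge0.
Qed.

Let sumE m (F : 'I_m -> Om -> R) c : (forall i, L1 P (F i)) ->
  (forall i, Ex P (F i) <= c) -> Ex P (fun w => \sum_i F i w) <= m%:R * c.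
Proof.
move=> lF Fc; rewrite Ex_sum// (le_trans (ler_sum _ (fun i _ => Fc i)))//.
by rewrite sumr_const card_ord mulr_natl.
Qed.

Let U_incr s t i c : 0 <= s -> 0 <= t ->
  (forall j, Ex P (fun w => (Z t w j 0 - Z s w j 0) ^+ 2) <= c) ->
  L2 P (fun w => U t i w - U s i w) /\
  Ex P (fun w => (U t i w - U s i w) ^+ 2) <= C ^+ 2 * (n%:R * c).
Proof.
move=> s0 t0 hc.
have lD j : L2 P (fun w => Z t w j 0 - Z s w j 0).
  by apply: L2B; [exact: (Z_L2 j t0).1|exact: (Z_L2 j s0).1].
have lB : L1 P (fun w => C ^+ 2 * \sum_j (Z t w j 0 - Z s w j 0) ^+ 2).
  by apply: L1Zl; apply: L1_sum => j _; exact: (lD j).2.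
have le w : (U t i w - U s i w) ^+ 2 <= C ^+ 2 * \sum_j (Z t w j 0 - Z s w j 0) ^+ 2.
  have h : `|U t i w - U s i w| <= C * `|Z t w - Z s w|.
    apply: le_trans (beta_lip _ _).
    by have := coord_mxnorm (beta (Z t w) - beta (Z s w)) i 0; rewrite !mxE.
  rewrite -[leLHS]real_normK ?num_real//.
  apply: (@le_trans _ _ ((C * `|Z t w - Z s w|) ^+ 2)).
    by rewrite lerXn2r ?nnegrE ?mulr_ge0.
  rewrite exprMn ler_wpM2l ?sqr_ge0//; apply: le_trans (mxnorm_sq _) _.
  by rewrite /sq; apply: ler_sum => j _; rewrite !mxE.
have m : measurable_fun setT (fun w => U t i w - U s i w).
  by apply: measurable_funB; exact: mU.
have l2 : L2 P (fun w => U t i w - U s i w).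
  split => //; apply: (L1_le _ _ lB); first exact: sqr_measurable.
  by move=> w; rewrite ger0_norm ?sqr_ge0//; exact: le_trans (le w) (ler_norm _).
split => //; apply: le_trans (Ex_le l2.2 lB le) _.
rewrite ExZl; last by apply: L1_sum => j _; exact: (lD j).2.
rewrite ler_wpM2l ?sqr_ge0//; apply: sumE => // j; exact: (lD j).2.
Qed.

Let b i := beta 0 i 0.

Let MU i := 2 * (C ^+ 2 * (n%:R * M)) + 2 * b i ^+ 2.

Let U_L2 t i : 0 <= t -> L2 P (U t i) /\ Ex P (fun w => U t i w ^+ 2) <= MU i.
Proof.
move=> t0.
have lB : L1 P (fun w => C ^+ 2 * \sum_j Z t w j 0 ^+ 2).
  by apply: L1Zl; apply: L1_sum => j _; exact: (Z_L2 j t0).1.2.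
have le w : (U t i w - b i) ^+ 2 <= C ^+ 2 * \sum_j Z t w j 0 ^+ 2.
  have h : `|U t i w - b i| <= C * `|Z t w|.
    have := beta_lip (Z t w) 0; rewrite subr0; apply: le_trans.
    by have := coord_mxnorm (beta (Z t w) - beta 0) i 0; rewrite !mxE.
  rewrite -[leLHS]real_normK ?num_real//.
  apply: (@le_trans _ _ ((C * `|Z t w|) ^+ 2)).
    by rewrite lerXn2r ?nnegrE ?mulr_ge0.
  by rewrite exprMn ler_wpM2l ?sqr_ge0//; exact: mxnorm_sq.
have m : measurable_fun setT (fun w => U t i w - b i).
  by apply: measurable_funB => //; exact: mU.
have l2 : L2 P (fun w => U t i w - b i).
  split => //; apply: (L1_le _ _ lB); first exact: sqr_measurable.
  by move=> w; rewrite ger0_norm ?sqr_ge0//; exact: le_trans (le w) (ler_norm _).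
have e2 : Ex P (fun w => (U t i w - b i) ^+ 2) <= C ^+ 2 * (n%:R * M).
  apply: le_trans (Ex_le l2.2 lB le) _.
  rewrite ExZl; last by apply: L1_sum => j _; exact: (Z_L2 j t0).1.2.
  rewrite ler_wpM2l ?sqr_ge0//; apply: sumE => j; first exact: (Z_L2 j t0).1.2.
  exact: (Z_L2 j t0).2.
have ecst : Ex P (fun=> b i ^+ 2) <= b i ^+ 2 by rewrite Ex_cst.
have := L2_sqrD_le l2 (L2_cst P (b i)) e2 ecst.
by under eq_fun do rewrite subrK; under [X in _ /\ Ex P X <= _]eq_fun do rewrite subrK.
Qed.

Let MU0 i : 0 <= MU i.
Proof.
by apply: le_trans (U_L2 i (lexx 0)).2; apply: Ex_ge0 => w; exact: sqr_ge0.
Qed.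

Let drift_measurable s t i : 0 <= s -> s <= t -> measurable_fun setT (drift s t i).
Proof.
move=> s0 st; apply: measurable_funB.
  by apply: measurable_funB; apply: mZ => //; exact: le_trans st.
by have [[m _] _ _] := noise_moments V_wiener V_indep (l i) s0 st.
Qed.

(** Almost every path is continuous, so the time integral is a limit of finite sums; Fatou's lemma
    then bounds its moments from those of [U] at fixed times. *)
Let drift_riemann s t i : 0 <= s -> s <= t ->
  {ae P, forall w, ((t - s) / m%:R) * (\sum_(j < m) U (s + j%:R * ((t - s) / m%:R)) i w)
    @[m --> \oo] --> drift s t i w}.
Proof.
move=> s0 st; apply: filterS good => w [cz ez].
have cphi := drift_path_continuous (i := i) C0 beta_lip cz.
have ts0 : 0 <= t - s by rewrite subr_ge0.
have := riemann_sum_cvg cphi s0 ts0.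
rewrite [s + (t - s)]addrC subrK.
suff -> : \int[lebesgue_measure]_(r in `[0, t]) beta (Z r w) i 0 -
    \int[lebesgue_measure]_(r in `[0, s]) beta (Z r w) i 0 = drift s t i w by [].
rewrite /drift (ez t)// ?(ez s)//; last exact: le_trans st.
rewrite (_ : noise V (l i) s t w = N t w i 0 - N s w i 0); first by ring.
rewrite !NE -sumrB; apply: eq_bigr => a _; rewrite /increment; ring.
Qed.

Let drift_L2 s t i : 0 <= s -> s <= t ->
  L2 P (drift s t i) /\ Ex P (fun w => drift s t i w ^+ 2) <= (t - s) ^+ 2 * MU i.
Proof.
move=> s0 st; have ts0 : 0 <= t - s by rewrite subr_ge0.
have hF m := @Ex_sqr_sum_le _ _ _ P m (t - s) (MU i)
  (fun j w => U (s + j%:R * ((t - s) / m%:R)) i w) (MU0 i).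
have t0 m j : 0 <= s + j%:R * ((t - s) / m%:R).
  by rewrite addr_ge0// mulr_ge0// divr_ge0.
apply: (fatou_L2 (fun m => (hF m (fun j _ => U_L2 i (t0 m j))).1)
  (fun m => (hF m (fun j _ => U_L2 i (t0 m j))).2)).
- exact: drift_measurable.
- exact: drift_riemann.
Qed.

Let Lnoise i := \sum_a l i a ^+ 2.

(** Noise gives second moment of order [t - s], the drift only [(t - s)^2]; on steps of length at
    most 1 the former dominates. *)
Let Z_incr s t i : 0 <= s -> s <= t -> t <= s + 1 ->
  Ex P (fun w => (Z t w i 0 - Z s w i 0) ^+ 2) <= (2 * MU i + 2 * Lnoise i) * (t - s).
Proof.
move=> s0 st ts1; have [lD eD] := drift_L2 i s0 st.
have [lN _ eN] := noise_moments V_wiener V_indep (l i) s0 st.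
have eN' : Ex P (fun w => noise V (l i) s t w ^+ 2) <= (t - s) * Lnoise i by rewrite eN.
have [_ h] := L2_sqrD_le lD lN eD eN'.
rewrite (_ : (fun w => (Z t w i 0 - Z s w i 0) ^+ 2) =
  (fun w => (drift s t i w + noise V (l i) s t w) ^+ 2)); last first.
  by apply/funext => w; rewrite /drift subrK.
apply: le_trans h _.
have -> : (2 * MU i + 2 * Lnoise i) * (t - s) =
  2 * ((t - s) * MU i) + 2 * ((t - s) * Lnoise i) by ring.
rewrite lerD2r ler_pM2l// ler_wpM2r ?MU0// expr2 ler_piMl ?subr_ge0//.
by rewrite lerBlDr addrC.
Qed.

Let K := \sum_i (2 * MU i + 2 * Lnoise i).

Let K0 : 0 <= K.
Proof.
apply: sumr_ge0 => i _; rewrite addr_ge0// mulr_ge0//.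
by apply: sumr_ge0 => a _; exact: sqr_ge0.
Qed.

Let Z_incr' s t i : 0 <= s -> s <= t -> t <= s + 1 ->
  Ex P (fun w => (Z t w i 0 - Z s w i 0) ^+ 2) <= K * (t - s).
Proof.
move=> s0 st ts1; apply: le_trans (Z_incr i s0 st ts1) _.
rewrite ler_wpM2r ?subr_ge0// /K (bigD1 i)//= lerDl.
apply: sumr_ge0 => j _; rewrite addr_ge0// mulr_ge0//.
by apply: sumr_ge0 => a _; exact: sqr_ge0.
Qed.

(** Over the step [U] moves by the order of the square root of [t - s]; integrating this over a
    length [t - s] gives a squared error of order [(t - s)^3]. *)
Let drift_rem s t i : 0 <= s -> s <= t -> t <= s + 1 ->
  L2 P (fun w => drift s t i w - (t - s) * U s i w) /\
  Ex P (fun w => (drift s t i w - (t - s) * U s i w) ^+ 2) <=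
    (t - s) ^+ 2 * (C ^+ 2 * (n%:R * (K * (t - s)))).
Proof.
move=> s0 st ts1; have ts0 : 0 <= t - s by rewrite subr_ge0.
pose r m (j : nat) := s + j%:R * ((t - s) / m%:R).
have rb m j : (j < m)%N -> [/\ 0 <= r m j, s <= r m j & r m j <= t].
  move=> jm; have h : 0 <= j%:R * ((t - s) / m%:R) by rewrite mulr_ge0// divr_ge0.
  split; [by rewrite addr_ge0|by rewrite lerDl|].
  rewrite -lerBrDl mulrCA ler_piMr// ler_pdivrMr ?ltr0n ?(leq_ltn_trans _ jm)//.
  by rewrite mul1r ler_nat ltnW.
have c0 : 0 <= C ^+ 2 * (n%:R * (K * (t - s))).
  by rewrite !mulr_ge0// sqr_ge0.
have hF m j : (j < m)%N -> L2 P (fun w => U (r m j) i w - U s i w) /\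
    Ex P (fun w => (U (r m j) i w - U s i w) ^+ 2) <= C ^+ 2 * (n%:R * (K * (t - s))).
  move=> jm; have [r0 sr rt] := rb m j jm; apply: U_incr => // k.
  apply: le_trans (Z_incr' k s0 sr (le_trans rt ts1)) _.
  by rewrite ler_wpM2l// lerD2r.
have hS m := @Ex_sqr_sum_le _ _ _ P m (t - s) _
  (fun j w => U (r m j) i w - U s i w) c0 (hF m).
apply: (fatou_L2 (fun m => (hS m).1) (fun m => (hS m).2)).
  apply: measurable_funB; first exact: drift_measurable.
  by apply: measurable_funM => //; exact: mU.
apply: filterS (drift_riemann i s0 st) => w hw.
have h2 : ((t - s) / m%:R * \sum_(j < m) U (s + j%:R * ((t - s) / m%:R)) i w)
   - (t - s) * U s i w @[m --> \oo] --> drift s t i w - (t - s) * U s i w.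
  by apply: cvgB hw _; exact: cvg_cst.
(* For [m > 0] the mean of [m] copies of [U s] is [U s], so the constant goes under the Riemann sum;
   the empty sum at [m = 0] has to be avoided. *)
apply: cvg_trans h2; apply: near_eq_cvg; near=> m.
have m0 : m%:R != 0 :> R by rewrite pnatr_eq0 -lt0n; near: m; exact: nbhs_infty_gt.
rewrite sumrB mulrBr; congr (_ - _); rewrite sumr_const card_ord -[X in _ = _ * X]mulr_natl mulrA.
by rewrite divfK.
Unshelve. all: by end_near. Qed.

Lemma sde_drifts i : drifts P V (fun s t => drift s t i).
Proof.
exists (MU i + C ^+ 2 * (n%:R * K)).
  by rewrite addr_ge0// mulr_ge0 ?sqr_ge0// mulr_ge0.
have c0 : 0 <= C ^+ 2 * (n%:R * K) by rewrite !mulr_ge0// sqr_ge0.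
move=> s t s0 st ts1; have ts0 : 0 <= t - s by rewrite subr_ge0.
have /choice[Y hY] : forall j, exists Y, adapted V s Y /\ {ae P, forall w, Y w = Z s w j 0}.
  by move=> j; have [Y aY eY] := adapted_version j s0; exists Y.
(* [Z s] agrees with an adapted vector only almost surely, so [u] is evaluated at the versions [Y]
   and the bounds are transferred along the null set. *)
pose u w := beta (\col_j Y j w) i 0.
have au : adapted V s u.
  apply: beta_meas => j; under eq_fun do rewrite mxE; exact: (hY j).1.
have mu : measurable_fun setT u := adapted_measurable V_wiener au.
have ue : {ae P, forall w, U s i w = u w}.
  have F := ae_filter_ringOfSetsType P.
  have := @filter_forall _ _ _ (almost_everywhere P) F (fun j => (hY j).2).
  apply: filterS => w h; rewrite /U /u; congr (beta _ _ _).
  by apply/colP => j; rewrite mxE h.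
exists u; split => //.
- have [lD eD] := drift_L2 i s0 st; split => //.
  by rewrite mulrC (le_trans eD)// ler_wpM2l ?sqr_ge0// lerDl.
- have [lU eU] := U_L2 i s0; have [lu ->] := L2_ae mu ue lU; split => //.
  by rewrite (le_trans eU)// lerDl.
- have [lr er] := drift_rem i s0 st ts1.
  have mr : measurable_fun setT (fun w => drift s t i w - (t - s) * u w).
    apply: measurable_funB; first exact: drift_measurable.
    exact: measurable_funM.
  have re : {ae P, forall w, drift s t i w - (t - s) * U s i w = drift s t i w - (t - s) * u w}.
    by apply: filterS ue => w ->.
  have [l' ->] := L2_ae mr re lr; split => //.
  apply: le_trans er _.
  have -> : (t - s) ^+ 2 * (C ^+ 2 * (n%:R * (K * (t - s)))) =
    C ^+ 2 * (n%:R * K) * (t - s) ^+ 3 by ring.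
  by rewrite ler_wpM2r ?exprn_ge0// lerDr.
Qed.

End lipschitz_sde.

(** * Realized covariance *)

Section realized_covariance.
Context {R : realType} {d : measure_display} {Om : measurableType d}
  (P : probability Om R) (I : finType) (V : I -> R -> Om -> R).
Hypothesis V_wiener : forall i, wiener P (V i).
Hypothesis V_indep : indep_family P (fun i => sigma_process `[0, +oo[ (V i)).
Context {p : nat} (L : 'I_p -> I -> R) (X : R -> Om -> 'cV[R]_p).

Definition residual s t c w := X t w c 0 - X s w c 0 - noise V (L c) s t w.

Hypothesis X_drifts : forall c, drifts P V (fun s t => residual s t c).

(** The coefficient matrix of the product of two noise forms, symmetrized because the variance
    formula for quadratic forms requires symmetry. *)
Definition cov_form (c e : 'I_p) (a b : I) : R :=
  (L c a * L e b + L c b * L e a) / 2.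

Lemma cov_form_sym c e a b : cov_form c e a b = cov_form c e b a.
Proof. by rewrite /cov_form addrC. Qed.

Lemma noise_mul c e s t w : s < t ->
  noise V (L c) s t w * noise V (L e) s t w =
  (t - s) * (\sum_a L c a * L e a + quad V s t (cov_form c e) w).
Proof.
move=> st; rewrite !noise_xi// mulrACA -expr2 sqr_sqrtr ?subr_ge0 ?(ltW st)//.
congr (_ * _); pose x a := xi V s t a w.
have e1 : (\sum_a L c a * x a) * (\sum_a L e a * x a) =
    \sum_a \sum_b L c a * L e b * (x a * x b).
  by rewrite mulr_suml; apply: eq_bigr => a _; rewrite mulr_sumr;
    apply: eq_bigr => b _; ring.
have e2 : \sum_a \sum_b L c b * L e a * (x a * x b) =
    \sum_a \sum_b L c a * L e b * (x a * x b).
  by rewrite exchange_big; apply: eq_bigr => a _; apply: eq_bigr => b _; ring.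
have e3 : \sum_a \sum_b cov_form c e a b * (a == b)%:R = \sum_a L c a * L e a.
  apply: eq_bigr => a _; rewrite (bigD1 a)//= big1 ?addr0 => [|b ba].
    by rewrite eqxx mulr1 /cov_form; field.
  by rewrite eq_sym (negbTE ba) mulr0.
have -> : quad V s t (cov_form c e) w =
    \sum_a \sum_b cov_form c e a b * (x a * x b) - \sum_a L c a * L e a.
  rewrite -e3 -sumrB; apply: eq_bigr => a _; rewrite -sumrB.
  by apply: eq_bigr => b _; rewrite mulrBr.
rewrite addrCA subrr addr0 e1.
have -> : \sum_a \sum_b cov_form c e a b * (x a * x b) =
    2^-1 * (\sum_a \sum_b L c a * L e b * (x a * x b)
      + \sum_a \sum_b L c b * L e a * (x a * x b)).
  rewrite -big_split mulr_sumr; apply: eq_bigr => a _.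
  rewrite -big_split mulr_sumr; apply: eq_bigr => b _ /=.
  by rewrite /cov_form; field.
rewrite e2; set S := \sum_a _; by field.
Qed.

Definition main_term h n c e w : R :=
  n%:R^-1 * \sum_(i < n) quad V (i%:R * h) (i.+1%:R * h) (cov_form c e) w.

Let ell := \sum_c \sum_a L c a ^+ 2.

Let ell_ge c : \sum_a L c a ^+ 2 <= ell.
Proof.
rewrite /ell (bigD1 c)//= lerDl; apply: sumr_ge0 => e _.
by apply: sumr_ge0 => a _; exact: sqr_ge0.
Qed.

Let ell0 : 0 <= ell.
Proof. by apply: sumr_ge0 => e _; apply: sumr_ge0 => a _; exact: sqr_ge0. Qed.

Let mul_le (x y h : R) : 0 < h -> `|x * y| <= (h * x ^+ 2 + h^-1 * y ^+ 2) / 2.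
Proof.
move=> h0; rewrite normrM.
rewrite -[x ^+ 2]real_normK ?num_real// -[y ^+ 2]real_normK ?num_real//.
set a := `|x|; set b := `|y|.
have := mulr_ge0 (ltW h0) (sqr_ge0 (a - h^-1 * b)).
have -> : h * (a - h^-1 * b) ^+ 2 = h * a ^+ 2 + h^-1 * b ^+ 2 - 2 * (a * b).
  by field; rewrite gt_eqF.
by lra.
Qed.

(** The weight [h] balances a noise increment, with second moment of order [h], against a drift
    remainder, with second moment of order [h^3]: both terms become of order [h^2]. *)
Let Ex_mul_le (x y : Om -> R) h a b : 0 < h -> L2 P x -> L2 P y ->
  Ex P (fun w => x w ^+ 2) <= a -> Ex P (fun w => y w ^+ 2) <= b ->
  L1 P (fun w => x w * y w) /\ Ex P (fun w => `|x w * y w|) <= (h * a + h^-1 * b) / 2.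
Proof.
move=> h0 lx ly xa yb; have lxy := L2_mul lx ly; split => //.
have l1 : L1 P (fun w => h * x w ^+ 2) by apply: L1Zl; exact: lx.2.
have l2 : L1 P (fun w => h^-1 * y w ^+ 2) by apply: L1Zl; exact: ly.2.
have l12 : L1 P (fun w => 2^-1 * (h * x w ^+ 2 + h^-1 * y w ^+ 2)).
  by apply: L1Zl; exact: L1D.
apply: (@le_trans _ _ (Ex P (fun w => 2^-1 * (h * x w ^+ 2 + h^-1 * y w ^+ 2)))).
  apply: Ex_le => [| |w]; [exact: L1_norm|exact: l12|].
  by rewrite [leRHS]mulrC; exact: mul_le.
rewrite ExZl; last exact: L1D.
rewrite ExD// ExZl; last exact: lx.2.
rewrite ExZl; last exact: ly.2.
by rewrite mulrC ler_pM2r// lerD// ler_pM2l// invr_gt0.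
Qed.

(* [A] collects the products of a noise increment with the predictable part of a
   drift: they are martingale differences, hence orthogonal over the grid.  All
   other remainders are absolutely small and go into [B]. *)
Lemma realized_cov_decomp : exists2 K, 0 <= K &
  forall h n, 0 < h -> h <= 1 -> (0 < n)%N -> forall c e, exists A B : Om -> R,
  [/\ L2 P A /\ Ex P (fun w => A w ^+ 2) <= K * (h / n%:R),
      L1 P B /\ Ex P (fun w => `|B w|) <= K * h &
      forall w, realized_cov h n (X ^~ w) c e =
        \sum_a L c a * L e a + main_term h n c e w + A w + B w].
Proof.
have /choice[k hk] : forall c, exists k, 0 <= k /\ forall s t, 0 <= s -> s <= t ->
    t <= s + 1 -> exists u, drift_bound P V s t k (residual s t c) u.
  by move=> c; have [k k0 h] := X_drifts c; exists k.
pose k' := \sum_c k c.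
have kk c : k c <= k'.
  by rewrite /k' (bigD1 c)//= lerDl; apply: sumr_ge0 => e _; exact: (hk e).1.
have k0 : 0 <= k' by apply: sumr_ge0 => c _; exact: (hk c).1.
(* The first summand serves [A], a sum of two martingale terms of size [ell * k']; the second serves
   [B], two mixed terms of size [(ell + k') / 2] and one drift product of size [k']. *)
exists (4 * (ell * k') + (ell + 2 * k')) => [|h n h0 h1 n0 c e].
  by rewrite !addr_ge0 ?mulr_ge0.
pose s (i : nat) := i%:R * h.
have s0 i : 0 <= s i by rewrite mulr_ge0// ltW.
have ds i : s i.+1 - s i = h by rewrite /s -natr1 mulrDl mul1r addrAC subrr add0r.
have ss i : s i < s i.+1 by rewrite -subr_gt0 ds.
have s1 i : s i.+1 <= s i + 1 by rewrite -lerBlDl ds.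
have /choice[u hu] : forall x : nat * 'I_p, exists u,
    drift_bound P V (s x.1) (s x.1.+1) (k x.2) (residual (s x.1) (s x.1.+1) x.2) u.
  by move=> [i b] /=; exact: (hk b).2 _ _ (s0 i) (ltW (ss i)) (s1 i).
pose G i b := noise V (L b) (s i) (s i.+1).
pose D i b := residual (s i) (s i.+1) b.
have nn : n%:R != 0 :> R by rewrite pnatr_eq0 -lt0n.
have np : 0 < n%:R :> R by rewrite ltr0n.
have sG i b : step_fun V (s i) (s i.+1) (G i b) by exact: noise_step.
have lG i b : L2 P (G i b) by have [] := noise_moments V_wiener V_indep (L b) (s0 i) (ltW (ss i)).
have EG i b : Ex P (G i b) = 0.
  by have [] := noise_moments V_wiener V_indep (L b) (s0 i) (ltW (ss i)).
have EG2 i b : Ex P (fun w => G i b w ^+ 2) = h * \sum_a L b a ^+ 2.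
  by have [_ _ ->] := noise_moments V_wiener V_indep (L b) (s0 i) (ltW (ss i)); rewrite ds.
have EG2' i b : Ex P (fun w => G i b w ^+ 2) <= h * ell.
  by rewrite EG2 ler_wpM2l// ltW.
have lu i b : L2 P (u (i, b)) by have [_ []] := hu (i, b).
have eu i b : Ex P (fun w => u (i, b) w ^+ 2) <= k'.
  by have [_ [_ h'] _ _] := hu (i, b); exact: le_trans h' (kk b).
have au i b : adapted V (s i) (u (i, b)) by have [_ _] := hu (i, b).
have lD i b : L2 P (D i b) by have [[]] := hu (i, b).
have eD i b : Ex P (fun w => D i b w ^+ 2) <= k' * h ^+ 2.
  have [[_ h'] _ _ _] := hu (i, b); apply: le_trans h' _.
  by rewrite /= ds ler_wpM2r ?sqr_ge0.
have lr i b : L2 P (fun w => D i b w - h * u (i, b) w).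
  by have [_ _ _ []] := hu (i, b); rewrite /= ds.
have er i b : Ex P (fun w => (D i b w - h * u (i, b) w) ^+ 2) <= k' * h ^+ 3.
  have [_ _ _ []] := hu (i, b); rewrite /= ds => _ h'; apply: le_trans h' _.
  by rewrite ler_wpM2r// exprn_ge0// ltW.
have mart b b' : L2 P (fun w => n%:R^-1 * \sum_(i < n) u (nat_of_ord i, b') w * G i b w) /\
    Ex P (fun w => (n%:R^-1 * \sum_(i < n) u (nat_of_ord i, b') w * G i b w) ^+ 2) <=
    ell * k' * (h / n%:R).
  have [lS eS] := @martingale_sum _ _ _ P _ V V_wiener V_indep h h0
    (fun i => u (i, b')) (fun i => G i b) (h * \sum_a L b a ^+ 2) n
    (fun i => au i b') (fun i => sG i b) (fun i => lu i b')
    (fun i => lG i b) (fun i => EG i b) (fun i => EG2 i b).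
  have eS' : Ex P (fun w => (\sum_(i < n) u (nat_of_ord i, b') w * G i b w) ^+ 2) <=
      h * ell * (n%:R * k').
    rewrite eS; apply: ler_pM.
    - by rewrite mulr_ge0 ?(ltW h0)//; apply: sumr_ge0 => a _; exact: sqr_ge0.
    - by apply: sumr_ge0 => i _; apply: Ex_ge0 => w; exact: sqr_ge0.
    - by rewrite ler_wpM2l// ltW.
    - apply: (@le_trans _ _ (\sum_(i < n) k')); first by apply: ler_sum => i _.
      by rewrite sumr_const card_ord mulr_natl.
  have [l' e'] := L2_sqrZ_le n%:R^-1 lS eS'; split => //.
  apply: le_trans e' _; rewrite le_eqVlt; apply/orP; left; apply/eqP.
  by field.
(* The factor [h] of the predictable drift [h * u] cancels the [h] in the normalization
   [(n h)^-1]. *)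
pose A w := n%:R^-1 * (\sum_(i < n) u (nat_of_ord i, e) w * G i c w) +
  n%:R^-1 * (\sum_(i < n) u (nat_of_ord i, c) w * G i e w).
pose Bt i w := G i c w * (D i e w - h * u (i, e) w)
  + G i e w * (D i c w - h * u (i, c) w) + D i c w * D i e w.
pose B w := (n%:R * h)^-1 * \sum_(i < n) Bt i w.
exists A, B; split.
- have [l1 e1] := mart c e; have [l2 e2] := mart e c.
  have [l e'] := L2_sqrD_le l1 l2 e1 e2; split => //; apply: le_trans e' _.
  have hn : 0 <= h / n%:R by rewrite divr_ge0// ltW.
  have -> : 2 * (ell * k' * (h / n%:R)) + 2 * (ell * k' * (h / n%:R)) =
    4 * (ell * k') * (h / n%:R) by ring.
  by rewrite ler_wpM2r// lerDl addr_ge0// mulr_ge0.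
- have b1 i b b' : L1 P (fun w => G i b w * (D i b' w - h * u (i, b') w)) /\
      Ex P (fun w => `|G i b w * (D i b' w - h * u (i, b') w)|) <= (ell + k') / 2 * h ^+ 2.
    have [l' e'] := Ex_mul_le h0 (lG i b) (lr i b') (EG2' i b) (er i b'); split => //.
    apply: le_trans e' _; rewrite le_eqVlt; apply/orP; left; apply/eqP.
    by field; rewrite gt_eqF.
  have b2 i : L1 P (fun w => D i c w * D i e w) /\
      Ex P (fun w => `|D i c w * D i e w|) <= k' * h ^+ 2.
    have [l' e'] := Ex_mul_le ltr01 (lD i c) (lD i e) (eD i c) (eD i e); split => //.
    apply: le_trans e' _; rewrite le_eqVlt; apply/orP; left; apply/eqP.
    by field.
  have bt i : L1 P (Bt i) /\ Ex P (fun w => `|Bt i w|) <= (ell + 2 * k') * h ^+ 2.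
    have [l1 e1] := b1 i c e; have [l2 e2] := b1 i e c; have [l3 e3] := b2 i.
    have lB : L1 P (Bt i) by apply: L1D => //; exact: L1D.
    split => //; have n1 := L1_norm l1; have n2 := L1_norm l2; have n3 := L1_norm l3.
    have n12 := L1D n1 n2.
    apply: le_trans (Ex_le (L1_norm lB) (L1D n12 n3) _) _.
      by move=> w; apply: le_trans (ler_normD _ _) _; rewrite lerD2r ler_normD.
    rewrite ExD// ExD//; apply: le_trans (lerD (lerD e1 e2) e3) _.
    by rewrite le_eqVlt; apply/orP; left; apply/eqP; field.
  have lS : L1 P (fun w => \sum_(i < n) Bt i w) by apply: L1_sum => i _; exact: (bt i).1.
  have lB : L1 P B by exact: L1Zl.
  split => //; have nh0 : 0 <= (n%:R * h)^-1 by rewrite invr_ge0 mulr_ge0// ltW.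
  have lN : L1 P (fun w => \sum_(i < n) `|Bt i w|).
    by apply: L1_sum => i _; apply: L1_norm; exact: (bt i).1.
  apply: (@le_trans _ _ (Ex P (fun w => (n%:R * h)^-1 * \sum_(i < n) `|Bt i w|))).
    apply: Ex_le => [| |w]; [exact: L1_norm|exact: L1Zl|].
    by rewrite /B normrM ger0_norm// ler_wpM2l// ler_norm_sum.
  rewrite ExZl// Ex_sum => [|i _]; last by apply: L1_norm; exact: (bt i).1.
  apply: (@le_trans _ _ ((n%:R * h)^-1 * \sum_(i < n) (ell + 2 * k') * h ^+ 2)).
    by rewrite ler_wpM2l//; apply: ler_sum => i _; exact: (bt i).2.
  rewrite sumr_const card_ord -[X in _ * X]mulr_natl.
  have -> : (n%:R * h)^-1 * (n%:R * ((ell + 2 * k') * h ^+ 2)) = (ell + 2 * k') * h.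
    by field; rewrite gt_eqF.
  by rewrite ler_wpM2r ?(ltW h0)// lerDr !mulr_ge0.
- move=> w.
  have -> : realized_cov h n (X ^~ w) c e = (n%:R * h)^-1 *
      \sum_(i < n) (X (s i.+1) w c 0 - X (s i) w c 0) * (X (s i.+1) w e 0 - X (s i) w e 0).
    rewrite /realized_cov mxE; congr (_ * _); rewrite summxE; apply: eq_bigr => i _.
    by rewrite mxE big_ord1 !mxE.
  have Xi i b : X (s i.+1) w b 0 - X (s i) w b 0 = G i b w + D i b w.
    by rewrite /D /residual [RHS]addrC subrK.
  have GG i : G i c w * G i e w = h * (\sum_a L c a * L e a
      + quad V (s i) (s i.+1) (cov_form c e) w).
    by rewrite noise_mul// ds.
  under eq_bigr do rewrite !Xi.
  pose S0 := \sum_a L c a * L e a.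
  pose q i := quad V (s i) (s i.+1) (cov_form c e) w.
  have alg (g1 g2 d1 d2 u1 u2 k1 k2 : R) : g1 * g2 = h * (k1 + k2) ->
      (g1 + d1) * (g2 + d2) = h * k1 + h * k2 + h * (u2 * g1) + h * (u1 * g2) +
      (g1 * (d2 - h * u2) + g2 * (d1 - h * u1) + d1 * d2).
    by move=> eg; rewrite mulrDl (mulrDr g1) eg; ring.
  have expand (x : R) (y : nat -> R) : (forall i, G i c w * G i e w = h * (x + y i)) ->
      \sum_(i < n) (G i c w + D i c w) * (G i e w + D i e w) =
      h * (n%:R * x) + h * (\sum_(i < n) y i) +
      h * (\sum_(i < n) u (nat_of_ord i, e) w * G i c w) +
      h * (\sum_(i < n) u (nat_of_ord i, c) w * G i e w) + \sum_(i < n) Bt i w.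
    move=> xy; have -> : n%:R * x = \sum_(i < n) x by rewrite sumr_const card_ord mulr_natl.
    rewrite !mulr_sumr -!big_split; apply: eq_bigr => i _ /=.
    exact: alg (xy i).
  rewrite (expand S0 q GG).
  rewrite /main_term /A /B -/S0; set Q := \sum_(i < n) q i.
  by field; rewrite nn gt_eqF.
Qed.

End realized_covariance.

(** * Convergence in probability *)

Section stochastic_order.
Context {R : realType} {d : measure_display} {Om : measurableType d}
  (P : probability Om R).
Implicit Types X Y : nat -> Om -> R.

(* Measurability is only required for large n, where the step lies in (0, 1]. *)
Definition to0 X := forall e e' : R, 0 < e -> 0 < e' -> \forall n \near \oo,
  measurable_fun setT (X n) /\ (P [set w | (e <= `|X n w|)%R] <= e'%:E)%E.

Definition tight X := forall e : R, 0 < e -> exists2 L : R, 0 < L &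
  \forall n \near \oo,
    measurable_fun setT (X n) /\ (P [set w | (L <= `|X n w|)%R] <= e%:E)%E.

Let mset (X : Om -> R) (e : R) : measurable_fun setT X ->
  measurable [set w | e <= `|X w|].
Proof.
move=> mX; rewrite -[X in measurable X]setTI.
by apply: measurable_fun_le => //; exact: measurableT_comp.
Qed.

Lemma prob_le_2 (A B C : set Om) (a b : R) : measurable A -> measurable B ->
  measurable C -> A `<=` B `|` C -> (P B <= a%:E)%E -> (P C <= b%:E)%E ->
  (P A <= (a + b)%:E)%E.
Proof.
move=> mA mB mC ABC Ba Cb.
apply: (@le_trans _ _ (P (B `|` C))).
  by apply: le_measure => //; rewrite inE//; exact: measurableU.
apply: (le_trans (@measureU2 _ _ _ P B C mB mC)).
by rewrite EFinD; exact: leeD.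
Qed.

Let setD (X Y : Om -> R) (a b : R) :
  [set w | a + b <= `|X w + Y w|] `<=` [set w | a <= `|X w|] `|` [set w | b <= `|Y w|].
Proof.
move=> w /= h; have [|xa] := leP a `|X w|; first by left.
have [|yb] := leP b `|Y w|; first by right.
by have := ler_normD (X w) (Y w); lra.
Qed.

Lemma to0D X Y : to0 X -> to0 Y -> to0 (fun n w => X n w + Y n w).
Proof.
move=> hX hY e e' e0 e'0.
have e2 : 0 < e / 2 by rewrite divr_gt0.
have e'2 : 0 < e' / 2 by rewrite divr_gt0.
apply: filterS2 (hX _ _ e2 e'2) (hY _ _ e2 e'2) => n [mX pX] [mY pY].
have mXY : measurable_fun setT (fun w => X n w + Y n w) by exact: measurable_funD.
split => //; rewrite (splitr e').
apply: (prob_le_2 (mset _ mXY) (mset _ mX) (mset _ mY) _ pX pY).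
by rewrite [in X in X `<=` _](splitr e); exact: setD.
Qed.

Lemma tightD X Y : tight X -> tight Y -> tight (fun n w => X n w + Y n w).
Proof.
move=> hX hY e e0; have e2 : 0 < e / 2 by rewrite divr_gt0.
have [K K0 hK] := hX _ e2; have [L L0 hL] := hY _ e2.
exists (K + L); first exact: addr_gt0.
apply: filterS2 hK hL => n [mX pX] [mY pY].
have mXY : measurable_fun setT (fun w => X n w + Y n w) by exact: measurable_funD.
split => //; rewrite (splitr e).
apply: (prob_le_2 (mset _ mXY) (mset _ mX) (mset _ mY) _ pX pY).
exact: setD.
Qed.

Lemma to0_tight X : to0 X -> tight X.
Proof. by move=> hX e e0; exists 1 => //; exact: hX. Qed.

Lemma to0_cst0 : to0 (fun _ _ => 0).
Proof.
move=> e e' e0 e'0; apply: nearW => n; split => //.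
rewrite (_ : [set w | _] = set0) ?measure0 ?lee_fin ?(ltW e'0)//.
by apply/seteqP; split => // w /=; rewrite normr0 leNgt e0.
Qed.

Lemma to0Z a X : to0 X -> to0 (fun n w => a * X n w).
Proof.
move=> hX; have [->|a0] := eqVneq a 0.
  by under eq_fun do under eq_fun do rewrite mul0r; exact: to0_cst0.
have an : 0 < `|a| by rewrite normr_gt0.
move=> e e' e0 e'0.
have ea : 0 < e / `|a| by rewrite divr_gt0.
apply: filterS (hX _ _ ea e'0) => n [mX pX]; split; first exact: measurable_funM.
rewrite (_ : [set w | _] = [set w | e / `|a| <= `|X n w|])//.
by apply/seteqP; split => w /=; rewrite normrM ler_pdivrMr// mulrC.
Qed.

Lemma tightZ a X : tight X -> tight (fun n w => a * X n w).
Proof.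
move=> hX e e0; have [L L0 hL] := hX e e0.
have an : 0 < `|a| + 1 by rewrite ltr_wpDl.
exists ((`|a| + 1) * L); first exact: mulr_gt0.
apply: filterS hL => n [mX pX].
have maX : measurable_fun setT (fun w => a * X n w) by exact: measurable_funM.
split => //; apply: le_trans pX; apply: le_measure; rewrite ?inE; [exact: mset|exact: mset|].
move=> w /=; rewrite normrM => h.
by rewrite -(ler_pM2l an) (le_trans h)// ler_wpM2r// lerDl ler01.
Qed.

Lemma to0_sum I (r : seq I) (X : I -> nat -> Om -> R) : (forall i, to0 (X i)) ->
  to0 (fun n w => \sum_(i <- r) X i n w).
Proof.
move=> hX; elim: r => [|i r IH].
  by under eq_fun do under eq_fun do rewrite big_nil; exact: to0_cst0.
by under eq_fun do under eq_fun do rewrite big_cons; exact: to0D.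
Qed.

Lemma tight_sum I (r : seq I) (X : I -> nat -> Om -> R) : (forall i, tight (X i)) ->
  tight (fun n w => \sum_(i <- r) X i n w).
Proof.
move=> hX; elim: r => [|i r IH].
  by under eq_fun do under eq_fun do rewrite big_nil; exact/to0_tight/to0_cst0.
by under eq_fun do under eq_fun do rewrite big_cons; exact: tightD.
Qed.

Lemma to0_L2 X (a : nat -> R) : a n @[n --> \oo] --> 0 ->
  (\forall n \near \oo, L2 P (X n) /\ Ex P (fun w => X n w ^+ 2) <= a n) -> to0 X.
Proof.
move=> a0 hX e e' e0 e'0.
have ee : 0 < e' * e ^+ 2 by rewrite mulr_gt0// exprn_gt0.
have /cvgrPdist_lt/(_ _ ee) ha := a0.
apply: filterS2 hX ha => n [lX eX] an; split; first exact: lX.1.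
apply: le_trans (markov_L2 e0 lX) _; rewrite lee_fin ler_pdivrMr ?exprn_gt0//.
apply: le_trans eX _; move: an; rewrite sub0r normrN => /ltW; apply: le_trans.
exact: ler_norm.
Qed.

Lemma to0_L1 X (a : nat -> R) : a n @[n --> \oo] --> 0 ->
  (\forall n \near \oo, L1 P (X n) /\ Ex P (fun w => `|X n w|) <= a n) -> to0 X.
Proof.
move=> a0 hX e e' e0 e'0.
have ee : 0 < e' * e by rewrite mulr_gt0.
have /cvgrPdist_lt/(_ _ ee) ha := a0.
apply: filterS2 hX ha => n [lX eX] an; split; first exact: L1_measurable lX.
apply: le_trans (markov_L1 e0 lX) _; rewrite lee_fin ler_pdivrMr//.
apply: le_trans eX _; move: an; rewrite sub0r normrN => /ltW; apply: le_trans.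
exact: ler_norm.
Qed.

Lemma tight_L2 X (K : R) :
  (\forall n \near \oo, L2 P (X n) /\ Ex P (fun w => X n w ^+ 2) <= K) -> tight X.
Proof.
move=> hX e e0; have K1 : 0 < `|K| + 1 by rewrite ltr_wpDl.
have L2' : 0 < (`|K| + 1) / e by rewrite divr_gt0.
exists (Num.sqrt ((`|K| + 1) / e)); first by rewrite sqrtr_gt0.
apply: filterS hX => n [lX eX]; split; first exact: lX.1.
have s0 : 0 < Num.sqrt ((`|K| + 1) / e) by rewrite sqrtr_gt0.
apply: le_trans (markov_L2 s0 lX) _.
rewrite lee_fin sqr_sqrtr; last exact: ltW.
rewrite ler_pdivrMr// mulrC divfK ?gt_eqF//.
by apply: le_trans eX _; rewrite (le_trans (ler_norm _))// lerDl.
Qed.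

Lemma to0_ext X Y : (\forall n \near \oo, forall w, X n w = Y n w) -> to0 X -> to0 Y.
Proof.
move=> XY hX e e' e0 e'0; apply: filterS2 XY (hX _ _ e0 e'0) => n XY.
by rewrite (_ : X n = Y n)//; exact/funext.
Qed.

(* If Y is tight and X is small compared with Y off an event of vanishing
   probability, then X vanishes in probability. *)
Lemma to0_small X Y (Z : nat -> Om -> R) : (\forall n \near \oo, measurable_fun setT (X n)) ->
  tight Y -> to0 Z ->
  (forall eps, 0 < eps -> exists2 delta, 0 < delta &
     forall n w, `|Z n w| < delta -> `|X n w| <= eps * `|Y n w|) -> to0 X.
Proof.
move=> mX hY hZ small e e' e0 e'0.
have e'2 : 0 < e' / 2 by rewrite divr_gt0.
have [L L0 hL] := hY _ e'2.
have eL : 0 < e / 2 / L by rewrite !divr_gt0.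
have [del d0 hd] := small _ eL.
apply: filterS3 mX hL (hZ _ _ d0 e'2) => n mXn [mY pY] [mZ pZ]; split => //.
rewrite (splitr e'); apply: (prob_le_2 (mset _ mXn) (mset _ mY) (mset _ mZ) _ pY pZ).
move=> w /= h; have [|yL] := leP L `|Y n w|; first by left.
have [|zd] := leP del `|Z n w|; first by right.
have := hd n w zd; rewrite leNgt => /negP[].
apply: lt_le_trans h; apply: (@lt_trans _ _ (e / 2)); last first.
  by rewrite ltr_pdivrMr// mulr_natr mulr2n ltrDl.
by rewrite mulrAC ltr_pdivrMr// ltr_pM2l// divr_gt0.
Qed.

(** Used to pass from the squared norm of a vector to its coordinates. *)
Lemma to0_dom X Y : (\forall n \near \oo, measurable_fun setT (X n)) ->
  (forall n w, X n w ^+ 2 <= `|Y n w|) -> to0 Y -> to0 X.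
Proof.
move=> mX XY hY e e' e0 e'0; have e2 : 0 < e ^+ 2 by rewrite exprn_gt0.
apply: filterS2 mX (hY _ _ e2 e'0) => n mXn [mY pY]; split => //.
apply: le_trans pY; apply: le_measure; rewrite ?inE; [exact: mset|exact: mset|].
move=> w /= h; apply: le_trans (XY n w).
by rewrite -[leRHS]real_normK ?num_real// lerXn2r// ?nnegrE// ltW.
Qed.

Lemma tight_sqr X : tight X -> tight (fun n w => X n w ^+ 2).
Proof.
move=> hX e e0; have [L L0 hL] := hX e e0.
exists (L ^+ 2); first by rewrite exprn_gt0.
apply: filterS hL => n [mX pX]; split; first exact: measurable_funX.
apply: le_trans pX; apply: le_measure; rewrite ?inE.
- by apply: mset; exact: measurable_funX.
- exact: mset.
- by move=> w /=; rewrite normrX ler_pXn2r ?nnegrE ?(ltW L0).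
Qed.

Lemma to0_sqr X : to0 X -> to0 (fun n w => X n w ^+ 2).
Proof.
move=> hX e e' e0 e'0; have se : 0 < Num.sqrt e by rewrite sqrtr_gt0.
apply: filterS (hX _ _ se e'0) => n [mX pX]; split; first exact: measurable_funX.
apply: le_trans pX; apply: le_measure; rewrite ?inE.
- by apply: mset; exact: measurable_funX.
- exact: mset.
- move=> w /=; rewrite normrX => h.
  rewrite -(@ler_pXn2r _ 2)// ?nnegrE ?(ltW se)// sqr_sqrtr//; exact: ltW.
Qed.

(** The cosine is 1-Lipschitz where the arguments are close and bounded by 1 on the rare event where
    they are not. *)
Lemma cos_to0 (X Y : nat -> Om -> R) : (forall n, measurable_fun setT (Y n)) ->
  (\forall n \near \oo, measurable_fun setT (X n)) ->
  to0 (fun n w => Y n w - X n w) ->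
  Ex P (fun w => cos (Y n w)) - Ex P (fun w => cos (X n w)) @[n --> \oo] --> 0.
Proof.
move=> mY mX XY; apply/cvgrPdist_le => e e0.
have e2 : 0 < e / 2 by rewrite divr_gt0.
have e4 : 0 < e / 4 by rewrite divr_gt0.
apply: filterS2 mX (XY _ _ e2 e4) => n mXn [mD pD].
rewrite sub0r normrN.
have lY := L1_cos P (mY n); have lX := L1_cos P mXn.
rewrite -ExB//; apply: le_trans (Ex_norm (L1B lY lX)) _.
set B := [set w | _] in pD; have mB : measurable B := mset _ mD.
have lB : L1 P (\1_B : Om -> R).
  apply: (@L1_bounded _ _ _ _ _ 1) => [|w]; first exact: measurable_indic.
  by rewrite indicE; case: (_ \in _); rewrite ?normr1 ?normr0.
have lE : L1 P (fun w => e / 2 + 2 * \1_B w) by apply: L1D; [exact: L1_cst|exact: L1Zl].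
apply: (@le_trans _ _ (Ex P (fun w => e / 2 + 2 * \1_B w))).
  apply: Ex_le => //; first exact: L1_norm (L1B lY lX).
  move=> w; rewrite indicE; case: (boolP (w \in B)) => [_|].
    rewrite mulr1 (le_trans (ler_normB _ _))// ler_wpDl ?(ltW e2)//.
    by rewrite -[leRHS]/(1 + 1) lerD// cos_max.
  rewrite notin_setE /B /= => /negP; rewrite -ltNge => h.
  by rewrite mulr0 addr0 (le_trans (cos_lip _ _))// ltW.
rewrite ExD; [|exact: L1_cst|exact: L1Zl].
rewrite Ex_cst ExZl//.
have : Ex P \1_B <= e / 4 by rewrite -lee_fin -integral_Ex// integral_indic// setIT.
by lra.
Qed.

End stochastic_order.

(** * Factor and error noises as one Wiener family *)

Section merged_noise.
Context {R : realType} {d : measure_display} {Om : measurableType d}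
  (P : probability Om R) {r p : nat} (W : R -> Om -> 'cV[R]_r)
  (B : 'I_p -> R -> Om -> R).
Hypothesis W_wiener : wiener_vec P W.
Hypothesis B_wiener : forall i, wiener P (B i).
Hypothesis W_B : indep_family P (fun o : option 'I_p =>
  if o is Some i then sigma_process `[0, +oo[ (B i)
  else sigma_process (E := borel R r) `[0, +oo[ W).

Definition merged t w : 'cV[R]_(r + p) := col_mx (W t w) (\col_i B i t w).

Definition merged_coord (a : 'I_(r + p)) t w := merged t w a 0.

Let coordl j : merged_coord (lshift p j) = (fun t w => W t w j 0).
Proof. by apply/funext => t; apply/funext => w; rewrite /merged_coord /merged col_mxEu. Qed.

Let coordr i : merged_coord (rshift r i) = B i.
Proof. by apply/funext => t; apply/funext => w; rewrite /merged_coord /merged col_mxEd mxE. Qed.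

Lemma merged_wiener a : wiener P (merged_coord a).
Proof.
by case: (split_ordP a) => [j ->|i ->]; rewrite ?coordl ?coordr//; exact: W_wiener.1.
Qed.

Let coord_sub j : sigma_process `[0, +oo[ (fun t w => W t w j 0) `<=`
  sigma_process (E := borel R r) `[0, +oo[ W.
Proof.
apply: smallest_sub; first exact: smallest_sigma_algebra.
move=> _ [t t0 [A mA <-]]; apply: sub_sigma_algebra; exists t => //.
exists ((fun x : borel R r => x j 0) @^-1` A) => //.
apply: measurable_preim => //; apply: continuous_borel_measurable => x.
exact: coord_continuous.
Qed.

(** All events about coordinates of [W] are gathered into one event [E] of the vector process.
    Independence of [W] from the [B i] splits off [E], and independence of the coordinates of [W]
    factors it. *)
Lemma merged_indep :
  indep_family P (fun a => sigma_process `[0, +oo[ (merged_coord a)).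
Proof.
move=> J A hA.
pose J1 := [set j | lshift p j \in J]%SET; pose J2 := [set i | rshift r i \in J]%SET.
pose E := \bigcap_(j in [set` J1]) A (lshift p j).
have hA1 j : j \in J1 -> sigma_process `[0, +oo[ (fun t w => W t w j 0) (A (lshift p j)).
  by rewrite inE => /hA; rewrite coordl.
have hA2 i : i \in J2 -> sigma_process `[0, +oo[ (B i) (A (rshift r i)).
  by rewrite inE => /hA; rewrite coordr.
have hE : sigma_process (E := borel R r) `[0, +oo[ W E.
  apply: (@fin_bigcap_measurable _ (g_sigma_algebraType _)) => //.
  by move=> j /= jJ; apply: coord_sub; exact: hA1.
pose A' (o : option 'I_p) := if o is Some i then A (rshift r i) else E.
have -> : \bigcap_(a in [set` J]) A a =
    \bigcap_(o in [set` (None |: (Some @: J2))%SET]) A' o.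
  apply/seteqP; split => [w h [i|] /= |w h a /= aJ].
  - rewrite !inE /= => /imsetP[i' + [->]]; rewrite inE => iJ; exact: h.
  - by move=> _ j /=; rewrite inE; exact: h.
  - case: (split_ordP a) aJ => [j ->|i ->] aJ.
      by have := h None; rewrite /= !inE eqxx /= => /(_ isT) /(_ j); apply; rewrite /= inE.
    have := h (Some i); apply; rewrite /= !inE /=; apply/imsetP; exists i => //.
    by rewrite inE.
rewrite W_B; last first.
  move=> [i|]; rewrite ?inE //= => /imsetP[i' i'J [->]]; exact: hA2.
rewrite big_setU1 ?big_imset /=; last 2 first.
- by move=> x y _ _ [].
- by apply/imsetP => -[].
rewrite W_wiener.2//.
rewrite [RHS]big_mkcond /= big_split_ord /=; congr (_ * _)%E.
- by rewrite big_mkcond /=; apply: eq_bigr => j _; rewrite inE.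
- by rewrite big_mkcond /=; apply: eq_bigr => j _; rewrite inE.
Qed.

End merged_noise.

(** * The observed process *)

Section observed_process.
Context {R : realType} {d : measure_display} {Om : measurableType d}
  (P : probability Om R).

Lemma enorm_sq n (u : 'cV[R]_n) : enorm u ^+ 2 = sq u.
Proof. by rewrite sqr_sqrtr// sq_ge0. Qed.

Lemma mxnorm_enorm n (u : 'cV[R]_n) : `|u| <= enorm u.
Proof.
by rewrite -(@ler_pXn2r _ 2)// ?nnegrE ?sqrtr_ge0// enorm_sq mxnorm_sq.
Qed.

Lemma enorm_mxnorm n (u : 'cV[R]_n) : enorm u <= Num.sqrt n%:R * `|u|.
Proof.
rewrite -(@ler_pXn2r _ 2)// ?nnegrE ?sqrtr_ge0 ?mulr_ge0 ?sqrtr_ge0//.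
by rewrite enorm_sq exprMn sqr_sqrtr// sq_mxnorm.
Qed.

Lemma moments_L2 n (Z : R -> Om -> 'cV[R]_n) :
  (forall t, 0 <= t -> measurable_fun setT (Z t : Om -> borel R n)) ->
  bounded_moments P Z -> exists M : R, forall t i, 0 <= t ->
  L2 P (fun w => Z t w i 0) /\ Ex P (fun w => Z t w i 0 ^+ 2) <= M.
Proof.
move=> mZ /(_ 2 (ler0n _ _)); set S := ereal_sup _ => Soo.
have mC t i : 0 <= t -> measurable_fun setT (fun w => Z t w i 0).
  by move=> t0; exact: measurable_coord (mZ t t0).
have msq t : 0 <= t -> measurable_fun setT (fun w => sq (Z t w)).
  move=> t0; apply: measurable_sum => i.
  by apply: measurable_funX; exact: mC.
have sqS t : 0 <= t -> (\int[P]_w (sq (Z t w))%:E <= S)%E.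
  move=> t0; apply: ereal_sup_ubound; exists t; first by rewrite /= in_itv/= t0.
  rewrite unlock; apply: eq_integral => w _.
  by rewrite -[2]/(2%:R) powR_mulrn ?sqrtr_ge0// enorm_sq.
have S0 : (0 <= S)%E.
  by apply: le_trans (sqS 0 (lexx 0)); apply: integral_ge0 => w _; rewrite lee_fin sq_ge0.
have SE : (fine S)%:E = S by rewrite fineK// ge0_fin_numE.
have lsq t : 0 <= t -> L1 P (fun w => sq (Z t w)).
  move=> t0; apply/integrableP; split; first exact/measurable_EFinP/msq.
  apply: le_lt_trans Soo; apply: le_trans (sqS t t0).
  by under eq_integral do rewrite /= ger0_norm ?sq_ge0//.
exists (fine S) => t i t0.
have l2 : L2 P (fun w => Z t w i 0).
  split; first exact: mC.
  apply: L1_le (lsq t t0) => [|w]; first exact/measurable_funX/mC.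
  by rewrite !ger0_norm ?sqr_ge0 ?sq_ge0// ge_coord_sq.
split => //; apply: (@le_trans _ _ (Ex P (fun w => sq (Z t w)))).
  by apply: Ex_le => [| |w]; [exact: l2.2|exact: lsq|exact: ge_coord_sq].
by rewrite -lee_fin -integral_Ex ?SE; [exact: sqS|exact: lsq].
Qed.

Context {p k r : nat} (theta0 : 'cV[R]_(param_dim p k))
  (S0 : 'M[R]_(k, r)) (W : R -> Om -> 'cV[R]_r) (Bm : 'I_p -> R -> Om -> R).
Hypothesis W_wiener : wiener_vec P W.
Hypothesis B_wiener : forall i, wiener P (Bm i).
Hypothesis W_B : indep_family P (fun o : option 'I_p =>
  if o is Some i then sigma_process `[0, +oo[ (Bm i)
  else sigma_process (E := borel R r) `[0, +oo[ W).

Let V := merged_coord W Bm.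

Let Vw := merged_wiener W_wiener B_wiener.

Let Vi := merged_indep W_wiener W_B.

Context (b0 : 'cV[R]_k -> 'cV[R]_k) (B0 : 'I_p -> R -> R)
  (c1 : 'cV[R]_k) (c2 : 'cV[R]_p) (f : R -> Om -> 'cV[R]_k) (e : R -> Om -> 'cV[R]_p).
Hypothesis mf : forall t, 0 <= t -> measurable_fun setT (f t : Om -> borel R k).
Hypothesis me : forall t, 0 <= t -> measurable_fun setT (e t : Om -> borel R p).
Hypothesis f_sde : forall j : 'I_k, solves_sde P (c1 j 0)
  (fun t w => b0 (f t w) j 0) (fun t w => (S0 *m W t w) j 0) (fun t w => f t w j 0).
Hypothesis e_sde : forall i : 'I_p, solves_sde P (c2 i 0)
  (fun t w => B0 i (e t w i 0)) (fun t w => par_sigma theta0 i * Bm i t w)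
  (fun t w => e t w i 0).
Hypothesis b0_lip : exists2 C : R, 0 < C &
  forall x y, enorm (b0 x - b0 y) <= C * enorm (x - y).
Hypothesis B0_lip : exists2 C : R, 0 < C &
  forall i x y, `|B0 i x - B0 i y| <= C * `|x - y|.
Hypothesis f_moments : bounded_moments P f.
Hypothesis e_moments : bounded_moments P e.

(** The noise coefficients of the factor and error equations over the common noise.
    [Lambda theta0 *m lf + le] is [load S0 theta0]. *)
Let lf : 'M[R]_(k, r + p) := row_mx S0 0.

Let le : 'M[R]_(p, r + p) := row_mx 0 (diag_mx (\row_i par_sigma theta0 i)).

(** The factor [sqrt k] in the constant converts a Lipschitz bound for the Euclidean norm into one
    for the sup norm. *)
Lemma factor_drifts j : drifts P V (fun s t => drift V lf f s t j).
Proof.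
have [M fM] := moments_L2 mf f_moments; have [C C0 lip] := b0_lip.
have mV t w : (\col_a V a t w) = merged W Bm t w by apply/colP => a; rewrite mxE.
apply: (@sde_drifts _ _ _ P _ V Vw Vi _ b0 (C * Num.sqrt k%:R) _ _ lf
  (fun t w => S0 *m W t w) f c1 M) => //.
- by rewrite mulr_ge0 ?sqrtr_ge0// ltW.
- move=> x y; apply: le_trans (mxnorm_enorm _) (le_trans (lip x y) _).
  by rewrite -mulrA ler_pM2l// enorm_mxnorm.
- move=> t w i; rewrite big_split_ord /= [X in _ = _ + X]big1 ?addr0 => [|j' _].
    by rewrite mxE; apply: eq_bigr => a _; rewrite /V /merged_coord col_mxEu row_mxEl.
  by rewrite row_mxEr mxE mul0r.
Qed.

(** The scalar equations are stacked into one vector equation whose drift acts coordinatewise; in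
    the sup norm the Lipschitz constant is unchanged. *)
Lemma error_drifts i : drifts P V (fun s t => drift V le e s t i).
Proof.
have [M eM] := moments_L2 me e_moments; have [C C0 lip] := B0_lip.
apply: (@sde_drifts _ _ _ P _ V Vw Vi _ (fun x => \col_i B0 i (x i 0)) C _ _ le
  (fun t w => \col_i (par_sigma theta0 i * Bm i t w)) e c2 M) => //.
- exact: ltW.
- move=> x y; apply: le_mxnorm => [|i']; first by rewrite mulr_ge0// ltW.
  rewrite !mxE; apply: le_trans (lip _ _ _) _; rewrite ler_pM2l//.
  by have := coord_mxnorm (x - y) i' 0; rewrite !mxE.
- move=> t w i'; rewrite mxE big_split_ord /= big1 ?add0r => [|j _]; last first.
    by rewrite row_mxEl mxE mul0r.
  rewrite (bigD1 i')//= big1 ?addr0 => [|j ji].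
    by rewrite row_mxEr /V /merged_coord col_mxEd !mxE eqxx mulr1n.
  by rewrite row_mxEr !mxE eq_sym (negbTE ji) mulr0n mul0r.
- move=> i'; apply: filterS (e_sde i') => w [cw ew]; split => // t t0.
  by rewrite mxE (ew t t0); congr (_ + _ + _); apply: eq_Rintegral => s _; rewrite mxE.
Qed.

Context (X : R -> Om -> 'cV[R]_p).
Hypothesis XE : forall t w, 0 <= t -> X t w = Lambda theta0 *m f t w + e t w.

Lemma drifts_ext (D D' : R -> R -> Om -> R) :
  (forall s t, 0 <= s -> s <= t -> D s t = D' s t) -> drifts P V D -> drifts P V D'.
Proof.
move=> DD' [c c0 h]; exists c => // s t s0 st ts.
by rewrite -DD'//; exact: h.
Qed.

Lemma observed_drifts c : drifts P V (fun s t => residual V (load S0 theta0) X s t c).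
Proof.
pose D s t w := \sum_j Lambda theta0 c j * drift V lf f s t j w + drift V le e s t c w.
apply: (@drifts_ext D); last first.
  apply: driftsD; last exact: error_drifts.
  by apply: drifts_sum => j; apply: driftsZ; exact: factor_drifts.
move=> s t s0 st; apply/funext => w; rewrite /D /residual /drift.
have t0 : 0 <= t by exact: le_trans st.
rewrite !XE// 2!mxE [(Lambda theta0 *m f s w + _) c 0]mxE [(Lambda theta0 *m f s w) c 0]mxE.
have -> : noise V (load S0 theta0 c) s t w =
    \sum_j Lambda theta0 c j * noise V (lf j) s t w + noise V (le c) s t w.
  have -> : load S0 theta0 = Lambda theta0 *m lf + le.
    by rewrite mul_mx_row mulmx0 add_row_mx addr0 add0r.
  rewrite /noise; under [X in _ = X + _]eq_bigr do rewrite mulr_sumr.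
  rewrite exchange_big -big_split; apply: eq_bigr => a _ /=.
  rewrite !mxE mulrDl mulr_suml; congr (_ + _).
  by apply: eq_bigr => j _; rewrite mulrA.
under eq_bigr do rewrite !mulrBr.
rewrite !sumrB /=.
set a := \sum_j _; set b := \sum_j _; set u := \sum_j _.
by ring.
Qed.

End observed_process.

(** * The realized covariance along the sampling scheme *)

Section realized_covariance_limits.
Context {R : realType} {d : measure_display} {Om : measurableType d}
  (P : probability Om R) (I : finType) (V : I -> R -> Om -> R).
Hypothesis V_wiener : forall i, wiener P (V i).
Hypothesis V_indep : indep_family P (fun i => sigma_process `[0, +oo[ (V i)).
Context {p : nat} (L : 'I_p -> I -> R) (X : R -> Om -> 'cV[R]_p).
Hypothesis X_drifts : forall c, drifts P V (fun s t => residual V L X s t c).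
Context (h : nat -> R).
Hypothesis h_to0 : h @ \oo --> (0 : R).
Hypothesis nh_tooo : n%:R * h n @[n --> \oo] --> pinfty_nbhs R.

(** Positivity of the steps is not assumed for every [n]; for large [n] it follows from
    [n h -> +oo]. *)
Lemma step_good : \forall n \near \oo, [/\ 0 < h n, h n <= 1 & (0 < n)%N].
Proof.
have h1 : \forall n \near \oo, 0 < n%:R * h n.
  by move/cvgryPgt : nh_tooo; apply.
have h2 : \forall n \near \oo, `|0 - h n| < 1 by move/cvgrPdist_lt : h_to0; apply.
apply: filterS3 h1 h2 (nbhs_infty_gt 0) => n nh h1n n0; split => //.
  by rewrite pmulr_rgt0 ?ltr0n in nh.
by move: h1n; rewrite sub0r normrN => /ltW; apply: le_trans; exact: ler_norm.
Qed.

Let cov c e := \sum_a L c a * L e a.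

Let main n c e w := main_term V L (h n) n c e w.

Let Q n w := realized_cov (h n) n (X ^~ w).

(** Choice turns the decomposition into sequences of variables; at indices with an inadmissible step
    the terms are 0 and nothing is claimed. *)
Let decomp : exists A B : nat -> 'I_p -> 'I_p -> Om -> R, exists2 K, 0 <= K &
  forall n, 0 < h n -> h n <= 1 -> (0 < n)%N -> forall c e,
  [/\ L2 P (A n c e) /\ Ex P (fun w => A n c e w ^+ 2) <= K * (h n / n%:R),
      L1 P (B n c e) /\ Ex P (fun w => `|B n c e w|) <= K * h n &
      forall w, Q n w c e = cov c e + main n c e w + A n c e w + B n c e w].
Proof.
have [K K0 hK] := realized_cov_decomp V_wiener V_indep X_drifts.
have /choice[AB hAB] : forall x : nat * ('I_p * 'I_p), exists AB : (Om -> R) * (Om -> R),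
    0 < h x.1 -> h x.1 <= 1 -> (0 < x.1)%N ->
    [/\ L2 P AB.1 /\ Ex P (fun w => AB.1 w ^+ 2) <= K * (h x.1 / x.1%:R),
      L1 P AB.2 /\ Ex P (fun w => `|AB.2 w|) <= K * h x.1 &
      forall w, Q x.1 w x.2.1 x.2.2 =
        cov x.2.1 x.2.2 + main x.1 x.2.1 x.2.2 w + AB.1 w + AB.2 w].
  move=> [n [c e]] /=; have [[h0 [h1 n0]]|ng] := pselect (0 < h n /\ h n <= 1 /\ (0 < n)%N).
    by have [A [B hABn]] := hK _ _ h0 h1 n0 c e; exists (A, B).
  by exists (cst 0, cst 0) => h0 h1 n0; exfalso; apply: ng.
exists (fun n c e => (AB (n, (c, e))).1), (fun n c e => (AB (n, (c, e))).2), K => //.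
by move=> n h0 h1 n0 c e; exact: (hAB (n, (c, e))).
Qed.

Let var c e := 2 * \sum_a \sum_b cov_form L c e a b ^+ 2.

Let main_moments n c e : 0 < h n -> (0 < n)%N ->
  L2 P (main n c e) /\ Ex P (fun w => main n c e w ^+ 2) = n%:R^-1 * var c e.
Proof.
move=> h0 n0; have [l E] := quad_sum_var V_wiener V_indep h0 n (cov_form_sym L c e).
split; first exact: L2Zl.
under [X in Ex P X]eq_fun do rewrite exprMn.
rewrite ExZl; last exact: l.2.
by rewrite E -/(var c e) expr2 -mulrA mulKf// pnatr_eq0 -lt0n.
Qed.

Lemma main_tight c e : tight P (fun n w => Num.sqrt n%:R * main_term V L (h n) n c e w).
Proof.
apply: (@tight_L2 _ _ _ _ _ (var c e)); apply: filterS step_good => n [h0 _ n0].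
have [l E] := main_moments c e h0 n0; split; first exact: L2Zl.
under [X in Ex P X]eq_fun do rewrite exprMn.
rewrite ExZl; last exact: l.2.
by rewrite E sqr_sqrtr// mulVKf// pnatr_eq0 -lt0n.
Qed.

Let natV_to0 : (n%:R^-1 : R) @[n --> \oo] --> (0 : R).
Proof. by rewrite -(cvg_shiftS (fun n => n%:R^-1 : R)); exact: cvg_harmonic. Qed.

Let to0cM (a : nat -> R) c : a n @[n --> \oo] --> (0 : R) -> c * a n @[n --> \oo] --> (0 : R).
Proof. by move=> a0; rewrite -(mulr0 c); apply: cvgMr. Qed.

Lemma realized_cov_to0 c e :
  to0 P (fun n w => realized_cov (h n) n (X ^~ w) c e - \sum_a L c a * L e a).
Proof.
have [A [B [K K0 AB]]] := decomp.
apply: (@to0_ext _ _ _ _ (fun n w => main n c e w + (A n c e w + B n c e w))).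
  apply: filterS step_good => n [h0 h1 n0] w; have [_ _ E] := AB n h0 h1 n0 c e.
  by rewrite -/(Q n w) E -/(cov c e); ring.
apply: to0D; last apply: to0D.
- apply: (to0_L2 (to0cM (var c e) natV_to0)); apply: filterS step_good => n [h0 h1 n0].
  by have [l ->] := main_moments c e h0 n0; rewrite mulrC.
- apply: (to0_L2 (to0cM K h_to0)); apply: filterS step_good => n [h0 h1 n0].
  have [[l E] _ _] := AB n h0 h1 n0 c e; split => //; apply: le_trans E _.
  by rewrite ler_wpM2l// ler_pdivrMr ?ltr0n// ler_peMr ?ler1n// ltW.
- apply: (to0_L1 (to0cM K h_to0)); apply: filterS step_good => n [h0 h1 n0].
  by have [_ l _] := AB n h0 h1 n0 c e.
Qed.

(** After scaling, [A] has second moment of order [n (h / n) = h] and [B] first moment of order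
    [sqrt n h], the square root of [n h^2]. The extra rate condition is what removes [B]. *)
Lemma realized_cov_expansion c e : n%:R * h n ^+ 2 @[n --> \oo] --> (0 : R) ->
  to0 P (fun n w => Num.sqrt n%:R *
    (realized_cov (h n) n (X ^~ w) c e - \sum_a L c a * L e a
     - main_term V L (h n) n c e w)).
Proof.
move=> nh2; have [A [B [K K0 AB]]] := decomp.
have snh : Num.sqrt (n%:R * h n ^+ 2) @[n --> \oo] --> (0 : R).
  rewrite -[X in _ --> X](@sqrtr0 R).
  by apply: (cvg_comp _ _ nh2); exact: sqrt_continuous.
apply: (@to0_ext _ _ _ _ (fun n w => Num.sqrt n%:R * A n c e w + Num.sqrt n%:R * B n c e w)).
  apply: filterS step_good => n [h0 h1 n0] w; have [_ _ E] := AB n h0 h1 n0 c e.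
  by rewrite -/(Q n w) E -/(cov c e) -/(main n c e w); ring.
apply: to0D.
- apply: (to0_L2 (to0cM K h_to0)); apply: filterS step_good => n [h0 h1 n0].
  have [[l E] _ _] := AB n h0 h1 n0 c e; split; first exact: L2Zl.
  under [X in Ex P X]eq_fun do rewrite exprMn.
  rewrite ExZl; last exact: l.2.
  rewrite sqr_sqrtr//; apply: le_trans (ler_wpM2l _ E) _ => //.
  by rewrite mulrCA [n%:R * (h n / _)]mulrC divfK// pnatr_eq0 -lt0n.
- apply: (to0_L1 (to0cM K snh)); apply: filterS step_good => n [h0 h1 n0].
  have [_ [l E] _] := AB n h0 h1 n0 c e; split; first exact: L1Zl.
  under [X in Ex P X]eq_fun do rewrite normrM ger0_norm ?sqrtr_ge0//.
  rewrite ExZl; last exact: L1_norm.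
  rewrite sqrtrM// sqrtr_sqr ger0_norm ?(ltW h0)//.
  by rewrite mulrCA ler_wpM2l ?sqrtr_ge0.
Qed.

End realized_covariance_limits.

(** * The estimator *)

Section efficient_variance.
Context {R : realType} {p k r : nat}.
Implicit Type theta : 'cV[R]_(param_dim p k).

(** The sandwich variance collapses because the weight is the inverse of the covariance. *)
Lemma gain_Wmx theta (S : 'M[R]_(k, r)) : par_Sff theta = S *m S^T ->
  (forall i, 0 < par_sigma theta i) ->
  (Delta theta)^T *m invmx (Wmx theta) *m Delta theta \in unitmx ->
  gain theta *m Wmx theta *m (gain theta)^T =
  invmx ((Delta theta)^T *m invmx (Wmx theta) *m Delta theta).
Proof.
move=> hS s0 uH; have uW := Wmx_unit hS s0.
set H := _ *m _ *m _ in uH *.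
have sW : (invmx (Wmx theta))^T = invmx (Wmx theta) by rewrite trmx_inv Wmx_sym.
have sH : H^T = H by rewrite /H !trmx_mul trmxK sW mulmxA.
rewrite /gain -/H mulmxKV// !trmx_mul trmxK sW trmx_inv sH.
have -> : invmx H *m (Delta theta)^T *m (invmx (Wmx theta) *m (Delta theta *m invmx H)) =
    invmx H *m H *m invmx H by rewrite /H !mulmxA.
by rewrite mulVmx// mul1mx.
Qed.

Lemma gain_root theta (S : 'M[R]_(k, r)) : par_Sff theta = S *m S^T ->
  (forall i, 0 < par_sigma theta i) ->
  let A := Num.sqrt 2 *: (gain theta *m Wroot S theta) in
  A *m A^T = gain theta *m Wmx theta *m (gain theta)^T.
Proof.
move=> hS s0 /=; rewrite linearZ /= -scalemxAl -scalemxAr scalerA -expr2 sqr_sqrtr//.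
by rewrite (Wmx_root hS s0) trmx_mul -scalemxAr -scalemxAl !mulmxA.
Qed.

(** Matches the probabilistic side, a combination of entrywise products of increments, with the
    coefficient matrix that occurs in [Wmx_form]. *)
Lemma cov_form_dual (L : 'M[R]_(p, r + p)) (v : 'cV[R]_(vech_dim p)) a b :
  \sum_s v s 0 * cov_form L (lower_pos s).2 (lower_pos s).1 a b =
  (L^T *m vech_dual v *m L) a b.
Proof.
pose M : 'M[R]_p := \matrix_(i, j) cov_form L i j a b.
have sM : M^T = M by apply/matrixP => i j; rewrite !mxE /cov_form; field.
have -> : \sum_s v s 0 * cov_form L (lower_pos s).2 (lower_pos s).1 a b =
    (v^T *m vech M) 0 0 by rewrite mxE; apply: eq_bigr => s _; rewrite !mxE.
rewrite vech_dualE//.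
have sD i j : vech_dual v i j = vech_dual v j i.
  by have /matrixP/(_ j i) := dup_pinv_sym v; rewrite mxE.
pose T := \sum_i \sum_j L i a * vech_dual v i j * L j b.
have -> : (L^T *m vech_dual v *m L) a b = T.
  rewrite mxE /T exchange_big; apply: eq_bigr => j _; rewrite mxE mulr_suml.
  by apply: eq_bigr => i _; rewrite mxE.
have TE : T = \sum_i \sum_j L i b * vech_dual v i j * L j a.
  rewrite /T exchange_big; apply: eq_bigr => i _; apply: eq_bigr => j _.
  by rewrite sD; ring.
have -> : T = 2^-1 * (T + \sum_i \sum_j L i b * vech_dual v i j * L j a).
  by rewrite -TE; field.
rewrite /T -big_split mulr_sumr; apply: eq_bigr => i _.
rewrite -big_split mulr_sumr; apply: eq_bigr => j _ /=.
by rewrite [M i j]mxE /cov_form; field.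
Qed.

End efficient_variance.

(** * Consistency and asymptotic normality of the minimizer *)

Section estimator.
Context {R : realType} {d : measure_display} {Om : measurableType d}
  (P : probability Om R) {p k r : nat} (hkp : (k < p)%N)
  (Theta : set 'cV[R]_(param_dim p k)).
Hypothesis Theta_compact : compact Theta.
Hypothesis Theta_Sff : forall theta, Theta theta ->
  exists S : 'M[R]_(k, r), par_Sff theta = S *m S^T.
Context (theta0 : 'cV[R]_(param_dim p k)).
Hypothesis htheta0 : Theta° theta0.
Context (S0 : 'M[R]_(k, r)).
Hypothesis hS0 : par_Sff theta0 = S0 *m S0^T.
Hypothesis sigma_pos : forall theta, Theta theta -> forall i, 0 < par_sigma theta i.
Hypothesis identifiable : forall theta, Theta theta ->
  Sigma theta = Sigma theta0 -> theta = theta0.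
Hypothesis Delta_rank : \rank (Delta theta0) = param_dim p k.
Context (V : 'I_(r + p) -> R -> Om -> R).
Hypothesis V_wiener : forall i, wiener P (V i).
Hypothesis V_indep : indep_family P (fun i => sigma_process `[0, +oo[ (V i)).
Context (X : R -> Om -> 'cV[R]_p).
Hypothesis X_drifts : forall c,
  drifts P V (fun s t => residual V (load S0 theta0) X s t c).
Context (h : nat -> R).
Hypothesis h_to0 : h @ \oo --> (0 : R).
Hypothesis nh_tooo : n%:R * h n @[n --> \oo] --> pinfty_nbhs R.
Context (theta_hat : nat -> Om -> 'cV[R]_(param_dim p k)).
Hypothesis theta_hat_meas : forall n,
  measurable_fun setT (theta_hat n : Om -> borel R (param_dim p k)).
Hypothesis theta_hat_min : forall n w,
  min_contrast Theta (realized_cov (h n) n (X ^~ w)) (theta_hat n w).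

Let L := load S0 theta0.

Let sigma0_pos i : 0 < par_sigma theta0 i.
Proof. by apply: sigma_pos; exact: Theta_center htheta0. Qed.

Let z n w := vech (realized_cov (h n) n (X ^~ w)) - vech (Sigma theta0).

Let zE n w s : z n w s 0 =
  realized_cov (h n) n (X ^~ w) (lower_pos s).2 (lower_pos s).1
  - \sum_a L (lower_pos s).2 a * L (lower_pos s).1 a.
Proof.
rewrite /z (Sigma_load hS0 sigma0_pos) mxE [X in X + _]mxE; congr (_ + _).
rewrite 3!mxE; congr (- _); apply: eq_bigr => a _; congr (_ * _).
by rewrite mxE.
Qed.

Let z_to0 s : to0 P (fun n w => z n w s 0).
Proof.
under eq_fun do under eq_fun do rewrite zE.
exact: realized_cov_to0.
Qed.

Let z_meas : \forall n \near \oo, forall s, measurable_fun setT (fun w => z n w s 0).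
Proof.
have hs s : \forall n \near \oo, measurable_fun setT (fun w => z n w s 0).
  by apply: filterS (z_to0 s ltr01 ltr01) => n [].
exact: filter_forall hs.
Qed.

Let sqz_to0 : to0 P (fun n w => sq (z n w)).
Proof. by apply: to0_sum => s; exact: to0_sqr. Qed.

Lemma measurable_mxnorm q (Y : Om -> 'cV[R]_q) :
  (forall i, measurable_fun setT (fun w => Y w i 0)) -> measurable_fun setT (fun w => `|Y w|).
Proof.
move=> mY.
have -> : (fun w => `|Y w|) = (fun w => \big[Num.max/0]_(ij : 'I_q * 'I_1) `|Y w ij.1 ij.2|).
  by apply/funext => w; rewrite {1}/Num.Def.normr /= mx_normrE.
elim: (index_enum _) => [|ij s IH].
  by under eq_fun do rewrite big_nil; exact: measurable_cst.
under eq_fun do rewrite big_cons; apply: measurable_maxr => //.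
by rewrite (ord1 ij.2); apply: measurableT_comp.
Qed.

(** On measurable events the outer measure in [cvg_prob] is [P] itself. *)
Lemma to0_cvg_prob q (Y : nat -> Om -> 'cV[R]_q) c :
  (forall n, measurable_fun setT (fun w => `|Y n w - c|)) ->
  to0 P (fun n w => `|Y n w - c|) -> cvg_prob P \oo Y c.
Proof.
move=> mY hY eps eps0.
have mset n : measurable [set w | eps <= `|Y n w - c|].
  by rewrite -[X in measurable X]setTI; apply: measurable_fun_le.
apply/fine_cvgP; split.
  by apply: nearW => n; rewrite measurable_mu_extE// fin_num_measure.
apply/cvgrPdist_le => e e0; apply: filterS (hY _ _ eps0 e0) => n [_].
under eq_set do rewrite normr_id.
rewrite /= measurable_mu_extE// sub0r normrN ger0_norm ?fine_ge0//.
by rewrite -lee_fin fineK// fin_num_measure.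
Qed.

Lemma estimator_consistent : cvg_prob P \oo theta_hat theta0.
Proof.
have mn n : measurable_fun setT (fun w => `|theta_hat n w - theta0|).
  apply: measurable_mxnorm => i; under eq_fun do rewrite !mxE.
  by apply: measurable_funB => //; exact: measurable_coord.
apply: to0_cvg_prob => //.
(* With the tight sequence constant equal to 1, the comparison is plain continuity of the minimizer
   at [z = 0]. *)
apply: (@to0_small _ _ _ _ _ (fun _ _ => 1) (fun n w => sq (z n w))) => //.
- exact: nearW.
- by apply: (@tight_L2 _ _ _ _ _ 1); apply: nearW => n; split; [exact: L2_cst|rewrite expr1n Ex_cst].
- move=> eps eps0; have e2 : 0 < eps ^+ 2 by rewrite exprn_gt0.
  have [del del0 hd] := min_contrast_consistent hkp Theta_compact Theta_Sff htheta0
    sigma_pos identifiable e2.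
  exists del => // n w; rewrite ger0_norm ?sq_ge0// => zd.
  rewrite normr_id normr1 mulr1 -(@ler_pXn2r _ 2)// ?nnegrE ?(ltW eps0)//.
  exact: le_trans (mxnorm_sq _) (ltW (hd _ _ (theta_hat_min n w) zd)).
Qed.

Hypothesis nh2_to0 : n%:R * h n ^+ 2 @[n --> \oo] --> (0 : R).

Let main s n w := main_term V L (h n) n (lower_pos s).2 (lower_pos s).1 w.

Let rest_to0 s : to0 P (fun n w => Num.sqrt n%:R * (z n w s 0 - main s n w)).
Proof.
under eq_fun do under eq_fun do rewrite zE.
exact: realized_cov_expansion.
Qed.

Let z_tight s : tight P (fun n w => Num.sqrt n%:R * z n w s 0).
Proof.
have -> : (fun n w => Num.sqrt n%:R * z n w s 0) =
    (fun n w => Num.sqrt n%:R * (z n w s 0 - main s n w) + Num.sqrt n%:R * main s n w).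
  by apply/funext => n; apply/funext => w; rewrite -mulrDr subrK.
by apply: tightD; [exact/to0_tight|exact: main_tight].
Qed.

Let rho n w := Num.sqrt n%:R *: (theta_hat n w - theta0 - gain theta0 *m z n w).

Let rho_meas : \forall n \near \oo, forall i, measurable_fun setT (fun w => rho n w i 0).
Proof.
apply: filterS z_meas => n mz i; under eq_fun do rewrite !mxE.
apply: measurable_funM => //; apply: measurable_funB.
  by apply: measurable_funB => //; exact: measurable_coord.
by apply: measurable_sum => s; exact: measurable_funM.
Qed.

(** The deterministic expansion bounds [sq (rho n w)] by [eps] times [n * sq (z n w)] once [z] is
    small; the latter is tight and [eps] is arbitrary. *)
Let rho_to0 i : to0 P (fun n w => rho n w i 0).
Proof.
have m1 : \forall n \near \oo, measurable_fun setT (fun w => rho n w i 0).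
  by apply: filterS rho_meas => n; apply.
apply: (@to0_dom _ _ _ _ _ (fun n w => sq (rho n w))) => // [n w|].
  by rewrite [leRHS]ger0_norm ?sq_ge0// ge_coord_sq.
apply: (@to0_small _ _ _ _ _ (fun n w => \sum_s (Num.sqrt n%:R * z n w s 0) ^+ 2)
  (fun n w => sq (z n w))) => //.
- apply: filterS rho_meas => n mr.
  by apply: measurable_sum => j; exact: measurable_funX.
- by apply: tight_sum => s; exact: tight_sqr.
- move=> eps eps0.
  have [del del0 hd] := min_contrast_expansion hkp Theta_compact Theta_Sff htheta0
    sigma_pos identifiable Delta_rank eps0.
  exists del => // n w; rewrite [X in X < _]ger0_norm ?sq_ge0// => zd.
  rewrite ger0_norm ?sq_ge0// ger0_norm ?sumr_ge0// => [|s _]; last exact: sqr_ge0.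
  have -> : \sum_s (Num.sqrt n%:R * z n w s 0) ^+ 2 = n%:R * sq (z n w).
    by rewrite /sq mulr_sumr; apply: eq_bigr => s _; rewrite exprMn sqr_sqrtr.
  rewrite sqZ sqr_sqrtr// mulrCA ler_wpM2l//.
  exact: hd (theta_hat_min n w) zd.
Qed.

Let Z n w := Num.sqrt n%:R *: (theta_hat n w - theta0).

Let ZE n w : Z n w = rho n w + gain theta0 *m (Num.sqrt n%:R *: z n w).
Proof. by rewrite /rho -scalemxAr -scalerDr subrK. Qed.

Let Z_meas n i : measurable_fun setT (fun w => Z n w i 0).
Proof.
under eq_fun do rewrite !mxE; apply: measurable_funM => //.
by apply: measurable_funB => //; exact: measurable_coord.
Qed.

Let Z_tight : tight P (fun n w => sq (Z n w)).
Proof.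
apply: tight_sum => i; apply: tight_sqr.
have -> : (fun n w => Z n w i 0) = (fun n w => rho n w i 0 +
    \sum_s gain theta0 i s * (Num.sqrt n%:R * z n w s 0)).
  apply/funext => n; apply/funext => w; rewrite ZE mxE; congr (_ + _).
  rewrite [LHS]mxE; apply: eq_bigr => s _; congr (_ * _); exact: mxE.
apply: tightD; first exact/to0_tight.
by apply: tight_sum => s; exact: tightZ.
Qed.

Let form v a b : R := (L^T *m vech_dual v *m L) a b.

Let formE v a b : form v a b =
  \sum_s v s 0 * cov_form L (lower_pos s).2 (lower_pos s).1 a b.
Proof. by rewrite cov_form_dual. Qed.

Let form_sym v a b : form v a b = form v b a.
Proof. by rewrite !formE; apply: eq_bigr => s _; rewrite cov_form_sym. Qed.

Let quad_form s t v w : quad V s t (form v) w =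
  \sum_l v l 0 * quad V s t (cov_form L (lower_pos l).2 (lower_pos l).1) w.
Proof.
rewrite /quad; under [RHS]eq_bigr do rewrite mulr_sumr.
rewrite [RHS]exchange_big; apply: eq_bigr => a _.
under [RHS]eq_bigr do rewrite mulr_sumr.
rewrite [RHS]exchange_big; apply: eq_bigr => b _.
rewrite formE mulr_suml.
by apply: eq_bigr => l _; rewrite mulrA.
Qed.

(** The part of the scaled error that survives: a normalized grid sum of independent quadratic
    forms, to which the cosine limit theorem applies. *)
Let leading v n w := (Num.sqrt n%:R)^-1 *
  \sum_(i < n) quad V (i%:R * h n) (i.+1%:R * h n) (form v) w.

Let leadingE v n w : (0 < n)%N -> leading v n w = \sum_s v s 0 * (Num.sqrt n%:R * main s n w).
Proof.
move=> n0; rewrite /leading; under eq_bigr do rewrite quad_form.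
rewrite exchange_big mulr_sumr; apply: eq_bigr => s _ /=.
rewrite -mulr_sumr mulrCA; congr (_ * _); rewrite /main /main_term mulrA; congr (_ * _).
have n1 : (0 : R) < n%:R by rewrite ltr0n.
have s1 : Num.sqrt n%:R != 0 :> R by rewrite gt_eqF// sqrtr_gt0.
by rewrite -[in n%:R^-1](@sqr_sqrtr _ n%:R)// expr2 invfM mulrA mulfV// mul1r.
Qed.

Let Z_leading u : to0 P (fun n w =>
  (u^T *m Z n w) 0 0 - leading ((gain theta0)^T *m u) n w).
Proof.
pose v := (gain theta0)^T *m u.
apply: (@to0_ext _ _ _ _ (fun n w => \sum_i u i 0 * rho n w i 0 +
    \sum_s v s 0 * (Num.sqrt n%:R * (z n w s 0 - main s n w)))).
  apply: filterS (nbhs_infty_gt 0) => n n0 w; rewrite leadingE//.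
  have uv : u^T *m gain theta0 = v^T by rewrite /v trmx_mul trmxK.
  rewrite ZE mulmxDr mulmxA uv -/v [in RHS]mxE -addrA.
  congr (_ + _); first by rewrite [RHS]mxE; apply: eq_bigr => i _; congr (_ * _); rewrite mxE.
  rewrite [X in _ = X - _]mxE -sumrB; apply: eq_bigr => s _.
  rewrite [v^T 0 s]mxE [(_ *: z n w) s 0]mxE; set zz := z n w s 0; ring.
apply: to0D; apply: to0_sum => i; exact: to0Z.
Qed.

Let sqrtV_to0 c : c / Num.sqrt n%:R @[n --> \oo] --> (0 : R).
Proof.
have i0 : (n%:R^-1 : R) @[n --> \oo] --> (0 : R).
  by rewrite -(cvg_shiftS (fun n => n%:R^-1 : R)); exact: cvg_harmonic.
have s0 : Num.sqrt (n%:R^-1 : R) @[n --> \oo] --> (0 : R).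
  by rewrite -[X in _ --> X](@sqrtr0 R); apply: (cvg_comp _ _ i0); exact: sqrt_continuous.
rewrite -(mulr0 c); under eq_fun do rewrite -sqrtrV//.
exact: cvgMr.
Qed.

Let leading_cos v (c : R) : Ex P (fun w => cos (leading v n w + c)) @[n --> \oo] -->
  expR (- \sum_a \sum_b form v a b ^+ 2) * cos c.
Proof.
have [C hC] := quad_clt V_wiener V_indep (form_sym v).
apply/cvgrPdist_le => e e0.
have /cvgrPdist_le/(_ _ e0) hs := sqrtV_to0 C.
apply: filterS2 hs (step_good h_to0 nh_tooo) => n hn [h0 _ n0].
rewrite distrC; under [X in Ex P X]eq_fun do rewrite addrC.
apply: le_trans (hC _ c _ h0 n0) _; apply: le_trans hn.
by rewrite sub0r normrN ler_norm.
Qed.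

Lemma estimator_clt : cvg_to_normal P
  (fun n w => Num.sqrt n%:R *: (theta_hat n w - theta0)) 0
  (invmx ((Delta theta0)^T *m invmx (Wmx theta0) *m Delta theta0)).
Proof.
(* Any member of the noise family can supply the normal variables of the limit law; an error noise
   is taken because [k < p] provides one. *)
pose i0 : 'I_(r + p) := rshift r (Ordinal (leq_ltn_trans (leq0n k) hkp)).
pose A := Num.sqrt 2 *: (gain theta0 *m Wroot S0 theta0).
pose mu := gauss_law (V_wiener i0) A.
have AE : A *m A^T = gain theta0 *m Wmx theta0 *m (gain theta0)^T.
  exact: gain_root.
have VE : A *m A^T = invmx ((Delta theta0)^T *m invmx (Wmx theta0) *m Delta theta0).
  rewrite AE; apply: (gain_Wmx hS0 sigma0_pos).
  have := hessian_unit hkp Theta_compact Theta_Sff htheta0 sigma_pos Delta_rank.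
  by apply.
exists mu; first by rewrite -VE; exact: gauss_law_normal.
apply: weak_convergence.
- by move=> n; apply: measurable_cV => i; exact: Z_meas.
- move=> e e0; have [l l0 hl] := Z_tight e0.
  exists (Num.sqrt l); first by rewrite sqrtr_gt0.
  apply: filterS hl => n [_]; rewrite sqr_sqrtr ?(ltW l0)//.
  by under eq_set do rewrite ger0_norm ?sq_ge0//.
- by move=> e e0; exact: gauss_law_tight.
move=> u c; pose v := (gain theta0)^T *m u.
have -> : Ex mu (fun x : borel R (param_dim p k) => cos ((u^T *m x) 0 0 + c)) =
    expR (- \sum_a \sum_b form v a b ^+ 2) * cos c.
  rewrite gauss_law_cos; congr (expR (- _) * _).
  have -> : u^T *m (A *m A^T) *m u = v^T *m Wmx theta0 *m v.
    by rewrite AE /v [(_ *m u)^T]trmx_mul trmxK !mulmxA.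
  (* The 2 in [Wmx_form] cancels the one half in the normal transform, leaving the sum of squares in
     the exponent of [leading_cos]. *)
  rewrite (Wmx_form v v hS0 sigma0_pos) mulrC mulKf ?pnatr_eq0//.
have cl := @leading_cos v c.
have c0 : Ex P (fun w => cos ((u^T *m Z n w) 0 0 + c)) -
    Ex P (fun w => cos (leading v n w + c)) @[n --> \oo] --> (0 : R).
  apply: cos_to0.
  - move=> n; apply: measurable_funD => //; under eq_fun do rewrite mxE.
    by apply: measurable_sum => i; apply: measurable_funM.
  - apply: filterS (step_good h_to0 nh_tooo) => n [h0 _ n0].
    apply: measurable_funD => //; apply: measurable_funM => //.
    exact: (quad_sum_var V_wiener V_indep h0 n (form_sym v)).1.1.
  - apply: to0_ext (Z_leading u); apply: nearW => n w.
    by rewrite -/v; ring.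
have := @cvgD _ _ _ _ _ _ _ _ _ c0 cl; rewrite add0r.
rewrite (_ : _ + _ = (fun n => Ex P (fun w => cos ((u^T *m Z n w) 0 0 + c)))).
  by apply.
by apply/funext => n /=; rewrite fctE subrK.
Qed.

End estimator.

Theorem theorem2 (R : realType) (p k r : nat)
  (hk1 : (1 <= k)%N) (hkp : (k < p)%N) (hr : (1 <= r)%N)
  (d : measure_display) (Om : measurableType d) (P : probability Om R)
  (* parameter space and true parameter *)
  (Theta : set 'cV[R]_(param_dim p k))
  (Theta_convex : convex_set (Theta : set (convex_lmodType 'cV[R]_(param_dim p k))))
  (Theta_compact : compact Theta)
  (Theta_Sff : forall theta, Theta theta ->
     exists S : 'M[R]_(k, r), par_Sff theta = S *m S^T)
  (theta0 : 'cV[R]_(param_dim p k)) (htheta0 : Theta° theta0)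
  (S0 : 'M[R]_(k, r)) (hS0 : par_Sff theta0 = S0 *m S0^T)
  (* driving noises *)
  (W : R -> Om -> 'cV[R]_r) (Bm : 'I_p -> R -> Om -> R)
  (hW : wiener_vec P W) (hBm : forall i, wiener P (Bm i))
  (hWB : indep_family P (fun o : option 'I_p =>
     if o is Some i then sigma_process `[0, +oo[ (Bm i)
     else sigma_process (E := borel R r) `[0, +oo[ W))
  (* factor and error processes *)
  (b0 : 'cV[R]_k -> 'cV[R]_k) (B0 : 'I_p -> R -> R)
  (c1 : 'cV[R]_k) (c2 : 'cV[R]_p)
  (f : R -> Om -> 'cV[R]_k) (e : R -> Om -> 'cV[R]_p)
  (mf : forall t, 0 <= t -> measurable_fun setT (f t : Om -> borel R k))
  (me : forall t, 0 <= t -> measurable_fun setT (e t : Om -> borel R p))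
  (hf : forall j : 'I_k, solves_sde P (c1 j 0)
     (fun t w => b0 (f t w) j 0) (fun t w => (S0 *m W t w) j 0)
     (fun t w => f t w j 0))
  (he : forall i : 'I_p, solves_sde P (c2 i 0)
     (fun t w => B0 i (e t w i 0)) (fun t w => par_sigma theta0 i * Bm i t w)
     (fun t w => e t w i 0))
  (* (i) *)
  (b0_lip : exists2 C : R, 0 < C &
     forall x y, enorm (b0 x - b0 y) <= C * enorm (x - y))
  (f_moments : bounded_moments P f)
  (b0_C4 : forall j, C4up (fun x => b0 x j 0))
  (* (ii) *)
  (pi_f : probability (borel R k) R) (f_ergodic : ergodic P f pi_f)
  (* (iii) *)
  (B0_lip : exists2 C : R, 0 < C &
     forall i x y, `|B0 i x - B0 i y| <= C * `|x - y|)
  (e_moments : bounded_moments P e)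
  (B0_C4 : forall i, C4up1 (B0 i))
  (* (iv) *)
  (sigma_pos : forall theta, Theta theta -> forall i, 0 < par_sigma theta i)
  (* (v) *)
  (pi_e : probability (borel R p) R) (e_ergodic : ergodic P e pi_e)
  (* (vi) *)
  (identifiable : forall theta, Theta theta ->
     Sigma theta = Sigma theta0 -> theta = theta0)
  (* (vii) *)
  (Delta_rank : \rank (Delta theta0) = param_dim p k)
  (* observations and estimator *)
  (h : nat -> R)
  (X : R -> Om -> 'cV[R]_p)
  (hX : forall t w, 0 <= t -> X t w = Lambda theta0 *m f t w + e t w)
  (theta_hat : nat -> Om -> 'cV[R]_(param_dim p k))
  (theta_hat_meas : forall n,
     measurable_fun setT (theta_hat n : Om -> borel R (param_dim p k)))
  (theta_hat_min : forall n w, Theta (theta_hat n w) /\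
     forall theta, Theta theta ->
       contrast (realized_cov (h n) n (X ^~ w)) (theta_hat n w)
       <= contrast (realized_cov (h n) n (X ^~ w)) theta)
  (h_to0 : h @ \oo --> (0 : R))
  (nh_tooo : n%:R * h n @[n --> \oo] --> pinfty_nbhs R) :
  cvg_prob P \oo theta_hat theta0 /\
  (n%:R * h n ^+ 2 @[n --> \oo] --> (0 : R) ->
   cvg_to_normal P
     (fun n w => Num.sqrt n%:R *: (theta_hat n w - theta0)) 0
     (invmx ((Delta theta0)^T *m invmx (Wmx theta0) *m Delta theta0))).
Proof.
have Vw := merged_wiener hW hBm; have Vi := merged_indep hW hWB.
have Xd := observed_drifts hW hBm hWB mf me hf he b0_lip B0_lip f_moments e_moments hX.
have min n w : min_contrast Theta (realized_cov (h n) n (X ^~ w)) (theta_hat n w).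
  exact: theta_hat_min.
split.
  exact: (estimator_consistent hkp Theta_compact Theta_Sff htheta0 hS0 sigma_pos
    identifiable Vw Vi Xd h_to0 nh_tooo theta_hat_meas min).
move=> nh2.
exact: (estimator_clt hkp Theta_compact Theta_Sff htheta0 hS0 sigma_pos
  identifiable Delta_rank Vw Vi Xd h_to0 nh_tooo theta_hat_meas min nh2).
Qed.
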